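(* Let $T=RCF$ (the theory of real closed fields) and let $G$ be the following group definable in $(\mathbb{R},+,\cdot)$. Let $H=SL_{2}(\mathbb{R})$, let $h:H\times H\to\mathbb{Z}$ be a $2$-cocycle with finite image, definable in $(\mathbb{R},+,\cdot)$ (i.e. for each $n$ in the image, $\{(x,y)\in H\times H: h(x,y)=n\}$ is semialgebraic), such that the set $\mathbb{Z}\times H$ with operation $(t_1,x_1)*(t_2,x_2)=(t_1+t_2+h(x_1,x_2),x_1x_2)$, together with projection to the second coordinate, is isomorphic to the universal cover $\widetilde{SL_{2}(\mathbb{R})}$ with its covering map to $SL_2(\mathbb{R})$. Writing the circle group $SO_2(\mathbb{R})$ additively, fix an element $g\in SO_2(\mathbb{R})$ of infinite order (with algebraic coordinates), and let $G$ be the set $SO_2(\mathbb{R})\times H$ with operation $(t_1,x_1)*(t_2,x_2)=(t_1+t_2+h(x_1,x_2)g,\ x_1x_2)$. Let $G_1=G(\bar M)$ be the interpretation of the same formulas in a saturated real closed field $\bar M=(K,+,\cdot)$. Then $G_1=G_1^{00}$, but $G_1\neq G_1^{000}$; in fact $G_1/G_1^{000}$ is naturally isomorphic to the quotient of the circle group $SO_2(\mathbb{R})$ by a dense cyclic subgroup.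
   Context: Such a cocycle $h$ exists (this is a known fact about the universal cover of $SL_2(\mathbb{R})$). For a group $G_1$ definable in a saturated model $\bar M$, ''bounded index'' means index smaller than the degree of saturation of $\bar M$; $G_1^{00}$ is the smallest type-definable subgroup of $G_1$ of bounded index and $G_1^{000}$ is the smallest subgroup of $G_1$ of bounded index invariant under automorphisms of $\bar M$ (in this NIP setting these do not depend on the choice of parameters). *)

(* Defs.v *)
From HB Require Import structures.
From mathcomp Require Import all_boot all_order all_algebra.
From mathcomp Require Import ring.
From mathcomp Require Import all_classical all_reals all_analysis.
Import numFieldNormedType.Exports.
Import Order.TTheory GRing.Theory Num.Theory.

Set Implicit Arguments.
Unset Strict Implicit.
Unset Printing Implicit Defensive.

Local Open Scope classical_set_scope.
Local Open Scope card_scope.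
Local Open Scope ring_scope.

Record SL2 (F : fieldType) :=
  MkSL2 { SL2val :> 'M[F]_2; SL2P : \det SL2val == 1 }.

HB.instance Definition _ (F : fieldType) := [isSub for @SL2val F].
HB.instance Definition _ (F : fieldType) := [Choice of SL2 F by <:].

Fact ord2E (i : 'I_2) : i = 0 \/ i = 1.
Proof. by case: i => [[|[|//]] lt]; [left | right]; apply: val_inj. Qed.

Fact sum2E (V : nmodType) (f : 'I_2 -> V) : \sum_i f i = f 0 + f 1.
Proof. by rewrite !big_ord_recl big_ord0 addr0; congr (_ + f _); apply: val_inj. Qed.

Fact det2E (F : comNzRingType) (M : 'M[F]_2) :
  \det M = M 0 0 * M 1 1 - M 0 1 * M 1 0.
Proof.
rewrite (expand_det_row _ 0) sum2E /cofactor !det_mx11 !mxE /=.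
have l0 : lift (0 : 'I_2) 0 = 1 by apply: val_inj.
have l1 : lift (1 : 'I_2) 0 = 0 by apply: val_inj.
by rewrite !l0 !l1 /= expr0 expr1; ring.
Qed.

Section SL2Group.
Variable F : fieldType.
Implicit Types A B C : SL2 F.

Fact SL2_unit A : SL2val A \in unitmx.
Proof. by rewrite unitmxE (eqP (SL2P A)) unitr1. Qed.

Fact SL2_one_subproof : \det (1%:M : 'M[F]_2) == 1.
Proof. by rewrite det1. Qed.

Fact SL2_mul_subproof A B : \det (SL2val A *m SL2val B) == 1.
Proof. by rewrite det_mulmx (eqP (SL2P A)) (eqP (SL2P B)) mulr1. Qed.

Fact SL2_inv_subproof A : \det (invmx (SL2val A)) == 1.
Proof. by rewrite det_inv (eqP (SL2P A)) invr1. Qed.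

Definition SL2_one := MkSL2 SL2_one_subproof.
Definition SL2_mul A B := MkSL2 (SL2_mul_subproof A B).
Definition SL2_inv A := MkSL2 (SL2_inv_subproof A).

Fact SL2_mulA : associative SL2_mul.
Proof. by move=> A B C; apply: val_inj; rewrite /= mulmxA. Qed.

Fact SL2_mul1 : left_id SL2_one SL2_mul.
Proof. by move=> A; apply: val_inj; rewrite /= mul1mx. Qed.

Fact SL2_mulr1 : right_id SL2_one SL2_mul.
Proof. by move=> A; apply: val_inj; rewrite /= mulmx1. Qed.

Fact SL2_mulV : left_inverse SL2_one SL2_inv SL2_mul.
Proof. by move=> A; apply: val_inj; rewrite /= mulVmx // SL2_unit. Qed.

Fact SL2_mulrV : right_inverse SL2_one SL2_inv SL2_mul.
Proof. by move=> A; apply: val_inj; rewrite /= mulmxV // SL2_unit. Qed.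

HB.instance Definition _ :=
  isGroup.Build (SL2 F) SL2_mulA SL2_mul1 SL2_mulr1 SL2_mulV SL2_mulrV.
End SL2Group.

(* The circle group is written additively: t1 + t2 is the matrix product. *)

Record SO2 (F : fieldType) := MkSO2 {
  SO2val :> 'M[F]_2;
  SO2P : (SO2val *m SO2val^T == 1%:M) && (\det SO2val == 1) }.

HB.instance Definition _ (F : fieldType) := [isSub for @SO2val F].
HB.instance Definition _ (F : fieldType) := [Choice of SO2 F by <:].

Section SO2Group.
Variable F : fieldType.
Implicit Types A B C : SO2 F.

Fact SO2_mul_tr A : SO2val A *m (SO2val A)^T = 1%:M.
Proof. by case/andP: (SO2P A) => /eqP. Qed.

Fact SO2_tr_mul A : (SO2val A)^T *m SO2val A = 1%:M.
Proof. exact: mulmx1C (SO2_mul_tr A). Qed.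

Fact SO2_det A : \det (SO2val A) = 1.
Proof. by case/andP: (SO2P A) => _ /eqP. Qed.

Fact SO2_zero_subproof :
  ((1%:M : 'M[F]_2) *m 1%:M^T == 1%:M) && (\det (1%:M : 'M[F]_2) == 1).
Proof. by rewrite trmx1 mulmx1 det1 !eqxx. Qed.

Fact SO2_add_subproof A B : let M := SO2val A *m SO2val B in
  (M *m M^T == 1%:M) && (\det M == 1).
Proof.
rewrite /= det_mulmx !SO2_det mulr1 eqxx andbT trmx_mul.
by rewrite mulmxA -(mulmxA _ (SO2val B)) SO2_mul_tr mulmx1 SO2_mul_tr.
Qed.

Fact SO2_opp_subproof A : let M := (SO2val A)^T in
  (M *m M^T == 1%:M) && (\det M == 1).
Proof. by rewrite /= trmxK det_tr SO2_tr_mul SO2_det !eqxx. Qed.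

Definition SO2_zero := MkSO2 SO2_zero_subproof.
Definition SO2_add A B := MkSO2 (SO2_add_subproof A B).
Definition SO2_opp A := MkSO2 (SO2_opp_subproof A).

Fact SO2_addA : associative SO2_add.
Proof. by move=> A B C; apply: val_inj; rewrite /= mulmxA. Qed.

Fact SO2_entries A :
  SO2val A 1 1 = SO2val A 0 0 /\ SO2val A 1 0 = - SO2val A 0 1.
Proof.
have /matrixP E := SO2_mul_tr A; have D := SO2_det A.
have := E 0 0; have := E 0 1.
rewrite !mxE !sum2E !mxE /= => e01 e00; rewrite det2E in D.
move: (SO2val A 0 0) (SO2val A 0 1) (SO2val A 1 0) (SO2val A 1 1) e01 e00 D.
move=> a b c d e01 e00 D; split.
  transitivity (d * (a * a + b * b)); first by rewrite e00 mulr1.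
  transitivity (a * (a * d - b * c) + b * (a * c + b * d)); first by ring.
  by rewrite D e01 mulr1 mulr0 addr0.
transitivity (c * (a * a + b * b)); first by rewrite e00 mulr1.
transitivity (a * (a * c + b * d) - b * (a * d - b * c)); first by ring.
by rewrite D e01 mulr1 mulr0 add0r.
Qed.

Fact SO2_addC : commutative SO2_add.
Proof.
move=> A B; apply: val_inj; apply/matrixP => i j /=.
have [A11 A10] := SO2_entries A; have [B11 B10] := SO2_entries B.
rewrite !mxE !sum2E.
by case: (ord2E i) => ->; case: (ord2E j) => ->;
  rewrite ?A11 ?A10 ?B11 ?B10; ring.
Qed.

Fact SO2_add0 : left_id SO2_zero SO2_add.
Proof. by move=> A; apply: val_inj; rewrite /= mul1mx. Qed.

Fact SO2_addN : left_inverse SO2_zero SO2_opp SO2_add.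
Proof. by move=> A; apply: val_inj; rewrite /= SO2_tr_mul. Qed.

HB.instance Definition _ :=
  GRing.isZmodule.Build (SO2 F) SO2_addA SO2_addC SO2_add0 SO2_addN.
End SO2Group.

Section BaseChange.
Variables (F L : fieldType) (iota : {rmorphism F -> L}).

Fact SL2_map_subproof (A : SL2 F) : \det (map_mx iota A) == 1.
Proof. by rewrite det_map_mx (eqP (SL2P A)) rmorph1. Qed.

Definition SL2_map (A : SL2 F) : SL2 L := MkSL2 (SL2_map_subproof A).

Fact SO2_map_subproof (A : SO2 F) : let M := map_mx iota A in
  (M *m M^T == 1%:M) && (\det M == 1).
Proof.
by rewrite /= map_trmx -map_mxM SO2_mul_tr map_mx1 det_map_mx SO2_det
  rmorph1 !eqxx.
Qed.

Definition SO2_map (A : SO2 F) : SO2 L := MkSO2 (SO2_map_subproof A).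
End BaseChange.

HB.instance Definition _ (R : realType) :=
  Topological.copy (SL2 R) (initial_topology (@SL2val R)).
HB.instance Definition _ (R : realType) :=
  Topological.copy (SO2 R) (initial_topology (@SO2val R)).

Definition cext_op (V : zmodType) (H : groupType) (c : H -> H -> V)
  (u v : V * H) : V * H := (u.1 + v.1 + c u.2 v.2, (u.2 * v.2)%g).

Definition cocycle2 (V : zmodType) (H : groupType) (c : H -> H -> V) : Prop :=
  forall x y z, c x y + c (x * y)%g z = c x (y * z)%g + c y z.

HB.structure Definition PreTopologicalGroup :=
  {E of Topological E & Group E}.

HB.mixin Record isTopologicalGroup E of PreTopologicalGroup E := {
  mulg_continuous : continuous (fun u : E * E => (u.1 * u.2)%g);
  invg_continuous : continuous (fun x : E => (x^-1)%g)
}.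

#[short(type="topologicalGroupType")]
HB.structure Definition TopologicalGroup :=
  {E of PreTopologicalGroup E & isTopologicalGroup E}.

Definition covering_map (E B : topologicalType) (p : E -> B) : Prop :=
  [/\ continuous p, range p = setT &
    forall b : B, exists U : set B, exists VV : set (set E),
      [/\ open U, U b, p @^-1` U = \bigcup_(V in VV) V,
          trivIset VV id &
          forall V, VV V -> [/\ open V, set_bij V U p &
            forall W, open W -> W `<=` V -> open (p @` W)]]].

Definition path_in (R : realType) (E : topologicalType) (f : R -> E) (x y : E) :=
  [/\ {within `[0, 1], continuous f}, f 0 = x & f 1 = y].

Definition simply_connected (R : realType) (E : topologicalType) : Prop :=
  (forall x y : E, exists f : R -> E, path_in f x y) /\
  (forall (x : E) (f : R -> E), path_in f x x ->
    exists h : R * R -> E,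
      [/\ {within `[0, 1] `*` `[0, 1], continuous h},
          forall s, s \in `[0, 1] -> h (s, 0) = f s,
          forall s, s \in `[0, 1] -> h (s, 1) = x &
          forall t, t \in `[0, 1] -> h (0, t) = x /\ h (1, t) = x]).

(* The universal cover is the simply connected topological group covering
   SL_2(R), determined up to isomorphism over SL_2(R); the isomorphism phi with
   it is one of abstract groups over SL_2(R). *)
Definition iso_universal_cover_SL2 (R : realType) (T : Type)
    (op : T -> T -> T) (pr : T -> SL2 R) : Prop :=
  exists (E : topologicalGroupType) (p : E -> SL2 R) (phi : T -> E),
    [/\ covering_map p, {morph p : x y / (x * y)%g}, simply_connected R E &
    [/\ bijective phi, {morph phi : u v / op u v >-> (u * v)%g} &
        forall u, p (phi u) = pr u]].

(* Formulas are the reified ring formulas of ssralg, whose constants are the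
   parameters.  Their inverse and unit test are definable from + and *. *)

Section FormulaMap.
Variables (S T : Type) (f : S -> T).

Fixpoint map_term (t : GRing.term S) : GRing.term T :=
  match t with
  | GRing.Var i => GRing.Var T i
  | GRing.Const c => GRing.Const (f c)
  | GRing.NatConst n => GRing.NatConst T n
  | GRing.Add t1 t2 => GRing.Add (map_term t1) (map_term t2)
  | GRing.Opp t1 => GRing.Opp (map_term t1)
  | GRing.NatMul t1 n => GRing.NatMul (map_term t1) n
  | GRing.Mul t1 t2 => GRing.Mul (map_term t1) (map_term t2)
  | GRing.Inv t1 => GRing.Inv (map_term t1)
  | GRing.Exp t1 n => GRing.Exp (map_term t1) n
  end.

Fixpoint map_formula (phi : GRing.formula S) : GRing.formula T :=
  match phi with
  | GRing.Bool b => GRing.Bool b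
  | GRing.Equal t1 t2 => GRing.Equal (map_term t1) (map_term t2)
  | GRing.Unit t1 => GRing.Unit (map_term t1)
  | GRing.And f1 f2 => GRing.And (map_formula f1) (map_formula f2)
  | GRing.Or f1 f2 => GRing.Or (map_formula f1) (map_formula f2)
  | GRing.Implies f1 f2 => GRing.Implies (map_formula f1) (map_formula f2)
  | GRing.Not f1 => GRing.Not (map_formula f1)
  | GRing.Exists i f1 => GRing.Exists i (map_formula f1)
  | GRing.Forall i f1 => GRing.Forall i (map_formula f1)
  end.
End FormulaMap.

Section FormulaOver.
Variables (S : Type) (A : set S).

Fixpoint term_over (t : GRing.term S) : Prop :=
  match t with
  | GRing.Var _ | GRing.NatConst _ => True
  | GRing.Const c => A c
  | GRing.Add t1 t2 | GRing.Mul t1 t2 => term_over t1 /\ term_over t2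
  | GRing.Opp t1 | GRing.NatMul t1 _ | GRing.Inv t1 | GRing.Exp t1 _ =>
      term_over t1
  end.

Fixpoint formula_over (phi : GRing.formula S) : Prop :=
  match phi with
  | GRing.Bool _ => True
  | GRing.Equal t1 t2 => term_over t1 /\ term_over t2
  | GRing.Unit t1 => term_over t1
  | GRing.And f1 f2 | GRing.Or f1 f2 | GRing.Implies f1 f2 =>
      formula_over f1 /\ formula_over f2
  | GRing.Not f1 | GRing.Exists _ f1 | GRing.Forall _ f1 => formula_over f1
  end.
End FormulaOver.

(* #|A| < #|K|: the degree of saturation of a saturated model K is its
   cardinality, and bounded means smaller than it. *)
Definition small (K T : Type) (A : set T) : Prop := ~~ ([set: K] #<= A).

(* Complete types play no role here: every partial 1-type over a small set of
   parameters, given by its free variable 'X_0, is realized. *)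
Definition saturated (K : rcfType) : Prop :=
  forall (A : set K) (p : set (GRing.formula K)),
    small K A -> p `<=` formula_over A ->
    (forall q, q `<=` p -> finite_set q ->
      exists x : K, forall f, q f -> GRing.holds [:: x] f) ->
    exists x : K, forall f, p f -> GRing.holds [:: x] f.

Definition coords (F : Type) (M : 'M[F]_2) : seq F :=
  [:: M 0 0; M 0 1; M 1 0; M 1 1].

(* The integer n such that phi n holds at (x, y) in L, n ranging over I. *)
Definition interp_cocycle (F : Type) (L : fieldType) (iota : F -> L)
    (I : set int) (phi : int -> GRing.formula F) (x y : SL2 L) : int :=
  xget 0 [set n | I n /\
    GRing.holds (coords x ++ coords y) (map_formula iota (phi n))].

(* The group law on G(K) is given by a bare operation: that it satisfies the
   group axioms comes from R by transfer, and is not available at this point. *)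

Section BareGroup.
Variables (T : Type) (op : T -> T -> T).
Implicit Types (N M : set T) (u v : T).

Definition is_subgroup N : Prop :=
  exists e, [/\ left_id e op, right_id e op, N e,
    forall u v, N u -> N v -> N (op u v) &
    forall u, N u -> exists v, [/\ N v, op u v = e & op v u = e]].

Definition is_group : Prop := associative op /\ is_subgroup setT.

Definition lcoset N u : set T := [set op u n | n in N].
Definition rcoset N u : set T := [set op n u | n in N].
Definition is_normal N : Prop := forall u, lcoset N u = rcoset N u.
Definition cosets N : set (set T) := range (lcoset N).
Definition set_op (A B : set T) : set T := [set op a b | a in A & b in B].

Definition least (P : set (set T)) N : Prop :=
  P N /\ forall M, P M -> N `<=` M.
End BareGroup.

Definition quotient_iso (T U : Type) (opT : T -> T -> T) (opU : U -> U -> U)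
    (N : set T) (C : set U) (f : set T -> set U) : Prop :=
  set_bij (cosets opT N) (cosets opU C) f /\
  forall A B, cosets opT N A -> cosets opT N B ->
    f (set_op opT A B) = set_op opU (f A) (f B).

Section Components.
Variables (K : rcfType) (op : SO2 K * SL2 K -> SO2 K * SL2 K -> SO2 K * SL2 K).
Implicit Types N : set (SO2 K * SL2 K).

Definition bounded_index N : Prop := small K (cosets op N).

Definition type_definable N : Prop :=
  exists (A : set K) (p : set (GRing.formula K)),
    [/\ small K A, p `<=` formula_over A &
      forall u, N u <->
        forall f, p f -> GRing.holds (coords u.1 ++ coords u.2) f].

Definition Aut_invariant (A : set K) N : Prop :=
  forall sigma : {rmorphism K -> K},
    bijective sigma -> (forall a, A a -> sigma a = a) ->
    forall u, N u -> N (SO2_map sigma u.1, SL2_map sigma u.2).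

Definition is_comp00 N : Prop :=
  least [set M | [/\ is_subgroup op M, type_definable M & bounded_index M]] N.

(* A is the parameter set: for A empty, invariance is under all of Aut(K). *)
Definition is_comp000 (A : set K) N : Prop :=
  least [set M | [/\ is_subgroup op M, Aut_invariant A M & bounded_index M]] N.
End Components.

(* t and the real point r differ by infinitesimals: the usual residue map. *)
Definition standard_part (R : realType) (K : rcfType)
    (iota : {rmorphism R -> K}) (t : SO2 K) (r : SO2 R) : Prop :=
  forall (i j : 'I_2) (n : nat), `|t i j - iota (r i j)| < n.+1%:R^-1.

Definition cyclic_subgroup (V : zmodType) (c : V) : set V :=
  [set c *~ z | z in [set: int]].

(* Main.v *)
Require Import Defs.
From HB Require Import structures.
From mathcomp Require Import all_boot all_order all_algebra.
From mathcomp Require Import ring lra.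
From mathcomp Require Import all_classical all_reals all_analysis.
From mathcomp.real_closed Require qe_rcf_th qe_rcf polyrcf.
Import numFieldNormedType.Exports.
Import Order.TTheory GRing.Theory Num.Theory.

Set Implicit Arguments.
Unset Strict Implicit.
Unset Printing Implicit Defensive.

Local Open Scope classical_set_scope.
Local Open Scope ring_scope.

(* Let M be a subgroup of G(K) of bounded index, invariant under the automorphisms
   fixing a small set A.  Few cosets and homogeneity of K force translates of a
   generic point to lie in the same coset: this applies to the unipotents of
   SL_2(K) (generic points at +oo), so that M projects onto SL_2(K), and to the
   rotations by infinitesimal angles (generic points above the infinitesimals).
   As SO_2(K) is central, M contains all commutators of G(K), hence the image of
   the universal cover of SL_2(R): the latter is perfect, because a subgroup of a
   connected cover containing the commutators contains the lifts of the small
   unipotents u(s) = [u(s/3), diag(1/2, 2)], so is open.  Transfer to K then gives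
   (Z g + mu) x SL_2(K) as a subset of M, mu being the infinitesimal rotations, and
   this set is itself an invariant subgroup of index at most |SO_2(R)|.  The residue
   map identifies the quotient with SO_2(R) / Z g.  Finally, as Z g is dense, a
   type-definable M meets every infinitesimal neighbourhood, so is everything. *)

(** * Substitution in formulas *)

(** Over K only the formulas defining h are available, so every fact about the group there is a
    transferred sentence. The image of h is finite: that some value is taken is a finite
    disjunction, and uniqueness and the cocycle identity split into one sentence for each choice of
    integer values. Two cuts of K carry a type that survives translation: +oo is preserved by all
    translations, the cut above the infinitesimals exactly by the infinitesimal ones. Hence the
    first yields whole unipotent subgroups, and the second, read in the tangent of the half angle,
    only infinitesimal rotations. Commutators in G(K) put above each element of SL_2(K) some
    multiple of g, without control over which one. The universal cover supplies the control: its
    kernel over 1 is Z, and its perfectness gives every (z g, 1). The coordinates of g are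
    algebraic, so each automorphism of K fixes them. This makes Z g + mu invariant even over the
    empty set, and one subgroup serves for all parameter sets. *)

Section Substitution.

Section Def.
Variable F : unitRingType.
Implicit Types (t : GRing.term F) (ts : seq (GRing.term F)) (f : GRing.formula F).

Definition ub_vars ts : nat := \max_(t <- ts) GRing.ub_var t.

Fixpoint tsubsts ts t : GRing.term F :=
  match t with
  | GRing.Var i => nth (GRing.NatConst F 0) ts i
  | GRing.Const c => GRing.Const c
  | GRing.NatConst n => GRing.NatConst F n
  | GRing.Add t1 t2 => GRing.Add (tsubsts ts t1) (tsubsts ts t2)
  | GRing.Opp t1 => GRing.Opp (tsubsts ts t1)
  | GRing.NatMul t1 n => GRing.NatMul (tsubsts ts t1) n
  | GRing.Mul t1 t2 => GRing.Mul (tsubsts ts t1) (tsubsts ts t2)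
  | GRing.Inv t1 => GRing.Inv (tsubsts ts t1)
  | GRing.Exp t1 n => GRing.Exp (tsubsts ts t1) n
  end.

(* Bound variables are renamed to the first index above those of ts; variables
   beyond the size of ts become 0, as in GRing.holds. *)
Fixpoint fsubsts ts f : GRing.formula F :=
  let fresh i := set_nth (GRing.NatConst F 0) ts i (GRing.Var F (ub_vars ts)) in
  match f with
  | GRing.Bool b => GRing.Bool b
  | GRing.Equal t1 t2 => GRing.Equal (tsubsts ts t1) (tsubsts ts t2)
  | GRing.Unit t1 => GRing.Unit (tsubsts ts t1)
  | GRing.And f1 f2 => GRing.And (fsubsts ts f1) (fsubsts ts f2)
  | GRing.Or f1 f2 => GRing.Or (fsubsts ts f1) (fsubsts ts f2)
  | GRing.Implies f1 f2 => GRing.Implies (fsubsts ts f1) (fsubsts ts f2)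
  | GRing.Not f1 => GRing.Not (fsubsts ts f1)
  | GRing.Exists i f1 => GRing.Exists (ub_vars ts) (fsubsts (fresh i) f1)
  | GRing.Forall i f1 => GRing.Forall (ub_vars ts) (fsubsts (fresh i) f1)
  end.

Lemma eval_tsubsts e ts t :
  GRing.eval e (tsubsts ts t) = GRing.eval (map (GRing.eval e) ts) t.
Proof.
elim: t => //=.
- move=> i; have [lti|lei] := ltnP i (size ts).
    by rewrite (nth_map (GRing.NatConst F 0)).
  by rewrite !nth_default ?size_map.
- by move=> t -> u ->.
- by move=> t ->.
- by move=> t -> n.
- by move=> t -> u ->.
- by move=> t ->.
- by move=> t -> n.
Qed.

Lemma eval_set_nth_fresh e m x t : (GRing.ub_var t <= m)%N ->
  GRing.eval (set_nth 0 e m x) t = GRing.eval e t.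
Proof.
elim: t => //=.
- by move=> i im; rewrite nth_set_nth /= ltn_eqF.
- by move=> t IHt u IHu; rewrite geq_max => /andP[/IHt -> /IHu ->].
- by move=> t IHt /IHt ->.
- by move=> t IHt n /IHt ->.
- by move=> t IHt u IHu; rewrite geq_max => /andP[/IHt -> /IHu ->].
- by move=> t IHt /IHt ->.
- by move=> t IHt n /IHt ->.
Qed.

(** This excludes capture: the fresh index lies above all variables of [ts], so writing [x] there
    changes the value of no term of [ts]. *)
Lemma same_env_fresh e ts i x : GRing.same_env
  (map (GRing.eval (set_nth 0 e (ub_vars ts) x))
     (set_nth (GRing.NatConst F 0) ts i (GRing.Var F (ub_vars ts))))
  (set_nth 0 (map (GRing.eval e) ts) i x).
Proof.
set m := ub_vars ts; set e' := set_nth 0 e m x.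
have nthE e1 s k : nth 0 (map (GRing.eval e1) s) k =
    GRing.eval e1 (nth (GRing.NatConst F 0) s k).
  have [lk|lk] := ltnP k (size s); first by rewrite (nth_map (GRing.NatConst F 0)).
  by rewrite !nth_default ?size_map.
have ubP k : (GRing.ub_var (nth (GRing.NatConst F 0%N) ts k) <= m)%N.
  rewrite /m /ub_vars; elim: (ts) k => [|t s IH] [|k] //=;
    rewrite big_cons leq_max ?leqnn //.
  by rewrite IH orbT.
move=> k; rewrite nthE !nth_set_nth /=; case: eqP => _.
  by rewrite /= /e' nth_set_nth /= eqxx.
by rewrite nthE eval_set_nth_fresh.
Qed.

Lemma holds_fsubsts e ts f :
  GRing.holds e (fsubsts ts f) <-> GRing.holds (map (GRing.eval e) ts) f.
Proof.
have iffs := @GRing.eq_holds F.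
elim: f e ts => //=.
- by move=> t u e ts; rewrite !eval_tsubsts.
- by move=> t e ts; rewrite !eval_tsubsts.
- by move=> f IHf g IHg e ts; rewrite IHf IHg.
- by move=> f IHf g IHg e ts; rewrite IHf IHg.
- by move=> f IHf g IHg e ts; rewrite IHf IHg.
- by move=> f IHf e ts; rewrite IHf.
- move=> i f IHf e ts; split=> -[x xP]; exists x.
    by move/IHf: xP; apply: iffs; apply: same_env_fresh.
  by apply/IHf; apply: iffs xP => k; rewrite same_env_fresh.
- move=> i f IHf e ts; split=> fP x.
    by move/IHf: (fP x); apply: iffs; apply: same_env_fresh.
  by apply/IHf; apply: iffs (fP x) => k; rewrite same_env_fresh.
Qed.

Lemma term_over_sub (A B : set F) t : A `<=` B -> term_over A t -> term_over B t.
Proof.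
move=> AB; elim: t => //= [t IHt u IHu [tA uA]|t IHt u IHu [tA uA]];
  by split; [apply: IHt | apply: IHu].
Qed.

Lemma formula_over_sub (A B : set F) f :
  A `<=` B -> formula_over A f -> formula_over B f.
Proof.
move=> AB; have tAB := term_over_sub AB.
elim: f => //= [t u [tA uA]|f IHf g IHg [fA gA]|f IHf g IHg [fA gA]|f IHf g IHg [fA gA]];
  by split; auto.
Qed.

Lemma tsubsts_over (A : set F) ts t :
  (forall i, term_over A (nth (GRing.NatConst F 0) ts i)) ->
  term_over A t -> term_over A (tsubsts ts t).
Proof.
by move=> tsA; elim: t => //= t IHt u IHu [tA uA]; split; auto.
Qed.

Lemma fsubsts_over (A : set F) ts f :
  (forall i, term_over A (nth (GRing.NatConst F 0) ts i)) ->
  formula_over A f -> formula_over A (fsubsts ts f).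
Proof.
elim: f ts => //=.
- by move=> t u ts tsA [tA uA]; split; apply: tsubsts_over.
- by move=> t ts tsA tA; apply: tsubsts_over.
- by move=> f IHf g IHg ts tsA [fA gA]; split; auto.
- by move=> f IHf g IHg ts tsA [fA gA]; split; auto.
- by move=> f IHf g IHg ts tsA [fA gA]; split; auto.
- move=> i f IHf ts tsA fA; apply: IHf => // k.
  by rewrite nth_set_nth /=; case: eqP.
- move=> i f IHf ts tsA fA; apply: IHf => // k.
  by rewrite nth_set_nth /=; case: eqP.
Qed.
End Def.

Section Map.
Variables (F L : unitRingType) (j : F -> L).

Lemma ub_var_map (t : GRing.term F) : GRing.ub_var (map_term j t) = GRing.ub_var t.
Proof. by elim: t => //= t -> u ->. Qed.

Lemma map_tsubsts ts t :
  map_term j (tsubsts ts t) = tsubsts (map (map_term j) ts) (map_term j t).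
Proof.
elim: t => //= [i|t -> u ->|t ->|t -> n|t -> u ->|t ->|t -> n] //.
have [lti|lei] := ltnP i (size ts); first by rewrite (nth_map (GRing.NatConst F 0)).
by rewrite !nth_default ?size_map.
Qed.

Lemma map_fsubsts ts f :
  map_formula j (fsubsts ts f) = fsubsts (map (map_term j) ts) (map_formula j f).
Proof.
(* Base change keeps variable indices, so both sides choose the same bound variables and the
   equality is syntactic. *)
have ubE (s : seq (GRing.term F)) : ub_vars (map (map_term j) s) = ub_vars s.
  by rewrite /ub_vars big_map; apply: eq_bigr => t _; apply: ub_var_map.
have setE (s : seq (GRing.term F)) i m :
    map (map_term j) (set_nth (GRing.NatConst F 0) s i (GRing.Var F m)) =
    set_nth (GRing.NatConst L 0) (map (map_term j) s) i (GRing.Var L m).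
  by elim: s i => [|t s IH] [|i] //=; rewrite ?IH ?map_ncons // -cat_nseq map_cat map_nseq -cat_nseq.
elim: f ts => //=.
- by move=> t u ts; rewrite !map_tsubsts.
- by move=> t ts; rewrite !map_tsubsts.
- by move=> f IHf g IHg ts; rewrite IHf IHg.
- by move=> f IHf g IHg ts; rewrite IHf IHg.
- by move=> f IHf g IHg ts; rewrite IHf IHg.
- by move=> f IHf ts; rewrite IHf.
- by move=> i f IHf ts; rewrite IHf setE ubE.
- by move=> i f IHf ts; rewrite IHf setE ubE.
Qed.
End Map.

End Substitution.

(** * Quantifier elimination over real closed extensions *)

Module QE.
Import qe_rcf_th qe_rcf.

Section MapQF.
Variables (R L : Type) (j : R -> L).

(** Terms and formulas here are those of [qe_rcf], with order atoms and without inverse, unlike the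
    ring formulas of ssralg. *)
Fixpoint map_rterm (t : term R) : term L :=
  match t with
  | Var i => Var L i
  | Const c => Const (j c)
  | NatConst n => NatConst L n
  | Add t1 t2 => Add (map_rterm t1) (map_rterm t2)
  | Opp t1 => Opp (map_rterm t1)
  | NatMul t1 n => NatMul (map_rterm t1) n
  | Mul t1 t2 => Mul (map_rterm t1) (map_rterm t2)
  | Exp t1 n => Exp (map_rterm t1) n
  end.

Fixpoint map_qf (f : formula R) : formula L :=
  match f with
  | Bool b => Bool b
  | Equal t1 t2 => Equal (map_rterm t1) (map_rterm t2)
  | Lt t1 t2 => Lt (map_rterm t1) (map_rterm t2)
  | Le t1 t2 => Le (map_rterm t1) (map_rterm t2)
  | And f1 f2 => And (map_qf f1) (map_qf f2)
  | Or f1 f2 => Or (map_qf f1) (map_qf f2)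
  | Implies f1 f2 => Implies (map_qf f1) (map_qf f2)
  | Not f1 => Not (map_qf f1)
  end.
End MapQF.

(* The elimination of qe_rcf is in continuation-passing style.  That it commutes
   with base change makes one quantifier-free formula serve all extensions. *)
Section Commutation.
Variables (R L : realFieldType) (j : {rmorphism R -> L}).

Local Notation mt := (map_rterm j).
Local Notation mp := (map (map_rterm j)).
Local Notation mq := (map_qf j).

Lemma map_Size p k k' : (forall n, mq (k n) = k' n) ->
  mq (Size p k) = Size (mp p) k'.
Proof.
elim: p k k' => [|c p IH] k k' kk' //=; rewrite /bind_def.
by apply: IH => -[|n] //=; rewrite !kk'.
Qed.

Lemma map_Isnull p k k' : (forall b, mq (k b) = k' b) ->
  mq (Isnull p k) = Isnull (mp p) k'.
Proof. by move=> kk'; apply: map_Size => n; apply: kk'. Qed.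

Lemma map_LeadCoef p k k' : (forall t, mq (k t) = k' (mt t)) ->
  mq (LeadCoef p k) = LeadCoef (mp p) k'.
Proof.
elim: p k k' => [|c p IH] k k' kk' /=; first by rewrite kk' /= rmorph0.
by rewrite /bind_def; apply: IH => t /=; rewrite !kk'.
Qed.

Lemma map_AmulXn a n : mp (AmulXn a n) = AmulXn (mt a) n.
Proof. by elim: n => [|n IH] //=; rewrite IH rmorph0. Qed.

Lemma map_AddPoly p q : mp (AddPoly p q) = AddPoly (mp p) (mp q).
Proof. by elim: p q => [|a p IH] [|b q] //=; rewrite IH. Qed.

Lemma map_ScalPoly c p : mp (ScalPoly c p) = ScalPoly (mt c) (mp p).
Proof. by rewrite /ScalPoly -!map_comp. Qed.

Lemma map_MulPoly p q : mp (MulPoly p q) = MulPoly (mp p) (mp q).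
Proof. by elim: p q => [|a p IH] q //=; rewrite map_AddPoly map_ScalPoly /= IH. Qed.

Lemma map_ExpPoly p n : mp (ExpPoly p n) = ExpPoly (mp p) n.
Proof.
rewrite /ExpPoly; case: n => [|n] //; rewrite !iteropS.
by elim: n => [|n IH] //=; rewrite map_MulPoly IH.
Qed.

Lemma map_OppPoly p : mp (OppPoly p) = OppPoly (mp p).
Proof. by rewrite /OppPoly map_ScalPoly /= rmorphN1. Qed.

Lemma map_NatMulPoly n p : mp (NatMulPoly n p) = NatMulPoly n (mp p).
Proof. exact: map_ScalPoly. Qed.

Lemma map_Deriv p : mp (Deriv p) = Deriv (mp p).
Proof. by elim: p => [|a p IH] //=; rewrite map_AddPoly /= IH. Qed.

Lemma map_Rediv_rec_loop q sq cq c qq r n k k' :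
  (forall c' p1 p2, mq (k (c', p1, p2)) = k' (c', mp p1, mp p2)) ->
  mq (Rediv_rec_loop q sq cq c qq r n k) =
  Rediv_rec_loop (mp q) sq (mt cq) c (mp qq) (mp r) n k'.
Proof.
move=> kk'; elim: n c qq r => [|n IH] c qq r /=; rewrite /bind_def;
  apply: map_Size => s; case: ifP => // _; apply: map_LeadCoef => t.
  by rewrite kk' !map_AddPoly map_OppPoly !map_MulPoly map_AmulXn.
by rewrite IH !map_AddPoly map_OppPoly !map_MulPoly map_AmulXn.
Qed.

Lemma map_Rediv p q k k' :
  (forall c' p1 p2, mq (k (c', p1, p2)) = k' (c', mp p1, mp p2)) ->
  mq (Rediv p q k) = Rediv (mp p) (mp q) k'.
Proof.
move=> kk'; apply: map_Isnull => -[]; first by rewrite kk' /= rmorph0.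
apply: map_Size => s; apply: map_Size => s'; apply: map_LeadCoef => t.
by rewrite (map_Rediv_rec_loop _ _ _ _ _ _ _ kk') /= rmorph0.
Qed.

Lemma map_Rmod p q k k' : (forall r, mq (k r) = k' (mp r)) ->
  mq (Rmod p q k) = Rmod (mp p) (mp q) k'.
Proof. by move=> kk'; apply: map_Rediv => c p1 p2; apply: kk'. Qed.

Lemma map_Rscal p q k k' : (forall n, mq (k n) = k' n) ->
  mq (Rscal p q k) = Rscal (mp p) (mp q) k'.
Proof. by move=> kk'; apply: map_Rediv => c p1 p2; apply: kk'. Qed.

Lemma map_Rgcd_loop n p q k k' : (forall r, mq (k r) = k' (mp r)) ->
  mq (Rgcd_loop n p q k) = Rgcd_loop n (mp p) (mp q) k'.
Proof.
move=> kk'; elim: n p q => [|n IH] p q /=; rewrite /bind_def;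
  by apply: map_Rmod => r; apply: map_Isnull => -[].
Qed.

Lemma map_Rgcd p q k k' : (forall r, mq (k r) = k' (mp r)) ->
  mq (Rgcd p q k) = Rgcd (mp p) (mp q) k'.
Proof.
move=> kk'; rewrite /Rgcd /bind_def /LtSize /bind_def.
apply: map_Size => n; apply: map_Size => m; case: ifP => _;
  apply: map_Isnull => -[] //; apply: map_Size => s; exact: map_Rgcd_loop.
Qed.

Lemma map_BigRgcd ps k k' : (forall r, mq (k r) = k' (mp r)) ->
  mq (BigRgcd ps k) = BigRgcd (map mp ps) k'.
Proof.
elim: ps k k' => [|p ps IH] k k' kk' /=; first by rewrite kk' /= rmorph0.
by apply: IH => r; apply: map_Rgcd.
Qed.

Lemma map_Changes s k k' : (forall n, mq (k n) = k' n) ->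
  mq (Changes s k) = Changes (mp s) k'.
Proof.
elim: s k k' => [|a s IH] k k' kk' //=.
by apply: IH => v /=; rewrite !kk'; case: s.
Qed.

Lemma map_SeqPInfty ps k k' : (forall s, mq (k s) = k' (mp s)) ->
  mq (SeqPInfty ps k) = SeqPInfty (map mp ps) k'.
Proof.
elim: ps k k' => [|p ps IH] k k' kk' /=; first by rewrite kk'.
by apply: map_LeadCoef => t; apply: IH => s; rewrite kk'.
Qed.

Lemma map_SeqMInfty ps k k' : (forall s, mq (k s) = k' (mp s)) ->
  mq (SeqMInfty ps k) = SeqMInfty (map mp ps) k'.
Proof.
elim: ps k k' => [|p ps IH] k k' kk' /=; first by rewrite kk'.
apply: map_LeadCoef => t; apply: map_Size => n; apply: IH => s.
by rewrite kk' /= rmorphN1.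
Qed.

Lemma map_ChangesPoly ps k k' : (forall n, mq (k n) = k' n) ->
  mq (ChangesPoly ps k) = ChangesPoly (map mp ps) k'.
Proof.
move=> kk'; apply: map_SeqMInfty => m; apply: map_SeqPInfty => p.
by apply: map_Changes => vm; apply: map_Changes => vp; apply: kk'.
Qed.

Lemma map_NextMod p q k k' : (forall r, mq (k r) = k' (mp r)) ->
  mq (NextMod p q k) = NextMod (mp p) (mp q) k'.
Proof.
move=> kk'; apply: map_LeadCoef => t; apply: map_Rscal => n.
by apply: map_Rmod => r; rewrite kk' map_ScalPoly.
Qed.

Lemma map_ModsAux p q n k k' : (forall ps, mq (k ps) = k' (map mp ps)) ->
  mq (ModsAux p q n k) = ModsAux (mp p) (mp q) n k'.
Proof.
elim: n p q k k' => [|n IH] p q k k' kk' /=; first by rewrite kk'.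
apply: map_Isnull => -[]; first by rewrite kk'.
by apply: map_NextMod => r; apply: IH => ps; rewrite kk'.
Qed.

Lemma map_Mods p q k k' : (forall ps, mq (k ps) = k' (map mp ps)) ->
  mq (Mods p q k) = Mods (mp p) (mp q) k'.
Proof.
by move=> kk'; apply: map_Size => s; apply: map_Size => s'; apply: map_ModsAux.
Qed.

Lemma map_reducebig_MulPoly (I J : Type) (r : seq I) (h : I -> J)
    (f : I -> polyF R) (f' : J -> polyF L) :
  (forall i, mp (f i) = f' (h i)) ->
  mp (reducebig [:: NatConst R 1] r
        (fun i => BigBody i (@MulPoly R) true (f i))) =
  reducebig [:: NatConst L 1] (map h r)
        (fun i => BigBody i (@MulPoly L) true (f' i)).
Proof.
move=> ff'; rewrite /reducebig; elim: r => [|i r IH] //=.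
by rewrite map_MulPoly ff' IH.
Qed.

Lemma map_PolyComb sq sc : mp (PolyComb sq sc) = PolyComb (map mp sq) sc.
Proof.
rewrite /PolyComb size_map -[in RHS](map_id (iota 0 _)).
apply: map_reducebig_MulPoly => i; rewrite map_ExpPoly; congr (ExpPoly _ _).
have [lti|lei] := ltnP i (size sq); first by rewrite (nth_map [::]).
by rewrite !nth_default ?size_map.
Qed.

Lemma map_Pcq sq i : mp (Pcq sq i) = Pcq (map mp sq) i.
Proof.
rewrite /Pcq size_map; move: (sg_tab _) => s.
have [lti|lei] := ltnP i (size s); last by rewrite !nth_default ?size_map.
by rewrite !(nth_map [::]) // map_PolyComb.
Qed.

Lemma map_TaqR p q k k' : (forall n, mq (k n) = k' n) ->
  mq (TaqR p q k) = TaqR (mp p) (mp q) k'.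
Proof.
move=> kk'; rewrite /TaqR /bind_def.
rewrite (map_Mods _ _ (k' := fun r => ChangesPoly r k')); last first.
  by move=> ps; apply: map_ChangesPoly.
by rewrite map_MulPoly map_Deriv.
Qed.

Lemma map_TaqsR p sq i k k' : (forall t, mq (k t) = k' (mt t)) ->
  mq (TaqsR p sq i k) = TaqsR (mp p) (map mp sq) i k'.
Proof.
move=> kk'; rewrite /TaqsR /bind_def.
rewrite (map_TaqR _ _ (k' := fun n => k' (Const n%:~R))); last first.
  by move=> n; rewrite kk' /= rmorph_int.
by rewrite map_Pcq.
Qed.

Lemma map_BoundingPoly sq : mp (BoundingPoly sq) = BoundingPoly (map mp sq).
Proof. by rewrite /BoundingPoly map_Deriv (map_reducebig_MulPoly _ (h := mp) (f' := id)). Qed.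

(** These coefficients are entries of the inverse of an integer matrix, so they are rational and any
    ring morphism respects them. *)
Lemma map_coefs n i : j (coefs R n i) = coefs L n i.
Proof.
rewrite /coefs; have [lti|lei] := ltnP i (3 ^ n); last first.
  have out (F : realFieldType) (h : 'I_(3 ^ n) -> F) :
      [seq h x | x <- enum 'I_(3 ^ n)]`_i = 0.
    by rewrite nth_default // size_map size_enum_ord.
  by rewrite !out rmorph0.
have inn (F : realFieldType) (h : 'I_(3 ^ n) -> F) :
    [seq h x | x <- enum 'I_(3 ^ n)]`_i = h (Ordinal lti).
  rewrite (nth_map (Ordinal lti)) ?size_enum_ord //; congr h; apply: val_inj.
  by rewrite /= nth_enum_ord.
rewrite !inn !castmxE /=.
have -> : map_mx (intr : int -> L) (ctmat n) = map_mx j (map_mx intr (ctmat n)).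
  by apply/matrixP => a b; rewrite !mxE rmorph_int.
by rewrite -map_invmx [in RHS]mxE.
Qed.

Lemma map_Coefs n i : mt (Coefs R n i) = Coefs L n i.
Proof.
rewrite /Coefs /=; congr Const; case: n => [|[|n]].
- by rewrite rmorph_nat.
- by case: i => [|[|[|i]]]; rewrite ?rmorph0 ?fmorphV ?rmorph_nat /= ?nth_nil ?rmorph0.
- exact: map_coefs.
Qed.

Lemma map_CcountWeak p sq k k' : (forall t, mq (k t) = k' (mt t)) ->
  mq (CcountWeak p sq k) = CcountWeak (mp p) (map mp sq) k'.
Proof.
rewrite /CcountWeak size_map -[NatConst L 0]/(mt (NatConst R 0)).
move: (NatConst R 0) => s; elim: (3 ^ _)%N s k k' => [|n IH] s k k' kk' /=.
  exact: kk'.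
by apply: map_TaqsR => t; rewrite (IH _ _ _ kk') -map_Coefs.
Qed.

Lemma map_reducebig_And (r : seq (polyF R)) f f' :
  (forall q, mq (f q) = f' (mp q)) ->
  mq (reducebig (Bool true) r (fun q => BigBody q And true (f q))) =
  reducebig (Bool true) (map mp r) (fun q => BigBody q And true (f' q)).
Proof.
by move=> ff'; rewrite /reducebig; elim: r => [|q r IH] //=; rewrite ff' IH.
Qed.

Lemma map_CcountGt0 sp sq :
  mq (CcountGt0 sp sq) = CcountGt0 (map mp sp) (map mp sq).
Proof.
apply: map_BigRgcd => r; apply: map_Isnull => -[] /=; last first.
  by apply: map_CcountWeak.
rewrite /bind_def -map_BoundingPoly; apply: map_CcountWeak => t /=.
congr (Or _ (Or _ _)); apply: map_reducebig_And => q.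
  by apply: map_LeadCoef.
by apply: map_Size => n; apply: map_LeadCoef.
Qed.

Lemma map_abstrX i t : mp (abstrX i t) = abstrX i (mt t).
Proof.
elim: t => //=.
- by move=> n; case: ifP.
- by move=> t1 IH1 t2 IH2; rewrite map_AddPoly IH1 IH2.
- by move=> t IH; rewrite map_OppPoly IH.
- by move=> t IH n; rewrite map_NatMulPoly IH.
- by move=> t1 IH1 t2 IH2; rewrite map_MulPoly IH1 IH2.
- by move=> t IH n; rewrite map_ExpPoly IH.
Qed.

End Commutation.

(** * Quantifier elimination, uniform in the real closed extension *)

Section Elimination.
Variable R : rcfType.

Definition clause := (seq (term R) * seq (term R))%type.

Section ClauseEval.
Variables (L : rcfType) (j : {rmorphism R -> L}) (e : seq L).

Definition clause_eval (c : clause) : bool :=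
  all (fun t => eval e (map_rterm j t) == 0) c.1 &&
  all (fun t => 0 < eval e (map_rterm j t)) c.2.
End ClauseEval.

(** The clauses are chosen before [L], [j] and [e]: one list serves all real closed extensions. *)
Definition is_dnf (F : forall L : rcfType, {rmorphism R -> L} -> seq L -> bool) :=
  exists cs : seq clause, forall (L : rcfType) (j : {rmorphism R -> L}) e,
    F L j e = has (clause_eval j e) cs.

Lemma is_dnf1 c : is_dnf (fun L j e => @clause_eval L j e c).
Proof. by exists [:: c] => L j e /=; rewrite orbF. Qed.

Lemma is_dnf_or F G : is_dnf F -> is_dnf G ->
  is_dnf (fun L j e => F L j e || G L j e).
Proof.
move=> [cs csP] [ds dsP]; exists (cs ++ ds) => L j e.
by rewrite has_cat csP dsP.
Qed.

Lemma is_dnf_and F G : is_dnf F -> is_dnf G ->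
  is_dnf (fun L j e => F L j e && G L j e).
Proof.
move=> [cs csP] [ds dsP].
exists [seq (c.1 ++ d.1, c.2 ++ d.2) | c <- cs, d <- ds] => L j e.
rewrite csP dsP; elim: cs {csP} => [|c cs IH] //=.
rewrite has_cat andb_orl IH; congr orb; rewrite has_map.
have E d : clause_eval j e (c.1 ++ d.1, c.2 ++ d.2) =
    clause_eval j e c && clause_eval j e d.
  by rewrite /clause_eval /= !all_cat andbACA.
elim: ds {dsP IH} => [|d ds IH]; first by rewrite andbF.
by rewrite /= andb_orr IH E.
Qed.

Lemma is_dnf_bool (b : bool) : is_dnf (fun _ _ _ => b).
Proof. by case: b; [exists [:: ([::], [::])] | exists [::]] => L j e. Qed.

(** The formula and its negation are treated together so that the induction passes through [Not]; by
    trichotomy, a negated sign condition is again a disjunction of sign conditions. *)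
Lemma is_dnf_qf f : is_dnf (fun L j e => qf_eval e (map_qf j f)) /\
  is_dnf (fun L j e => ~~ qf_eval e (map_qf j f)).
Proof.
have E F G : (forall (L : rcfType) (j : {rmorphism R -> L}) e, F L j e = G L j e) ->
  is_dnf F -> is_dnf G.
  by move=> FG [cs csP]; exists cs => L j e; rewrite -FG csP.
elim: f => /=.
- by move=> b; split; apply: is_dnf_bool.
- move=> t u; split.
    apply: E (is_dnf1 ([:: Add t (Opp u)], [::])) => L j e.
    by rewrite /clause_eval /= !andbT subr_eq0.
  apply: E (is_dnf_or (is_dnf1 ([::], [:: Add t (Opp u)]))
    (is_dnf1 ([::], [:: Add u (Opp t)]))) => L j e.
  by rewrite /clause_eval /= !andbT !subr_gt0 neq_lt orbC.
- move=> t u; split.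
    apply: E (is_dnf1 ([::], [:: Add u (Opp t)])) => L j e.
    by rewrite /clause_eval /= !andbT subr_gt0.
  apply: E (is_dnf_or (is_dnf1 ([:: Add u (Opp t)], [::]))
    (is_dnf1 ([::], [:: Add t (Opp u)]))) => L j e.
  by rewrite /clause_eval /= !andbT subr_eq0 subr_gt0 -leNgt le_eqVlt.
- move=> t u; split; last first.
    apply: E (is_dnf1 ([::], [:: Add t (Opp u)])) => L j e.
    by rewrite /clause_eval /= !andbT subr_gt0 ltNge.
  apply: E (is_dnf_or (is_dnf1 ([:: Add t (Opp u)], [::]))
    (is_dnf1 ([::], [:: Add u (Opp t)]))) => L j e.
  by rewrite /clause_eval /= !andbT subr_eq0 subr_gt0 le_eqVlt.
- move=> f [fP fN] g [gP gN]; split; first exact: is_dnf_and.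
  by apply: E (is_dnf_or fN gN) => L j e; rewrite negb_and.
- move=> f [fP fN] g [gP gN]; split; first exact: is_dnf_or.
  by apply: E (is_dnf_and fN gN) => L j e; rewrite negb_or.
- move=> f [fP fN] g [gP gN]; split.
    by apply: E (is_dnf_or fN gP) => L j e; rewrite implybE.
  by apply: E (is_dnf_and fP gN) => L j e; rewrite negb_imply.
- by move=> f [fP fN]; split => //; apply: E fP => L j e; rewrite negbK.
Qed.

(** Read as polynomials in variable [i], the terms of a clause have a common solution exactly when
    the sign-counting formula [CcountGt0] holds, and this formula commutes with base change. *)
Lemma qf_exists_clause i (c : clause) : exists g : formula R,
  forall (L : rcfType) (j : {rmorphism R -> L}) e,
    (exists x, clause_eval j (set_nth 0 e i x) c) <-> qf_eval e (map_qf j g).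
Proof.
exists (CcountGt0 (map (abstrX i) c.1) (map (abstrX i) c.2)) => L j e.
rewrite map_CcountGt0 eval_CcountGt0.
have evE x : clause_eval j (set_nth 0 e i x) c =
  (\big[andb/true]_(p <- map (eval_poly e)
     (map (map (map_rterm j)) (map (abstrX i) c.1))) (p.[x] == 0)) &&
  (\big[andb/true]_(p <- map (eval_poly e)
     (map (map (map_rterm j)) (map (abstrX i) c.2))) (0 < p.[x])).
  rewrite !big_all !all_map /clause_eval; congr andb; apply: eq_all => t /=;
  by rewrite map_abstrX abstrXP.
split=> [[x xP]|/ccount_gt0P[x xP]].
  by apply/ccount_gt0P; exists x; rewrite -evE.
by exists x; rewrite evE.
Qed.

Definition has_qf (f : GRing.formula R) := exists g : formula R,
  forall (L : rcfType) (j : {rmorphism R -> L}) e,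
    GRing.holds e (map_formula j f) <-> qf_eval e (map_qf j g).

Lemma has_qf_exists i f : has_qf f -> has_qf (GRing.Exists i f).
Proof.
move=> [g gP]; have [[cs csP] _] := is_dnf_qf g.
suff [h hP] : exists h : formula R, forall (L : rcfType) (j : {rmorphism R -> L}) e,
    (exists x, has (clause_eval j (set_nth 0 e i x)) cs) <-> qf_eval e (map_qf j h).
  exists h => L j e; rewrite -hP /=.
  by split=> -[x xP]; exists x; move: xP; rewrite gP csP.
elim: cs {csP} => [|c cs [h IH]].
  by exists (Bool false) => L j e /=; split=> // -[].
have [g' g'P] := qf_exists_clause i c.
exists (Or g' h) => L j e /=; split.
  move=> [x /orP[cx|csx]]; apply/orP.
    by left; apply/g'P; exists x.
  by right; apply/IH; exists x.
move=> /orP[/g'P[x cx]|/IH[x csx]]; exists x; first by rewrite cx.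
by rewrite csx orbT.
Qed.

Lemma has_qf_not f : has_qf f -> has_qf (GRing.Not f).
Proof.
move=> [g gP]; exists (Not g) => L j e /=.
by split=> [nf|/negP nf /gP]; first by apply/negP => /gP.
Qed.

Lemma map_to_rterm (L : rcfType) (j : R -> L) t : GRing.rterm t ->
  forall t', t' = map_term j t -> map_rterm j (to_rterm t) = to_rterm t'.
Proof.
move=> rt _ ->; elim: t rt => //=; do ?[by move=> t IH n /IH -> | by move=> t IH /IH ->].
  by move=> t IHt u IHu /andP[/IHt -> /IHu ->].
by move=> t IHt u IHu /andP[/IHt -> /IHu ->].
Qed.

Lemma rterm_map (L : rcfType) (j : R -> L) t :
  GRing.rterm (map_term j t) = GRing.rterm t.
Proof. by elim: t => //= t1 -> t2 ->. Qed.

Lemma has_qf_rformula f : GRing.rformula f -> has_qf f.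
Proof.
elim: f => //=.
- by move=> b _; exists (Bool b).
- move=> t u /andP[rt ru]; exists (Equal (to_rterm t) (to_rterm u)) => L j e /=.
  rewrite !evalE (map_to_rterm rt erefl) (map_to_rterm ru erefl).
  by rewrite !to_rtermE ?rterm_map //; split=> [->|/eqP].
- move=> f IHf g IHg /andP[/IHf[f' f'P] /IHg[g' g'P]].
  exists (And f' g') => L j e /=; rewrite f'P g'P.
  by split=> [[-> ->]|/andP].
- move=> f IHf g IHg /andP[/IHf[f' f'P] /IHg[g' g'P]].
  exists (Or f' g') => L j e /=; rewrite f'P g'P.
  by split=> /orP.
- move=> f IHf g IHg /andP[/IHf[f' f'P] /IHg[g' g'P]].
  exists (Implies f' g') => L j e /=; rewrite f'P g'P.
  by split=> /implyP.
- by move=> f IHf /IHf; apply: has_qf_not.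
- by move=> i f IHf /IHf; apply: has_qf_exists.
- move=> i f IHf /IHf /has_qf_not /(has_qf_exists i) /has_qf_not [g gP].
  exists g => L j e; rewrite -gP /=; split.
    by move=> fP [x]; apply; apply: fP.
  by move=> nf x; apply: contrapT => nfx; apply: nf; exists x.
Qed.

Section ToRForm.
Variables (L : unitRingType) (j : {rmorphism R -> L}).

Lemma to_rterm_map t r n :
  GRing.to_rterm (map_term j t) (map (map_term j) r) n =
  (map_term j (GRing.to_rterm t r n).1, map (map_term j) (GRing.to_rterm t r n).2).
Proof.
elim: t r => //=.
- move=> t IHt u IHu r; rewrite IHt; case: (GRing.to_rterm t r n) => t' r' /=.
  by rewrite IHu; case: (GRing.to_rterm u r' n).
- by move=> t IHt r; rewrite IHt; case: (GRing.to_rterm t r n).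
- by move=> t IHt m r; rewrite IHt; case: (GRing.to_rterm t r n).
- move=> t IHt u IHu r; rewrite IHt; case: (GRing.to_rterm t r n) => t' r' /=.
  by rewrite IHu; case: (GRing.to_rterm u r' n).
- move=> t IHt r; rewrite IHt; case: (GRing.to_rterm t r n) => t' r' /=.
  by rewrite size_map map_rcons.
- by move=> t IHt m r; rewrite IHt; case: (GRing.to_rterm t r n).
Qed.

Lemma eq0_rform_map t :
  GRing.eq0_rform (map_term j t) = map_formula j (GRing.eq0_rform t).
Proof.
rewrite /GRing.eq0_rform ub_var_map (to_rterm_map t [::]).
case: (GRing.to_rterm _ _ _) => t' r /=.
elim: r (GRing.ub_var t) => [|u r IH] m /=; first by rewrite ?rmorph0.
by rewrite IH.
Qed.

Lemma to_rform_map f :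
  GRing.to_rform (map_formula j f) = map_formula j (GRing.to_rform f).
Proof.
elim: f => //=.
- by move=> t u; rewrite -eq0_rform_map.
- by move=> t; rewrite -eq0_rform_map.
- by move=> f -> g ->.
- by move=> f -> g ->.
- by move=> f -> g ->.
- by move=> f ->.
- by move=> i f ->.
- by move=> i f ->.
Qed.
End ToRForm.

(** Inverses and unit tests are first removed by [GRing.to_rform], which also commutes with base
    change. *)
Lemma has_qf_formula f : has_qf f.
Proof.
have [g gP] := has_qf_rformula (GRing.to_rform_rformula f).
exists g => L j e; rewrite -gP -to_rform_map.
exact: iff_sym (GRing.to_rformP _ _).
Qed.

End Elimination.

(** Nonnegative elements of a real closed field are squares, so a ring morphism preserves the
    order. *)
Lemma ler_rcf_morph (R L : rcfType) (j : {rmorphism R -> L}) :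
  {mono j : x y / x <= y}.
Proof.
have pos x : 0 <= x -> 0 <= j x.
  by move=> x0; rewrite -(sqr_sqrtr x0) rmorphXn sqr_ge0.
move=> x y; apply/idP/idP; last by rewrite -[x <= y]subr_ge0 -[j x <= _]subr_ge0 -rmorphB; apply: pos.
apply: contraLR; rewrite -!ltNge !lt_neqAle => /andP[xy yx].
by rewrite fmorph_eq xy -subr_ge0 -rmorphB pos // subr_ge0.
Qed.

Lemma ltr_rcf_morph (R L : rcfType) (j : {rmorphism R -> L}) :
  {mono j : x y / x < y}.
Proof. by move=> x y; rewrite !ltNge ler_rcf_morph. Qed.

Lemma eval_map_rterm (R L : rcfType) (j : {rmorphism R -> L}) e t :
  eval (map j e) (map_rterm j t) = j (eval e t).
Proof.
elim: t => //=.
- move=> i; have [lti|lei] := ltnP i (size e); first by rewrite (nth_map 0).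
  by rewrite !nth_default ?size_map // rmorph0.
- by move=> n; rewrite rmorph_nat.
- by move=> t -> u ->; rewrite rmorphD.
- by move=> t ->; rewrite rmorphN.
- by move=> t -> n; rewrite rmorphMn.
- by move=> t -> u ->; rewrite rmorphM.
- by move=> t -> n; rewrite rmorphXn.
Qed.

Lemma qf_eval_map (R L : rcfType) (j : {rmorphism R -> L}) e g :
  qf_eval (map j e) (map_qf j g) = qf_eval e g.
Proof.
elim: g => //=.
- by move=> t u; rewrite !eval_map_rterm fmorph_eq.
- by move=> t u; rewrite !eval_map_rterm ltr_rcf_morph.
- by move=> t u; rewrite !eval_map_rterm ler_rcf_morph.
- by move=> f -> g ->.
- by move=> f -> g ->.
- by move=> f -> g ->.
- by move=> f ->.
Qed.

Lemma map_term_id (R : Type) (t : GRing.term R) : map_term id t = t.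
Proof. by elim: t => //= [t -> u ->|t ->|t -> n|t -> u ->|t ->|t -> n]. Qed.

Lemma map_formula_id (R : Type) (f : GRing.formula R) : map_formula id f = f.
Proof.
elim: f => //= [t u|t|f -> g ->|f -> g ->|f -> g ->|f ->|i f ->|i f ->] //;
  by rewrite !map_term_id.
Qed.

(** Real closed extensions are elementary: both sides reduce to one quantifier-free formula, whose
    truth an ordered field morphism preserves. *)
Theorem holds_map_formula (R L : rcfType) (j : {rmorphism R -> L}) e f :
  GRing.holds (map j e) (map_formula j f) <-> GRing.holds e f.
Proof.
have [g gP] := has_qf_formula f.
rewrite gP qf_eval_map; have := gP R idfun e.
rewrite [map_formula _ f](map_formula_id f) => ->.
have idt (t : term R) : map_rterm (@idfun R) t = t.
  by elim: t => //= [t -> u ->|t ->|t -> n|t -> u ->|t -> n].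
suff -> : map_qf (@idfun R) g = g by [].
by elim: g {gP} => //= [t u|t u|t u|f' -> g ->|f' -> g ->|f' -> g ->|f' ->];
  rewrite ?idt.
Qed.

(** After elimination, [f] is a Boolean combination of sign conditions on polynomials in one
    variable, and a nonzero polynomial keeps its sign where it has no root. The list [bs] collects
    the roots. *)
Theorem o_minimal (K : rcfType) (f : GRing.formula K) (e : seq K) i :
  exists bs : seq K, forall x y, x <= y -> (forall b, b \in bs -> ~~ (x <= b <= y)) ->
    (GRing.holds (set_nth 0 e i x) f <-> GRing.holds (set_nth 0 e i y) f).
Proof.
have [g gP] := has_qf_formula f.
have idt (t : term K) : map_rterm (@idfun K) t = t.
  by elim: t => //= [t -> u ->|t ->|t -> n|t -> u ->|t -> n].
have idq : map_qf (@idfun K) g = g.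
  by elim: g {gP} => //= [t u|t u|t u|f' -> g ->|f' -> g ->|f' -> g ->|f' ->];
    rewrite ?idt.
have {}gP e' : GRing.holds e' f <-> qf_eval e' g.
  by have := gP K idfun e'; rewrite [map_formula _ f](map_formula_id f) idq.
pose const_off (bs : seq K) (T : Type) (F : K -> T) := forall x y, x <= y ->
  (forall b, b \in bs -> ~~ (x <= b <= y)) -> F x = F y.
suff [bs bsP] : exists bs, const_off bs _ (fun x => qf_eval (set_nth 0 e i x) g).
  by exists bs => x y xy xyP; rewrite !gP (bsP x y).
have const_cat bs bs' T F G (op : T -> T -> T) : const_off bs T F -> const_off bs' T G ->
    const_off (bs ++ bs') T (fun x => op (F x) (G x)).
  move=> FP GP x y xy xyP; rewrite (FP x y) // ?(GP x y) // => b bin;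
  by apply: xyP; rewrite mem_cat bin ?orbT.
have sgP (t u : term K) : exists bs, const_off bs _
    (fun x => Num.sg (eval (set_nth 0 e i x) t - eval (set_nth 0 e i x) u)).
  set p := eval_poly e (abstrX i (Add t (Opp u))).
  have pE x : eval (set_nth 0 e i x) t - eval (set_nth 0 e i x) u = p.[x].
    by rewrite /p abstrXP.
  have [p0|p0] := eqVneq p 0.
    by exists [::] => x y _ _; rewrite !pE p0 !horner0.
  exists (polyrcf.rootsR p) => x y xy xyP; rewrite !pE.
  have nr : {in `[x, y], forall r, ~~ root p r}.
    move=> r; rewrite in_itv /= => rxy; apply/negP => rp.
    have : r \in polyrcf.rootsR p.
      by rewrite -(polyrcf.roots_on_rootsR p0) ?inE.
    by move/xyP; rewrite rxy.
  have := polyrcf.noroot_noivt nr.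
  have xin : x \in `[x, y] by rewrite in_itv /= lexx xy.
  have yin : y \in `[x, y] by rewrite in_itv /= lexx xy.
  move=> /(_ x y xin yin) pp; apply/eqP; rewrite -subr_eq0.
  move: pp; rewrite -sgr_gt0 sgrM.
  by case: (sgrP p.[x]) => _; case: (sgrP p.[y]) => _;
    rewrite ?(mulr0, mul0r, ltxx, subrr, mul1r, mulr1, ltr0N1, ltrN10) //.
elim: g {gP idq} => /=.
- by move=> b; exists [::].
- move=> t u; have [bs bsP] := sgP t u; exists bs => x y xy /(bsP x y xy) E.
  by rewrite -subr_eq0 -[RHS]subr_eq0 -sgr_eq0 E sgr_eq0.
- move=> t u; have [bs bsP] := sgP u t; exists bs => x y xy /(bsP x y xy) E.
  by rewrite -subr_gt0 -[RHS]subr_gt0 -sgr_gt0 E sgr_gt0.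
- move=> t u; have [bs bsP] := sgP u t; exists bs => x y xy /(bsP x y xy) E.
  by rewrite -subr_ge0 -[RHS]subr_ge0 -sgr_ge0 E sgr_ge0.
- by move=> f' [bs bsP] g [bs' bs'P]; exists (bs ++ bs'); apply: const_cat.
- by move=> f' [bs bsP] g [bs' bs'P]; exists (bs ++ bs'); apply: const_cat.
- by move=> f' [bs bsP] g [bs' bs'P]; exists (bs ++ bs'); apply: const_cat.
- move=> f' [bs bsP]; exists bs => x y xy xyP.
  by rewrite (bsP x y).
Qed.

End QE.

(** * Small sets and saturation *)

Section SmallSets.

Lemma card_ge_setTP (K T : Type) (A : set T) :
  ([set: K] #<= A)%card <-> exists f : K -> T, injective f /\ forall x, A (f x).
Proof.
split=> [/card_leP[f]|[f [finj fA]]].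
  exists (fun x => set_val (f (SigSub (mem_setT x)))); split=> [x y|x].
    move=> /val_inj fxy; have : SigSub (mem_setT x) = SigSub (mem_setT y).
      by apply: (@inj _ _ setT f); rewrite ?inE.
    by move/(congr1 val).
  exact: set_valP.
have [g] : $|{injfun [set: K] >-> A}|.
  by apply/injfunPex; exists f => // x y _ _; apply: finj.
exact: inj_card_le.
Qed.

Lemma smallP (K T : Type) (A : set T) :
  small K A <-> ~ exists f : K -> T, injective f /\ forall x, A (f x).
Proof.
by rewrite -card_ge_setTP /small; split=> [/negP|/negP].
Qed.

Lemma small_card_le (K T U : Type) (A : set T) (B : set U) :
  (A #<= B)%card -> small K B -> small K A.
Proof. by move=> AB; apply: contra => /card_le_trans; apply. Qed.

Lemma small_sub (K T : Type) (A B : set T) : A `<=` B -> small K B -> small K A.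
Proof. by move/subset_card_le; apply: small_card_le. Qed.

Lemma small_image (K T U : Type) (f : T -> U) (A : set T) :
  small K A -> small K (f @` A).
Proof. exact/small_card_le/card_image_le. Qed.

(** One preimage is chosen for each value of [f]. The choice goes through [option T] because
    elements of [U] outside the range have no preimage and [T] may be empty. *)
Lemma small_transversal (K T U : Type) (f : T -> U) : small K (range f) ->
  exists S : set T, small K S /\ forall x, exists2 s, S s & f s = f x.
Proof.
move=> sf; have [r rP] : exists r : U -> option T,
    forall x, exists2 s, r (f x) = Some s & f s = f x.
  have : forall u, exists o : option T, forall x, f x = u ->
      exists2 s, o = Some s & f s = u.
    move=> u; have [[x fx]|nx] := pselect (exists x, f x = u).
      by exists (Some x) => _ _; exists x.
    by exists None => x fx; case: nx; exists x.
  by move=> /choice[r rP]; exists r => x; apply: rP.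
exists [set s | exists2 u, range f u & r u = Some s]; split; last first.
  move=> x; have [s rs fs] := rP x; exists s => //.
  by exists (f x) => //; exists x.
apply/smallP => -[g [ginj gP]]; move/smallP: (small_image r sf); apply.
exists (Some \o g); split=> [x y [/ginj]//|x /=].
by have [u fu <-] := gP x; exists u.
Qed.

(** If some initial segment of a well-order is not small, the least such one contains a copy of [K],
    and the order pulled back to [K] has only small initial segments. The back-and-forth is a
    recursion along this order, so that each stage stays small. *)
Lemma small_wellorder (K : eqType) : exists lt : K -> K -> Prop,
  [/\ well_founded lt,
      forall x y, x <> y -> lt x y \/ lt y x,
      forall x y z, lt x y -> lt y z -> lt x z &
      forall x, small K [set y | lt y x]].
Proof.
have [R Rwo] := wochoice.well_ordering_principle K.
have minU (P : K -> Prop) : (exists x, P x) -> exists m, [/\ P m,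
    forall y, P y -> R m y & forall m', P m' -> (forall y, P y -> R m' y) -> m = m'].
  move=> [x Px]; have [|m [[mP lbm] mU]] := Rwo (fun x => `[< P x >]).
    by exists x; apply/asboolP.
  exists m; split; first exact/asboolP.
    by move=> y Py; apply: lbm; apply/asboolP.
  by move=> m' Pm' m'P; apply: mU; split; [apply/asboolP | move=> y /asboolP/m'P].
have minP (P : K -> Prop) : (exists x, P x) ->
    exists2 x, P x & forall y, P y -> R x y.
  by move=> /minU[m [Pm mP _]]; exists m.
have Rxx x : R x x by have [|y -> yP] := minP (fun y => y = x); [exists x | apply: yP].
have Rtot x y : R x y \/ R y x.
  have [|z [->|->] zP] := minP (fun z => z = x \/ z = y); first by exists x; left.
    by left; apply: zP; right.
  by right; apply: zP; left.
have Ranti x y : R x y -> R y x -> x = y.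
  move=> xy yx; have [|z [_ _ zU]] := minU (fun z => z = x \/ z = y).
    by exists x; left.
  have <- : z = x by apply: zU; [left | move=> t [->|->]].
  by apply: zU; [right | move=> t [->|->]].
have Rtr x y z : R x y -> R y z -> R x z.
  move=> xy yz.
  have [|t tP tm] := minP (fun t => [\/ t = x, t = y | t = z]).
    by exists x; apply: Or31.
  case: tP => ->{t} in tm *.
  - by apply: tm; apply: Or33.
  - have yx : R y x by apply: tm; apply: Or31.
    by rewrite (Ranti _ _ xy yx).
  - have zy : R z y by apply: tm; apply: Or32.
    by rewrite (Ranti _ _ zy yz).
pose lt0 x y := x <> y /\ R x y.
have lt0_wf : well_founded lt0.
  move=> x; apply: contrapT => nx; have [|m nm mP] := minP (fun x => ~ Acc lt0 x).
    by exists x.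
  apply: nm; constructor => y [ym Rym]; apply: contrapT => /mP Rmy.
  by apply: ym; apply: Ranti.
have lt0_tot x y : x <> y -> lt0 x y \/ lt0 y x.
  by move=> xy; have [Rxy|Ryx] := Rtot x y; [left | right]; split=> // /esym.
have lt0_tr x y z : lt0 x y -> lt0 y z -> lt0 x z.
  move=> [xy Rxy] [yz Ryz]; split; last exact: Rtr Ryz.
  by move=> xz; subst z; apply: xy; apply: Ranti.
have [allsmall|] := pselect (forall x, small K [set y | lt0 y x]).
  by exists lt0.
move=> /existsNP nsmall.
have [x nx xmin] := minP _ nsmall.
move: nx => /negP; rewrite /small negbK => /card_ge_setTP[f [finj fx]].
exists (fun y z => lt0 (f y) (f z)); split.
- suff wf u : forall y, f y = u -> Acc (fun y z => lt0 (f y) (f z)) y.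
    by move=> y; apply: wf erefl.
  elim/(well_founded_ind lt0_wf): u => u IH y fyu; constructor => z.
  by rewrite fyu => /IH; apply.
- by move=> y z yz; apply: lt0_tot => /finj.
- by move=> y z t; apply: lt0_tr.
- move=> y; have sy : small K [set z | lt0 z (f y)].
    apply: contrapT => /xmin Rxy; have [fyx Ryx] := fx y.
    by apply: fyx; apply: Ranti.
  apply/smallP => -[h [hinj hP]]; move/smallP: sy; apply.
  by exists (f \o h); split=> // a b /finj /hinj.
Qed.

(** * Consequences of saturation for small sets *)

Section Saturated.
Variable K : rcfType.
Hypothesis K_sat : saturated K.

Lemma small1 (T : Type) (a : T) : small K [set a].
Proof.
apply/smallP => -[f [finj fa]].
have /finj/eqP : f 0 = f 1 by rewrite (fa 0) (fa 1).
by rewrite eq_sym oner_eq0.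
Qed.

Lemma small0 (T : Type) : small K (@set0 T).
Proof. by apply/smallP => -[f [_ /(_ 0)]]. Qed.

(** The ring language has no order symbol: t is positive when its inverse is a nonzero square. The
    quantified index lies above the variables of [t], so nothing is captured. *)
Definition pos_formula (t : GRing.term K) : GRing.formula K :=
  let m := GRing.ub_var t in
  GRing.Exists m (GRing.Equal (GRing.Mul (GRing.Exp (GRing.Var K m) 2) t)
    (GRing.NatConst K 1)).

Lemma holds_pos e t : GRing.holds e (pos_formula t) <-> 0 < GRing.eval e t.
Proof.
rewrite /pos_formula /=; split=> [[x]|t0].
  rewrite nth_set_nth /= eqxx eval_set_nth_fresh // => xt.
  rewrite ltNge; apply/negP => t0; have : x ^+ 2 * GRing.eval e t <= 0.
    by rewrite mulr_ge0_le0 ?sqr_ge0.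
  by rewrite xt ler10.
exists (Num.sqrt (GRing.eval e t)^-1).
rewrite nth_set_nth /= eqxx eval_set_nth_fresh //.
by rewrite sqr_sqrtr ?invr_ge0 ?(ltW t0) // mulVf // gt_eqF.
Qed.

Lemma pos_formula_over (A : set K) t : term_over A t -> formula_over A (pos_formula t).
Proof. by []. Qed.

(** A proper filter containing the solution set of each formula contains every finite intersection
    of them, so finite satisfiability need not be checked case by case. *)
Lemma saturated_filter (A : set K) (p : set (GRing.formula K))
    (F : set_system K) : ProperFilter F -> small K A ->
  p `<=` formula_over A -> (forall f, p f -> F [set x | GRing.holds [:: x] f]) ->
  exists x, forall f, p f -> GRing.holds [:: x] f.
Proof.
move=> FF sA pA pF; apply: K_sat sA pA _ => q qp.
move=> /(@finite_seqP {classic GRing.formula K})[s qE].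
suff /filter_ex[x xP] : F [set x | forall f : {classic GRing.formula K},
    f \in s -> GRing.holds [:: x] f].
  by exists x => f qf; apply: xP; move: qf; rewrite qE.
have {qE} : forall f : {classic GRing.formula K}, f \in s -> p f.
  by move=> f fs; apply: qp; rewrite qE.
elim: s => [|f s IH] sp; first by apply: filterE => x f.
have Ff := pF f (sp f (mem_head _ _)).
have {IH} Fs := IH (fun g gs => sp g (mem_behead (s := f :: s) gs)).
by apply: filterS2 Ff Fs => x fx sx g; rewrite inE => /predU1P[->//|/sx].
Qed.

Definition at_infty : set_system K := [set X | exists c, forall x, c < x -> X x].

Lemma at_infty_proper : ProperFilter at_infty.
Proof.
split; first by move=> [c /(_ (c + 1))]; apply; rewrite ltrDl.
split; first by exists 0.
  move=> P Q [c cP] [d dQ]; exists (Num.max c d) => x.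
  by rewrite gt_max => /andP[/cP ? /dQ].
by move=> P Q PQ [c cP]; exists c => x /cP/PQ.
Qed.

(** The conditions a < x, for a in the small set, all hold near +oo, so saturation realizes them
    together. *)
Lemma small_ubound (A : set K) : small K A -> exists s, forall a, A a -> a < s.
Proof.
move=> sA; pose h (a : K) := pos_formula (GRing.Add (GRing.Var K 0) (GRing.Opp (GRing.Const a))).
have [||s sP] := @saturated_filter A (h @` A) _ at_infty_proper sA.
- by move=> _ [a Aa <-]; apply: pos_formula_over.
- by move=> _ [a Aa <-]; exists a => x ax; apply/holds_pos; rewrite /= subr_gt0.
- exists s => a Aa; rewrite -subr_gt0.
  by have /holds_pos := sP (h a) (imageP _ Aa).
Qed.

Lemma ray_inj (s : K) : exists f : K -> K, injective f /\ forall x, s < f x.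
Proof.
(* Nonnegative x land in [s + 1, +oo) and negative x in (s, s + 1), so the two branches cannot
   collide. *)
exists (fun x => if 0 <= x then s + (x + 1) else s + (1 - x)^-1); split; last first.
  move=> x; case: ifP => x0; rewrite ltrDl; first by rewrite ltr_wpDl.
  by rewrite invr_gt0 subr_gt0 (lt_trans _ ltr01) // ltNge x0.
have lt1 (x : K) : (0 <= x) = false -> (1 - x)^-1 < 1.
  move/negbT; rewrite -ltNge => x0; rewrite invf_lt1 ?ltrDl ?oppr_gt0 //.
  by rewrite subr_gt0 (lt_trans x0).
move=> x y; case: ifP => x0; case: ifP => y0 /addrI.
- by move/addIr.
- by move=> E; have := lt1 _ y0; rewrite -E ltNge lerDr x0.
- by move=> E; have := lt1 _ x0; rewrite E ltNge lerDr y0.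
- by move/invr_inj/addrI/oppr_inj.
Qed.

(* If K injected into A u B, a point above the part landing in A would exist by
   saturation, and the ray above it, equipotent to K, would embed in B. *)
Lemma smallU (T : Type) (A B : set T) : small K A -> small K B -> small K (A `|` B).
Proof.
move=> sA sB; apply/smallP => -[f [finj fAB]].
have sP : small K [set x | A (f x)].
  apply/smallP => -[g [ginj gP]]; move/smallP: sA; apply.
  by exists (f \o g); split=> // x y /finj/ginj.
have [s sgt] := small_ubound sP; have [g [ginj gs]] := ray_inj s.
move/smallP: sB; apply; exists (f \o g); split=> [x y /finj/ginj//|x].
have [/= Afg|//] := fAB (g x); have := sgt _ Afg.
by rewrite ltNge (ltW (gs x)).
Qed.

Lemma small_seq (T : eqType) (s : seq T) : small K [set` s].
Proof.
elim: s => [|a s IH].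
  by apply: small_sub (small0 T) => x; rewrite /= in_nil.
apply: small_sub (smallU (small1 a) IH) => x /=.
by rewrite inE => /predU1P[->|]; [left | right].
Qed.

End Saturated.
End SmallSets.

(** * Automorphisms of saturated models *)

Section Automorphisms.
Variable K : rcfType.
Hypothesis K_sat : saturated K.

Local Notation X_ := (GRing.Var K).
Local Notation zeroT := (GRing.NatConst K 0).

(** A partial elementary map, kept as a relation to make it symmetric; the formula equating two
    variables shows that it is functional and injective. *)
Definition elementary (E : set (K * K)) := forall f, formula_over set0 f ->
  forall s : seq (K * K), (forall p, p \in s -> E p) ->
  GRing.holds (map fst s) f <-> GRing.holds (map snd s) f.

Definition swap_rel (E : set (K * K)) := [set (p.2, p.1) | p in E].

Lemma swap_relP E x y : swap_rel E (x, y) <-> E (y, x).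
Proof.
by split=> [[[a b] Eab [<- <-]]//|Eyx]; exists (y, x).
Qed.

Lemma elementary_swap E : elementary E -> elementary (swap_rel E).
Proof.
move=> Ee f f0 s sE; pose s' := [seq (p.2, p.1) | p <- s].
have -> : map fst s = map snd s' by rewrite -map_comp.
have -> : map snd s = map fst s' by rewrite -map_comp.
apply: iff_sym; apply: Ee => // _ /mapP[[x y] /sE/swap_relP Eyx ->].
exact: Eyx.
Qed.

Definition var_block k n := mkseq (fun i => X_ (k + i)) n.

Lemma eval_var_block e k n : (k + n <= size e)%N ->
  map (GRing.eval e) (var_block k n) = take n (drop k e).
Proof.
move=> kn; apply: (@eq_from_nth _ 0).
  by rewrite size_map size_mkseq size_takel // size_drop leq_subRL // (leq_trans (leq_addr n k)).
move=> i; rewrite size_map size_mkseq => ltin.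
by rewrite (nth_map zeroT) ?size_mkseq // nth_mkseq // nth_take // nth_drop.
Qed.

Lemma nth_var_block_over A k n i : term_over A (nth zeroT (var_block k n) i).
Proof.
have [lti|lei] := ltnP i n; first by rewrite nth_mkseq.
by rewrite nth_default ?size_mkseq.
Qed.

Section Extension.
Variables (E : set (K * K)) (a : K).
Hypotheses (Ee : elementary E) (E0 : E (0, 0)).

(** The type of [a] over the domain of [E], transported along [E]: a realization is a possible image
    of [a]. *)
Definition type_filter : set_system K := [set X | exists f s,
  [/\ formula_over set0 f, forall p, p \in s -> E p,
      GRing.holds (a :: map fst s) f &
      forall y, GRing.holds (y :: map snd s) f -> X y]].

Lemma type_filter_proper : ProperFilter type_filter.
Proof.
split.
  move=> [f [s [f0 sE fa nf]]].
  (* The pair (0, 0) only fills slot 0, which the quantifier overwrites. *)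
  have : GRing.holds (map fst ((0, 0) :: s)) (GRing.Exists 0 f) by exists a.
  have /Ee -> : formula_over set0 (GRing.Exists 0 f) by [].
    by move=> [y /nf].
  by move=> p; rewrite inE => /predU1P[->|/sE].
split.
- by exists (GRing.Bool true), [::]; split.
- move=> P Q [f [s [f0 sE fa fP]]] [g [t [g0 tE ga gQ]]].
  (* In an environment built on [s ++ t], the terms [ts] and [tt] select the slots of [s] and of
     [t]; both share slot 0. *)
  pose ts := X_ 0 :: var_block 1 (size s).
  pose tt := X_ 0 :: var_block (1 + size s) (size t).
  have tsE h x : map (GRing.eval (x :: map h (s ++ t))) ts = x :: map h s.
    rewrite /= eval_var_block /=; last by rewrite size_map size_cat !addSn !add0n ltnS leq_addr.
    by rewrite drop0 map_cat take_size_cat ?size_map.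
  have ttE h x : map (GRing.eval (x :: map h (s ++ t))) tt = x :: map h t.
    rewrite /= eval_var_block /=; last by rewrite size_map size_cat !addSn !add0n.
    by rewrite map_cat drop_size_cat ?size_map // take_oversize ?size_map.
  exists (GRing.And (fsubsts ts f) (fsubsts tt g)), (s ++ t); split.
  + split; apply: fsubsts_over => // -[|i] //; exact: nth_var_block_over.
  + by move=> p; rewrite mem_cat => /orP[/sE|/tE].
  + by split; apply/holds_fsubsts; rewrite ?tsE ?ttE.
  + by move=> y /= [/holds_fsubsts + /holds_fsubsts]; rewrite tsE ttE => /fP ? /gQ.
- move=> P Q PQ [f [s [f0 sE fa fP]]]; exists f, s; split=> // y /fP; exact: PQ.
Qed.

Lemma elementary_extend : small K (snd @` E) ->
  exists b, elementary (E `|` [set (a, b)]).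
Proof.
move=> sE.
pose inst (f : GRing.formula K) (s : seq (K * K)) :=
  fsubsts (X_ 0 :: map (@GRing.Const K) (map snd s)) f.
have instE x f s : GRing.holds [:: x] (inst f s) <-> GRing.holds (x :: map snd s) f.
  by rewrite /inst holds_fsubsts /= -[in X in X <-> _]map_comp map_id_in.
pose p := [set g | exists f s, [/\ formula_over set0 f, forall p, p \in s -> E p,
      GRing.holds (a :: map fst s) f & g = inst f s]].
have [||b bP] := saturated_filter K_sat type_filter_proper (p := p) sE.
- move=> _ [f [s [f0 fs _ ->]]]; apply: fsubsts_over; last exact: formula_over_sub f0.
  move=> [|i] //=; have [lti|lei] := ltnP i (size s); last first.
    by rewrite nth_default ?size_map.
  rewrite (nth_map 0) ?size_map //= (nth_map (0, 0)) //.
  by exists (nth (0, 0) s i) => //; apply: fs; apply: mem_nth.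
- move=> _ [f [s [f0 fs fa ->]]]; exists f, s; split=> // y fy; exact/instE.
have {bP} bP f s : formula_over set0 f -> (forall p, p \in s -> E p) ->
    GRing.holds (a :: map fst s) f <-> GRing.holds (b :: map snd s) f.
  move=> f0 fs; split=> [fa|fb].
    by apply/instE; apply: bP; exists f, s.
  apply: contrapT => nfa.
  have /bP/instE : p (inst (GRing.Not f) s) by exists (GRing.Not f), s.
  by apply.
exists b => f f0 s sEab.
(* A tuple from the extended relation is rewritten over [E] alone: each entry outside [E] is the new
   pair, and its slot is read off the variable 0 instead. *)
pose s' := [seq if `[< E p >] then p else (0, 0) | p <- s].
pose ts := mkseq (fun i => if `[< E (nth (0, 0) s i) >] then X_ i.+1 else X_ 0) (size s).
have tsE (h : K * K -> K) x : (forall p, p \in s -> ~ E p -> h p = x) ->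
    map (GRing.eval (x :: map h s')) ts = map h s.
  move=> hx; apply: (@eq_from_nth _ 0); first by rewrite !size_map size_iota.
  move=> i; rewrite size_map size_mkseq => ltis.
  rewrite (nth_map zeroT) ?size_mkseq // nth_mkseq // [in RHS](nth_map (0, 0)) //.
  case: asboolP => Esi /=; last by rewrite hx // mem_nth.
  by rewrite (nth_map (0, 0)) ?size_map // (nth_map (0, 0)) // asboolT.
have fT : formula_over set0 (fsubsts ts f).
  apply: fsubsts_over => // i; have [lti|lei] := ltnP i (size s).
    by rewrite nth_mkseq //; case: ifP.
  by rewrite nth_default ?size_mkseq.
have s'E q : q \in s' -> E q.
  by move=> /mapP[q' _ ->]; case: asboolP.
have := bP _ _ fT s'E; rewrite !holds_fsubsts !tsE // => q qs nEq;
  by case: (sEab q qs) => // ->.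
Qed.
End Extension.

(** One step of back-and-forth: [a] receives an image, then a preimage by the same extension applied
    to the swapped relation. *)
Lemma elementary_extend2 E a : elementary E -> E (0, 0) -> small K E ->
  exists bc : K * K, elementary (E `|` [set (a, bc.1); (bc.2, a)]).
Proof.
move=> Ee E0 sE; have [b Eb] := elementary_extend a Ee E0 (small_image snd sE).
set E1 := E `|` _ in Eb; have sE1 : small K E1 by apply: smallU => //; apply: small1.
have E10 : E1 (0, 0) by left.
have E1s := elementary_swap Eb; have E1s0 : swap_rel E1 (0, 0) by exact/swap_relP.
have [c] := elementary_extend a E1s E1s0 (small_image _ (small_image _ sE1)).
move/elementary_swap => Ec; exists (b, c) => f f0 s sE'; apply: Ec => // p /sE' {sE'}.
case: p => x y /= [Exy|[|] [-> ->]]; apply/swap_relP.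
- by left; apply/swap_relP; left.
- by left; apply/swap_relP; right.
- by right.
Qed.

(** Transfinite back-and-forth. The stage at x adds two pairs for each element below x, hence
    remains small and can be extended by saturation. *)
Lemma elementary_total E0 : elementary E0 -> E0 (0, 0) -> small K E0 ->
  exists E, [/\ E0 `<=` E, elementary E, forall x, exists y, E (x, y) &
    forall y, exists x, E (x, y)].
Proof.
move=> E0e E00 sE0; have [lt [lt_wf lt_tot lt_tr lt_small]] := small_wellorder K.
(* The recursion is defined before its stages are known to be elementary, so [ext] must be total,
   with an arbitrary value elsewhere. *)
have /choice[ext extP] : forall Ea : set (K * K) * K, exists bc : K * K,
    elementary Ea.1 -> Ea.1 (0, 0) -> small K Ea.1 ->
    elementary (Ea.1 `|` [set (Ea.2, bc.1); (bc.2, Ea.2)]).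
  move=> -[E a] /=; have [[Ee E0' sE]|nE] :=
      pselect [/\ elementary E, E (0, 0) & small K E].
    by have [bc bcP] := elementary_extend2 a Ee E0' sE; exists bc.
  by exists (0, 0) => Ee E0' sE; case: nE.
pose pieces x (bc : K * K) := [set (x, bc.1); (bc.2, x)].
pose step x (rec : forall y, lt y x -> K * K) := ext
  (E0 `|` [set p | exists y (yx : lt y x), pieces y (rec y yx) p], x).
pose g : K -> K * K := Fix lt_wf (fun=> (K * K)%type) step.
pose H (D : K -> Prop) := E0 `|` [set p | exists2 y, D y & pieces y (g y) p].
have gE x : g x = ext (H (lt^~ x), x).
  rewrite /g Fix_eq; last first.
    move=> y r1 r2 r12; congr ext; congr pair; congr setU; apply/seteqP.
    by split=> p [z [zy zp]]; exists z, zy; rewrite ?r12 // -r12.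
  congr ext; congr pair; congr setU; apply/seteqP.
  by split=> p [z]; [move=> [zy zp]; exists z | move=> zy zp; exists z, zy].
pose G y := H (lt^~ y) `|` pieces y (g y).
have GH x y : lt y x -> G y `<=` H (lt^~ x).
  move=> yx p [[E0p|[z zy zp]]|pp]; first by left.
    by right; exists z => //; apply: lt_tr yx.
  by right; exists y.
(* A formula involves finitely many pairs, and these already lie in a single stage because the
   stages increase along [lt]. *)
have HE (D : K -> Prop) : (forall y, D y -> elementary (G y)) -> elementary (H D).
  move=> GE f f0 s sH.
  have : (forall p, p \in s -> E0 p) \/
      exists2 y, D y & forall p, p \in s -> G y p.
    elim: s sH => [|p s IH] sH; first by left.
    have [|sE0'|[y Dy sG]] := IH.
        by move=> q qs; apply: sH; rewrite inE qs orbT.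
      have [E0p|[z Dz zp]] := sH p (mem_head _ _).
        by left=> q; rewrite inE => /predU1P[->|/sE0'].
      right; exists z => // q; rewrite inE => /predU1P[->|/sE0' E0q].
        by right.
      by left; left.
    right; have [E0p|[z Dz zp]] := sH p (mem_head _ _).
      exists y => // q; rewrite inE => /predU1P[->|/sG//].
      by left; left.
    have [yz|/lt_tot[yz|zy]] := pselect (y = z).
    - exists y => // q; rewrite inE => /predU1P[->|/sG//].
      by right; rewrite yz.
    - exists z => // q; rewrite inE => /predU1P[->|/sG Gq]; first by right.
      by left; apply: GH Gq.
    - exists y => // q; rewrite inE => /predU1P[->|/sG//].
      by left; apply: (GH _ z) => //; right.
  by move=> [sE|[y /GE Gy sG]]; [apply: E0e | apply: Gy].
have GE x : elementary (G x).
  elim/(well_founded_ind lt_wf): x => x IH.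
  have := extP (H (lt^~ x), x); rewrite -gE; apply => /=; first exact: HE.
    by left.
  apply: smallU => //.
  apply: small_sub (smallU K_sat (small_image (fun y => (y, (g y).1)) (lt_small x))
    (small_image (fun y => ((g y).2, y)) (lt_small x))).
  by move=> p [y yx [->|->]]; [left | right]; exists y.
exists (H (fun=> Logic.True)); split.
- by move=> p; left.
- by apply: HE => y _; apply: GE.
- by move=> x; exists (g x).1; right; exists x => //; left.
- by move=> x; exists (g x).2; right; exists x => //; right.
Qed.

(** The map fixing [A] and sending [a] to [b] is elementary and extends to a total relation;
    preservation of the formulas for 1, subtraction and product makes it a field automorphism. *)
Theorem exists_automorphism (A : set K) a b : small K A ->
  (forall f, formula_over A f -> GRing.holds [:: a] f -> GRing.holds [:: b] f) ->
  exists sigma : {rmorphism K -> K},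
    [/\ bijective sigma, forall c, A c -> sigma c = c & sigma a = b].
Proof.
move=> sA ab.
have {}ab f : formula_over A f -> GRing.holds [:: a] f <-> GRing.holds [:: b] f.
  move=> fA; split; first exact: ab.
  by move=> fb; apply: contrapT => nfa; have := ab (GRing.Not f) fA nfa.
pose A0 := A `|` [set 0].
pose E0 := [set (c, c) | c in A0] `|` [set (a, b)].
have E0e : elementary E0.
  move=> f f0 s sE.
  (* A tuple from [E0] is described over [A] in one variable: constants for elements of [A], a
     closed term for (0, 0), since 0 need not lie in [A], and variable 0 for the pair (a, b). *)
  pose ts := map (fun p : K * K => if `[< A p.1 /\ p.1 = p.2 >] then GRing.Const p.1
    else if p == (0, 0) then zeroT else X_ 0) s.
  have tsA : formula_over A (fsubsts ts f).
    apply: fsubsts_over; last exact: formula_over_sub f0.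
    move=> i; have [lti|lei] := ltnP i (size s); last by rewrite nth_default ?size_map.
    by rewrite (nth_map (0, 0)) //; case: asboolP => [[]//|_]; case: ifP.
  have tsE (h : K * K -> K) x : (forall p, p \in s -> p = (a, b) -> h p = x) ->
      (forall c, h (c, c) = c) ->
      map (GRing.eval [:: x]) ts = map h s.
    move=> hx hc; rewrite -map_comp; apply/eq_in_map => p ps /=.
    case: asboolP => [[_]|nA]; first by case: (p) => u v /= <-; rewrite hc.
    case: eqP => [->|n0] /=; first by rewrite hc.
    case: (sE p ps) => [[c [Ac|->] pE]|pE]; last by rewrite hx.
      by case: nA; rewrite -pE.
    by case: n0; rewrite -pE.
  have := ab _ tsA; rewrite !holds_fsubsts (tsE fst a) ?(tsE snd b) //.
  - by move=> p _ ->.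
  - by move=> p _ ->.
have E00 : E0 (0, 0) by left; exists 0 => //; right.
have sE0 : small K E0.
  by do !apply: smallU; rewrite //; [apply: small_image; apply: smallU => // |];
    apply: small1.
have [E [EE0 Ee Et Es]] := elementary_total E0e E00 sE0.
have [s sP] := choice Et.
have atom (f : GRing.formula K) (l : seq (K * K)) : formula_over set0 f ->
    (forall p, p \in l -> E p) -> GRing.holds (map fst l) f ->
    GRing.holds (map snd l) f.
  by move=> f0 lE; apply: (iffLR (Ee f f0 l lE)).
have Efun x y : E (x, y) -> s x = y.
  move=> Exy; apply: (atom (GRing.Equal (X_ 0) (X_ 1)) [:: (x, s x); (x, y)]) => //.
  by move=> p; rewrite !inE => /orP[/eqP->|/eqP->].
have s1 : s 1 = 1.
  apply: (atom (GRing.Equal (X_ 0) (GRing.NatConst K 1)) [:: (1, s 1)]) => //.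
  by move=> p; rewrite inE => /eqP->.
have sB : {morph s : x y / x - y}.
  move=> x y; apply: (atom (GRing.Equal (X_ 0) (GRing.Add (X_ 1) (GRing.Opp (X_ 2))))
    [:: (x - y, s (x - y)); (x, s x); (y, s y)]) => //.
  by move=> p; rewrite !inE => /or3P[/eqP->|/eqP->|/eqP->].
have sM : {morph s : x y / x * y}.
  move=> x y; apply: (atom (GRing.Equal (X_ 0) (GRing.Mul (X_ 1) (X_ 2)))
    [:: (x * y, s (x * y)); (x, s x); (y, s y)]) => //.
  by move=> p; rewrite !inE => /or3P[/eqP->|/eqP->|/eqP->].
pose m1 := GRing.isZmodMorphism.Build K K s sB.
pose m2 := GRing.isMonoidMorphism.Build K K s (conj s1 sM).
pose sigma : {rmorphism K -> K} := HB.pack s m1 m2.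
have sigmaE x : sigma x = s x by [].
exists sigma; split.
- have [t tP] := choice Es; exists t => x; last by rewrite sigmaE; apply: Efun.
  by apply: (fmorph_inj sigma); rewrite !sigmaE; apply: Efun.
- by move=> c Ac; rewrite sigmaE; apply: Efun; apply: EE0; left; exists c => //; left.
- by rewrite sigmaE; apply: Efun; apply: EE0; right.
Qed.

End Automorphisms.

(** * Rotations and generic points *)

Section Rotations.
Variable F : fieldType.

Definition rot_mx (a b : F) : 'M[F]_2 :=
  \matrix_(i, j) (if i == j then a else if i == 0 then - b else b).

Fact rot_mx_subproof (a b : F) : a ^+ 2 + b ^+ 2 = 1 ->
  (rot_mx a b *m (rot_mx a b)^T == 1%:M) && (\det (rot_mx a b) == 1).
Proof.
move=> ab; apply/andP; split; last first.
  by rewrite det2E !mxE /= -ab; apply/eqP; ring.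
apply/eqP/matrixP => i j; rewrite !mxE sum2E !mxE.
by case: (ord2E i) => ->; case: (ord2E j) => ->; rewrite /= -?ab; ring.
Qed.

Definition rotation (a b : F) (ab : a ^+ 2 + b ^+ 2 = 1) : SO2 F :=
  MkSO2 (rot_mx_subproof ab).

Lemma rotation00 a b (ab : a ^+ 2 + b ^+ 2 = 1) : rotation ab 0 0 = a.
Proof. by rewrite mxE eqxx. Qed.

Lemma rotation10 a b (ab : a ^+ 2 + b ^+ 2 = 1) : rotation ab 1 0 = b.
Proof. by rewrite mxE. Qed.

Lemma SO2_eqP (s t : SO2 F) : s 0 0 = t 0 0 -> s 1 0 = t 1 0 -> s = t.
Proof.
move=> e00 e10; have [s11 s10] := SO2_entries s; have [t11 t10] := SO2_entries t.
have e01 : s 0 1 = t 0 1 by apply: oppr_inj; rewrite -s10 -t10.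
apply: val_inj; apply/matrixP => i j /=.
by case: (ord2E i) => ->; case: (ord2E j) => ->; rewrite ?s11 ?t11.
Qed.

Lemma SO2_norm (t : SO2 F) : t 0 0 ^+ 2 + t 1 0 ^+ 2 = 1.
Proof.
have := SO2_det t; rewrite det2E; have [-> ->] := SO2_entries t.
by move=> <-; ring.
Qed.

Lemma SO2_addE (s t : SO2 F) : ((s + t) 0 0 = s 0 0 * t 0 0 - s 1 0 * t 1 0) *
  ((s + t) 1 0 = s 1 0 * t 0 0 + s 0 0 * t 1 0).
Proof.
have [s11 s10] := SO2_entries s.
by split; rewrite /= mxE sum2E ?s11 ?s10 ?opprK // mulNr opprK.
Qed.

Lemma SO2_oppE (t : SO2 F) : ((- t) 0 0 = t 0 0) * ((- t) 1 0 = - t 1 0).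
Proof. by have [_ t10] := SO2_entries t; split; rewrite /= mxE // t10 opprK. Qed.

Lemma SO2_0E : ((0 : SO2 F) 0 0 = 1) * ((0 : SO2 F) 1 0 = 0).
Proof. by split; rewrite /= mxE. Qed.

End Rotations.

Section BaseChangeMorph.
Variables (F L : fieldType) (j : {rmorphism F -> L}).

Lemma SO2_mapE (t : SO2 F) i k : SO2_map j t i k = j (t i k).
Proof. by rewrite /= mxE. Qed.

Lemma SO2_mapB : {morph SO2_map j : s t / s - t}.
Proof.
move=> s t; apply: SO2_eqP; rewrite !(SO2_addE, SO2_oppE, SO2_mapE);
  by rewrite !(rmorphD, rmorphM, rmorphN).
Qed.

Lemma SO2_map0 : SO2_map j 0 = 0.
Proof. by rewrite -(subr0 0) SO2_mapB subrr. Qed.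

Lemma SO2_mapN : {morph SO2_map j : t / - t}.
Proof. by move=> t; rewrite -[in LHS](add0r (- t)) SO2_mapB SO2_map0 add0r. Qed.

Lemma SO2_mapD : {morph SO2_map j : s t / s + t}.
Proof. by move=> s t; rewrite -[t in LHS]opprK SO2_mapB SO2_mapN opprK. Qed.

Lemma SO2_map_mulz t (z : int) : SO2_map j (t *~ z) = SO2_map j t *~ z.
Proof.
have mapn n : SO2_map j (t *+ n) = SO2_map j t *+ n.
  by elim: n => [|n IH]; rewrite ?SO2_map0 // !mulrS SO2_mapD IH.
by case: z => n; rewrite ?NegzE ?mulrNz ?SO2_mapN -!pmulrn mapn.
Qed.

Lemma SL2_mapM : {morph SL2_map j : x y / (x * y)%g}.
Proof. by move=> x y; apply: val_inj; rewrite /= map_mxM. Qed.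

Lemma SL2_map1 : SL2_map j 1%g = 1%g.
Proof. by apply: val_inj; rewrite /= map_mx1. Qed.
End BaseChangeMorph.

Section HalfAngle.
Variable K : rcfType.
Implicit Types s x : K.

Lemma addr1_sqr_gt0 s : 0 < 1 + s ^+ 2.
Proof. by rewrite ltr_wpDr // sqr_ge0. Qed.

Lemma addr1_sqr_neq0 s : 1 + s ^+ 2 != 0.
Proof. by rewrite gt_eqF ?addr1_sqr_gt0. Qed.

Fact half_angle_subproof s :
  ((1 - s ^+ 2) / (1 + s ^+ 2)) ^+ 2 + (2 * s / (1 + s ^+ 2)) ^+ 2 = 1.
Proof. by field; rewrite addr1_sqr_neq0. Qed.

(* s is the tangent of half the angle, so -1 is the only rotation missed. *)
Definition rot s : SO2 K := rotation (half_angle_subproof s).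

(** The addition formula for the tangent of the half angle; a zero denominator would mean that the
    sum is the half-turn. *)
Lemma rotD s x : 1 - s * x != 0 -> rot s + rot x = rot ((s + x) / (1 - s * x)).
Proof.
move=> sx; have s0 := addr1_sqr_neq0 s; have x0 := addr1_sqr_neq0 x.
have d0 : (1 - s * x) ^+ 2 + (s + x) ^+ 2 != 0.
  have -> : (1 - s * x) ^+ 2 + (s + x) ^+ 2 = (1 + s ^+ 2) * (1 + x ^+ 2) by ring.
  by rewrite mulf_neq0.
apply: SO2_eqP; rewrite SO2_addE !rotation00 !rotation10; field;
  by rewrite ?sx ?s0 ?x0 ?d0.
Qed.

Lemma rot_map (sigma : {rmorphism K -> K}) s : SO2_map sigma (rot s) = rot (sigma s).
Proof.
apply: SO2_eqP; rewrite SO2_mapE ?rotation00 ?rotation10;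
  by rewrite !(fmorph_div, rmorphD, rmorphN, rmorphM, rmorphXn, rmorph1, rmorph_nat).
Qed.

(** The identity tan(u/2) = sin u / (1 + cos u). *)
Lemma rotE (t : SO2 K) : t 0 0 != -1 -> t = rot (t 1 0 / (1 + t 0 0)).
Proof.
move=> t0; have d0 : 1 + t 0 0 != 0 by rewrite addrC addr_eq0.
set s := _ / _; have s1 : 1 + s ^+ 2 = 2 / (1 + t 0 0).
  have -> : s ^+ 2 = (1 - t 0 0 ^+ 2) / (1 + t 0 0) ^+ 2.
    by rewrite /s expr_div_n -(SO2_norm t) [X in _ = X / _]addrC addKr.
  by field.
have s2 : 1 - s ^+ 2 = 2 * t 0 0 / (1 + t 0 0).
  have -> : 1 - s ^+ 2 = 2 - (1 + s ^+ 2) by ring.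
  by rewrite s1; field.
apply: SO2_eqP; rewrite ?rotation00 ?rotation10 s1 ?s2 /s; field;
  by rewrite d0 ?pnatr_eq0.
Qed.

End HalfAngle.

(** * Generic points and their translates *)

Section Generic.
Variable K : rcfType.
Hypothesis K_sat : saturated K.

(** A proper filter that decides every formula is a complete type over [K]; the points [generic]
    over [A] realize its restriction to [A]. *)
Definition decides (F : set_system K) := forall f : GRing.formula K,
  F [set x | GRing.holds [:: x] f] \/ F [set x | ~ GRing.holds [:: x] f].

Definition generic (F : set_system K) (A : set K) (s : K) :=
  forall f, formula_over A f -> F [set x | GRing.holds [:: x] f] ->
    GRing.holds [:: s] f.

Lemma exists_generic F A : ProperFilter F -> small K A -> exists s, generic F A s.
Proof.
move=> FF sA; have [f []//|f []//|s sP] := saturated_filter K_sat FF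
  (p := [set f | formula_over A f /\ F [set x | GRing.holds [:: x] f]]) sA.
by exists s => f fA Ff; apply: sP.
Qed.

Lemma generic_sub F A B s : A `<=` B -> generic F B s -> generic F A s.
Proof. by move=> AB sB f /(formula_over_sub AB); apply: sB. Qed.

Lemma generic_conj F A s s' : decides F -> small K A ->
  generic F A s -> generic F A s' -> exists sigma : {rmorphism K -> K},
    [/\ bijective sigma, forall c, A c -> sigma c = c & sigma s = s'].
Proof.
move=> Fd sA sg s'g; apply: exists_automorphism => // f fA fs.
have [Ff|Fn] := Fd f; first exact: s'g.
by have := sg (GRing.Not f) fA Fn.
Qed.

(* The classes of E are few, so a point s that is F-generic over A and a
   transversal is equivalent to a point t of the transversal; by homogeneity all
   points F-generic over A u {t} are, in particular some s and its translate. *)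
Lemma generic_translate (F : set_system K) (A B S : set K) (E : K -> K -> Prop)
    (tau : K -> K) f0 : ProperFilter F -> decides F ->
  small K A -> small K B -> small K S ->
  (forall x y z, E x z -> E y z -> E x y) ->
  (forall sigma : {rmorphism K -> K}, bijective sigma ->
     (forall a, A a -> sigma a = a) -> forall x y, E x y -> E (sigma x) (sigma y)) ->
  (forall x, exists2 t, S t & E x t) ->
  (forall C f, formula_over C f -> F [set x | GRing.holds [:: x] f] ->
     exists f', [/\ formula_over (C `|` B) f', F [set x | GRing.holds [:: x] f'] &
       forall x, GRing.holds [:: x] f' -> GRing.holds [:: tau x] f]) ->
  formula_over B f0 -> F [set x | GRing.holds [:: x] f0] ->
  exists s, E s (tau s) /\ GRing.holds [:: s] f0.
Proof.
move=> FF Fd sA sB sS Eeq Einv ES tauP f0B Ff0.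
have [s0 s0g] := exists_generic FF (smallU K_sat sA sS).
have [t St Es0t] := ES s0; pose C := A `|` [set t].
have sC : small K C by apply: smallU => //; apply: small1.
have CE s : generic F C s -> E s t.
  move=> sg; have [sigma [sb sid <-]] : exists sigma : {rmorphism K -> K},
      [/\ bijective sigma, forall c, C c -> sigma c = c & sigma s0 = s].
    apply: generic_conj Fd sC _ sg; apply: generic_sub s0g => x [Ax|->].
      by left.
    by right.
  rewrite -(sid t); last by right.
  by apply: Einv => // a Aa; apply: sid; left.
(* Genericity over the parameters [B] of [tau] as well makes [tau s] generic over [C], so that both
   are equivalent to [t]. *)
have [s sg] := exists_generic FF (smallU K_sat sC sB).
exists s; split; last by apply: sg => //; apply: formula_over_sub f0B => x; right.
apply: Eeq (CE s _) (CE _ _).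
  by apply: generic_sub sg => x; left.
move=> f fC Ff; have [f' [f'C Ff' f'P]] := tauP C f fC Ff.
by apply: f'P; apply: sg.
Qed.

(** Beyond the last break point given by o-minimality the truth value is constant. *)
Lemma decides_at_infty : decides (@at_infty K).
Proof.
move=> f; have [bs bsP] := QE.o_minimal f [::] 0.
have [c cbs] : exists c, forall b, b \in bs -> b <= c.
  elim: bs {bsP} => [|b bs [c IH]]; first by exists 0.
  exists (Num.max b c) => b'; rewrite inE => /predU1P[->|/IH b'c];
    by rewrite le_max ?lexx ?b'c ?orbT.
have fP x y : c < x -> c < y -> GRing.holds [:: x] f -> GRing.holds [:: y] f.
  move=> cx cy; have off u v b : c < u -> b \in bs -> ~~ (u <= b <= v).
    by move=> cu /cbs bc; rewrite negb_and -ltNge (le_lt_trans bc cu).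
  have [xy|yx] := leP x y; first by move/(bsP x y xy) => /=; apply=> b; apply: off.
  by move=> fx; apply/(bsP y x (ltW yx)) => // b; apply: off.
have [fc|nfc] := pselect (GRing.holds [:: c + 1] f); [left|right];
  exists c => x cx /=; first by apply: fP fc => //; rewrite ltrDl.
by move=> fx; apply: nfc; apply: fP fx => //; rewrite ltrDl.
Qed.

Definition infinitesimal (x : K) := forall n, `|x| < n.+1%:R^-1.

(** The cut between the infinitesimals and the positive standard rationals. *)
Definition above_infinitesimals : set_system K :=
  [set X | exists c n, infinitesimal c /\ forall x, c < x -> x < n.+1%:R^-1 -> X x].

Lemma infinitesimal_max c d : infinitesimal c -> infinitesimal d ->
  infinitesimal (Num.max c d).
Proof. by move=> ci di n; case: (leP c d). Qed.

Lemma invS_le m n : (m <= n)%N -> n.+1%:R^-1 <= m.+1%:R^-1 :> K.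
Proof. by move=> mn; rewrite lef_pV2 ?posrE ?ltr0Sn // ler_nat. Qed.

Lemma above_infinitesimals_proper : ProperFilter above_infinitesimals.
Proof.
split.
  move=> [c [n [ci /(_ n.+2%:R^-1)]]]; apply.
    exact: le_lt_trans (ler_norm _) (ci _).
  by rewrite ltf_pV2 ?posrE ?ltr0Sn // ltr_nat.
split.
- by exists 0, 0%N; split=> // n; rewrite normr0 invr_gt0 ltr0Sn.
- move=> P Q [c [n [ci cP]]] [d [m [di dQ]]].
  exists (Num.max c d), (maxn n m); split; first exact: infinitesimal_max.
  move=> x; rewrite gt_max => /andP[cx dx] xnm; split.
    by apply: cP => //; apply: lt_le_trans xnm _; rewrite invS_le ?leq_maxl.
  by apply: dQ => //; apply: lt_le_trans xnm _; rewrite invS_le ?leq_maxr.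
- by move=> P Q PQ [c [n [ci cP]]]; exists c, n; split=> // x cx /(cP x cx)/PQ.
Qed.

Lemma decides_above_infinitesimals : decides above_infinitesimals.
Proof.
move=> f; have [bs bsP] := QE.o_minimal f [::] 0.
have [c [n [ci cbs]]] : exists c n, infinitesimal c /\
    forall b, b \in bs -> b <= c \/ n.+1%:R^-1 <= b.
  elim: bs {bsP} => [|b bs [c [n [ci IH]]]].
    by exists 0, 0%N; split=> // n; rewrite normr0 invr_gt0 ltr0Sn.
  have [[m mb]|nb] := pselect (exists m, m.+1%:R^-1 <= b).
    exists c, (maxn m n); split=> // b'; rewrite inE => /predU1P[->|/IH[?|nb']].
    - by right; apply: le_trans mb; rewrite invS_le ?leq_maxl.
    - by left.
    - by right; apply: le_trans nb'; rewrite invS_le ?leq_maxr.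
  have nb' m : b < m.+1%:R^-1 by rewrite ltNge; apply/negP => mb; apply: nb; exists m.
  (* The 0 absorbs negative break points, which need not be infinitesimal. *)
  exists (Num.max 0 (Num.max b c)), n; split.
    have [b0|b0] := leP b 0; last first.
      apply: infinitesimal_max; first by move=> k; rewrite normr0 invr_gt0 ltr0Sn.
      by apply: infinitesimal_max => // k; rewrite gtr0_norm.
    move=> k; rewrite maxA (max_idPl b0).
    by apply: infinitesimal_max ci k => k; rewrite normr0 invr_gt0 ltr0Sn.
  move=> b'; rewrite inE !le_max => /predU1P[->|/IH[b'c|]].
  - by left; rewrite lexx orbT.
  - by left; rewrite b'c !orbT.
  - by right.
set d := n.+1%:R^-1 in cbs.
have fP x y : c < x < d -> c < y < d -> GRing.holds [:: x] f -> GRing.holds [:: y] f.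
  move=> /andP[cx xd] /andP[cy yd].
  have off u v b : c < u -> v < d -> b \in bs -> ~~ (u <= b <= v).
    move=> cu vd /cbs[bc|db]; rewrite negb_and -!ltNge.
      by rewrite (le_lt_trans bc cu).
    by rewrite (lt_le_trans vd db) orbT.
  have [xy|yx] := leP x y; first by move/(bsP x y xy) => /=; apply=> b; apply: off.
  by move=> fx; apply/(bsP y x (ltW yx)) => // b; apply: off.
have pin : c < n.+2%:R^-1 < d.
  rewrite (le_lt_trans (ler_norm _) (ci _)) /=.
  by rewrite ltf_pV2 ?posrE ?ltr0Sn // ltr_nat.
have [fc|nfc] := pselect (GRing.holds [:: n.+2%:R^-1] f); [left|right];
  exists c, n; split=> // x cx xd /=; first by apply: fP fc => //; rewrite cx.
by move=> fx; apply: nfc; apply: fP fx => //; rewrite cx.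
Qed.

(** The type at +oo is invariant under translation by any x, so some s and s + x are congruent
    modulo [B]. *)
Lemma additive_subgroup_full (A S B : set K) : small K A -> small K S ->
  (forall x y, B x -> B y -> B (x - y)) ->
  (forall sigma : {rmorphism K -> K}, bijective sigma ->
     (forall a, A a -> sigma a = a) -> forall x, B x -> B (sigma x)) ->
  (forall x, exists2 t, S t & B (x - t)) ->
  forall x, B x.
Proof.
move=> sA sS BB Binv BS x.
have [||||||s [Bs _]] := @generic_translate (@at_infty K) A [set x] S
  (fun y z => B (y - z)) (fun y => y + x) (GRing.Bool true) (at_infty_proper K)
  decides_at_infty sA (small1 K x) sS.
- move=> a b c Bac Bbc; have -> : a - b = (a - c) - (b - c) by ring.
  exact: BB.
- by move=> sigma sb sid y z; rewrite -rmorphB; apply: Binv.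
- exact: BS.
- move=> C f fC [c cP].
  exists (fsubsts [:: GRing.Add (GRing.Var K 0) (GRing.Const x)] f); split.
  + apply: fsubsts_over; last by apply: formula_over_sub fC => y; left.
    by move=> [|[|i]] //=; split=> //; right.
  + exists (c - x) => y; rewrite ltrBlDr => /cP fy; exact/holds_fsubsts.
  + by move=> y /holds_fsubsts.
- by [].
- by exists 0.
have B0 : B 0 by rewrite -(subrr (s - (s + x))); apply: BB.
by have := BB _ _ B0 Bs; rewrite sub0r opprB addrC addKr.
Qed.

(** The argument of the additive case with the tangent addition law as translation: an infinitesimal
    [x] preserves the cut above the infinitesimals. *)
Lemma rot_subgroup_infinitesimal (A S : set K) (C : set (SO2 K)) :
  small K A -> small K S ->
  (forall s t, C s -> C t -> C (s - t)) ->
  (forall sigma : {rmorphism K -> K}, bijective sigma ->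
     (forall a, A a -> sigma a = a) -> forall t, C t -> C (SO2_map sigma t)) ->
  (forall x, exists2 t, S t & C (rot x - rot t)) ->
  forall x, infinitesimal x -> C (rot x).
Proof.
move=> sA sS CB Cinv CS x xi.
pose X0 := GRing.Var K 0; pose Cx := GRing.Const x; pose One := GRing.NatConst K 1.
(* The condition 0 < s < 1 keeps 1 - s x positive, so that [rotD] applies to [s]. *)
pose f0 := GRing.And (pos_formula X0) (pos_formula (GRing.Add One (GRing.Opp X0))).
have f0P s : GRing.holds [:: s] f0 <-> 0 < s < 1.
  split; first by move=> [/holds_pos + /holds_pos]; rewrite /= subr_gt0 => -> ->.
  by move=> /andP[s0 s1]; split; apply/holds_pos; rewrite //= subr_gt0.
have x1 : `|x| < 1 by have := xi 0%N; rewrite invr1.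
have sx s : 0 < s < 1 -> 0 < 1 - s * x < 2.
  move=> /andP[s0 s1]; have : `|s * x| < 1.
    rewrite normrM (gtr0_norm s0); apply: le_lt_trans x1.
    by rewrite ler_piMl ?normr_ge0 // ltW.
  by rewrite ltr_norml => /andP[h1 h2]; apply/andP; split; lra.
have [||||||s [Cs /f0P s01]] := @generic_translate above_infinitesimals A [set x] S
  (fun y z => C (rot y - rot z)) (fun y => (y + x) / (1 - y * x)) f0
  above_infinitesimals_proper decides_above_infinitesimals sA (small1 K x) sS.
- move=> a b c Bac Bbc; have -> : rot a - rot b = (rot a - rot c) - (rot b - rot c).
    by rewrite opprB addrA subrK.
  exact: CB.
- by move=> sigma sb sid y z; rewrite -!rot_map -SO2_mapB; apply: Cinv.
- exact: CS.
- move=> D f fD [c [n [ci cP]]].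
  pose t := GRing.Mul (GRing.Add X0 Cx)
    (GRing.Inv (GRing.Add One (GRing.Opp (GRing.Mul X0 Cx)))).
  exists (fsubsts [:: t] f); split.
  + apply: fsubsts_over; last by apply: formula_over_sub fD => y; left.
    by move=> [|[|i]] //=; do !split=> //; right.
  (* Above this lower bound, y + x exceeds 2 max(0, c) while 1 - y x is less than 2. Under the upper
     bound, y and |x| are below a quarter of 1/(n + 1), so y + x is below half of it while 1 - y x
     exceeds 3/4. *)
  + exists (2 * Num.max 0 c + 2 * `|x|), (4 * n.+1)%N; split.
      move=> m; set M := (8 * m.+1)%N.
      have := xi M; have : Num.max 0 c < M.+1%:R^-1.
        by rewrite gt_max invr_gt0 ltr0Sn (le_lt_trans (ler_norm _) (ci M)).
      have : M.+1%:R^-1 <= 8^-1 * m.+1%:R^-1 :> K.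
        by rewrite -invfM -natrM lef_pV2 ?posrE ?ltr0Sn // ler_nat /M.
      have : 0 < m.+1%:R^-1 :> K by rewrite invr_gt0 ltr0Sn.
      rewrite [`|_ + _|]ger0_norm ?addr_ge0 ?mulr_ge0 ?le_max ?lexx //.
      move: (Num.max 0 c) (`|x|) (m.+1%:R^-1) (M.+1%:R^-1) => a b u v; lra.
    move=> y cy yn; have m0 : 0 <= Num.max 0 c by rewrite le_max lexx.
    have cm : c <= Num.max 0 c by rewrite le_max lexx orbT.
    move: (Num.max 0 c) m0 cm cy => m m0 cm cy.
    have x0 : 0 <= `|x| by [].
    have [r0 r1] : 0 < n.+1%:R^-1 :> K /\ n.+1%:R^-1 <= 1 :> K.
      by rewrite invr_gt0 ltr0Sn invf_le1 ?ltr0Sn // ler1n.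
    have r4 : (4 * n.+1).+1%:R^-1 <= 4^-1 * n.+1%:R^-1 :> K.
      by rewrite -invfM -natrM lef_pV2 ?posrE ?ltr0Sn // ler_nat.
    have xr := xi (4 * n.+1)%N.
    move: ((4 * n.+1).+1%:R^-1) n.+1%:R^-1 r0 r1 r4 xr yn cP => r' r r0 r1 r4 xr yn cP.
    have y01 : 0 < y < 1 by apply/andP; split; lra.
    have yx : `|y * x| <= `|x|.
      have /andP[y0 y1] := y01.
      by rewrite normrM (gtr0_norm y0) ler_piMl // ltW.
    have /andP[D0 D2] := sx y y01.
    move: yx; rewrite ler_norml => /andP[yx1 yx2].
    have [xn1 xn2] : - `|x| <= x /\ x <= `|x| by rewrite ler_norm lerNnormlW.
    suff /cP fy : c < (y + x) / (1 - y * x) by apply/holds_fsubsts; apply: fy;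
      rewrite ltr_pdivrMr //; nra.
    rewrite ltr_pdivlMr //; nra.
  + by move=> y /holds_fsubsts.
- by do !split.
- exists 0, 0%N; split=> [n|y y0]; first by rewrite normr0 invr_gt0 ltr0Sn.
  by rewrite invr1 => y1; apply/f0P; rewrite y0.
have C0 : C 0.
  by rewrite -(subrr (rot s - rot ((s + x) / (1 - s * x)))); apply: CB.
have := CB _ _ C0 Cs; rewrite sub0r opprB -rotD.
  by rewrite addrC addKr.
by rewrite gt_eqF //; case/andP: (sx s s01).
Qed.

End Generic.

(** * Perfectness of connected covers of SL_2(R) *)

Section SpecialLinear.
Variable F : fieldType.
Implicit Types (x y : SL2 F) (a b c d s : F).

Definition mx2 a b c d : 'M[F]_2 :=
  \matrix_(i, j) (if i == 0 then if j == 0 then a else b else if j == 0 then c else d).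

Fact mx2_det a b c d : a * d - b * c = 1 -> \det (mx2 a b c d) == 1.
Proof. by move=> H; rewrite det2E !mxE /= H. Qed.

Definition sl2 a b c d (H : a * d - b * c = 1) : SL2 F := MkSL2 (mx2_det H).

Lemma sl2E a b c d (H : a * d - b * c = 1) : (sl2 H 0 0 = a) * (sl2 H 0 1 = b) *
  (sl2 H 1 0 = c) * (sl2 H 1 1 = d).
Proof. by rewrite !mxE. Qed.

Lemma SL2_eqP x y : x 0 0 = y 0 0 -> x 0 1 = y 0 1 -> x 1 0 = y 1 0 ->
  x 1 1 = y 1 1 -> x = y.
Proof.
move=> e00 e01 e10 e11; apply: val_inj; apply/matrixP => i j /=.
by case: (ord2E i) => ->; case: (ord2E j) => ->.
Qed.

Lemma SL2_mulE x y i j : (x * y)%g i j = x i 0 * y 0 j + x i 1 * y 1 j.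
Proof. by rewrite /= mxE sum2E. Qed.

Lemma SL2_oneE i j : (1%g : SL2 F) i j = (i == j)%:R.
Proof. by rewrite /= mxE. Qed.

Lemma SL2_detE x : x 0 0 * x 1 1 - x 0 1 * x 1 0 = 1.
Proof. by rewrite -det2E (eqP (SL2P x)). Qed.

Fact upper_subproof s : 1 * 1 - s * 0 = 1. Proof. by ring. Qed.
Fact lower_subproof s : 1 * 1 - 0 * s = 1. Proof. by ring. Qed.

Definition upper s := sl2 (upper_subproof s).
Definition lower s := sl2 (lower_subproof s).

Lemma upperD s t : (upper s * upper t)%g = upper (s + t).
Proof. by apply: SL2_eqP; rewrite SL2_mulE !sl2E; ring. Qed.

Lemma lowerD s t : (lower s * lower t)%g = lower (s + t).
Proof. by apply: SL2_eqP; rewrite SL2_mulE !sl2E; ring. Qed.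

Lemma upper0 : upper 0 = 1%g.
Proof. by apply: SL2_eqP; rewrite SL2_oneE sl2E. Qed.

Lemma lower0 : lower 0 = 1%g.
Proof. by apply: SL2_eqP; rewrite SL2_oneE sl2E. Qed.

Lemma upperV s : (upper s)^-1%g = upper (- s).
Proof.
by apply: (mulgI (upper s)); rewrite mulgV upperD subrr upper0.
Qed.

Lemma lowerV s : (lower s)^-1%g = lower (- s).
Proof.
by apply: (mulgI (lower s)); rewrite mulgV lowerD subrr lower0.
Qed.

Lemma SL2_lul x : x 0 1 != 0 ->
  x = (lower ((x 1 1 - 1) / x 0 1)%R * upper (x 0 1)%R *
       lower ((x 0 0 - 1) / x 0 1)%R)%g.
Proof.
move=> b0; have D := SL2_detE x.
have c : x 1 0 = (x 0 0 * x 1 1 - 1) / x 0 1 by rewrite -D; field.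
apply: SL2_eqP; rewrite !SL2_mulE !sl2E ?c; field; rewrite ?b0 //.
Qed.

Lemma SL2_unipotent_gen (Q : SL2 F -> Prop) :
  (forall x y, Q x -> Q y -> Q (x * y)%g) ->
  (forall s, Q (upper s)) -> (forall s, Q (lower s)) -> forall x, Q x.
Proof.
move=> QM Qu Ql; have gen x : x 0 1 != 0 -> Q x.
  by move=> b0; rewrite (SL2_lul b0); apply: (QM _ _ (QM _ _ _ _) _).
move=> x; have [b0|] := eqVneq (x 0 1) 0; last exact: gen.
have a0 : x 0 0 != 0.
  by apply: contra_eq_neq (SL2_detE x) => ->; rewrite b0 !mul0r subr0 eq_sym oner_eq0.
(* Multiplication by [upper 1] moves the nonzero diagonal entry into the vanishing upper right
   one. *)
rewrite -(mulgK (upper 1) x) upperV; apply: (QM) => //; apply: gen.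
by rewrite SL2_mulE !sl2E b0 mul0r addr0 mulr1.
Qed.

Section Commutators.
Hypothesis two_neq0 : (2 : F) != 0.

Fact half_subproof : 2^-1 * 2 - 0 * 0 = 1 :> F.
Proof. by field. Qed.

Fact double_subproof : 2 * 2^-1 - 0 * 0 = 1 :> F.
Proof. by field. Qed.

(** Conjugation by diag(1/2, 2) multiplies the parameter by 4, and the commutator subtracts the
    original s. *)
Lemma upper_commg s : [~ upper s, sl2 half_subproof]%g = upper (3 * s).
Proof.
have -> : [~ upper s, sl2 half_subproof]%g =
   (upper (- s) * (sl2 double_subproof * upper s * sl2 half_subproof))%g.
  rewrite commgEl conjgE upperV -!mulgA; congr (_ * (_ * _))%g.
  apply: (mulgI (sl2 half_subproof)); rewrite mulgV.
  by apply: SL2_eqP; rewrite SL2_mulE SL2_oneE !sl2E /=; field.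
by apply: SL2_eqP; rewrite !SL2_mulE !sl2E; field.
Qed.

Lemma lower_commg s : [~ lower s, sl2 double_subproof]%g = lower (3 * s).
Proof.
have -> : [~ lower s, sl2 double_subproof]%g =
   (lower (- s) * (sl2 half_subproof * lower s * sl2 double_subproof))%g.
  rewrite commgEl conjgE lowerV -!mulgA; congr (_ * (_ * _))%g.
  apply: (mulgI (sl2 double_subproof)); rewrite mulgV.
  by apply: SL2_eqP; rewrite SL2_mulE SL2_oneE !sl2E /=; field.
by apply: SL2_eqP; rewrite !SL2_mulE !sl2E; field.
Qed.
End Commutators.
End SpecialLinear.

(** The factorization [SL2_lul] divides by the upper right entry, which near 1 may be tiny or zero.
    Multiplying by [upper e] makes it comparable to e, while the diagonal stays within O(e^2) of 1,
    so all parameters are of order e. Hence eta is quadratic in e. *)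
Lemma SL2_near1_unipotent (F : realFieldType) (delta : F) : 0 < delta ->
  exists2 eta : F, 0 < eta & forall x : SL2 F,
    (forall i j, `|x i j - (1%g : SL2 F) i j| < eta) ->
    exists s1 s2 s3 s4, [/\ `|s1| < delta, `|s2| < delta, `|s3| < delta, `|s4| < delta &
      x = (lower s1 * upper s2 * lower s3 * upper s4)%g].
Proof.
move=> d0; pose e := Num.min delta 1 / 2.
have m0 : 0 < Num.min delta 1 by rewrite lt_min d0 ltr01.
have e0 : 0 < e by rewrite divr_gt0.
have e1 : e <= 1 / 2 by rewrite ler_pM2r ?invr_gt0 // ge_min lexx orbT.
have ed : 2 * e <= delta.
  by rewrite /e mulrC divfK ?pnatr_eq0 // ge_min lexx.
exists (e ^+ 2 / 8) => [|x xeta]; first by rewrite divr_gt0 ?exprn_gt0.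
have := xeta 0 0; have := xeta 0 1; have := xeta 1 0; have := xeta 1 1.
rewrite !SL2_oneE /= !subr0 => x11 x10 x01 x00.
pose y := (x * upper e)%g.
have y00 : y 0 0 = x 0 0 by rewrite SL2_mulE !sl2E; ring.
have y01 : y 0 1 = x 0 0 * e + x 0 1 by rewrite SL2_mulE !sl2E; ring.
have y11 : y 1 1 = x 1 0 * e + x 1 1 by rewrite SL2_mulE !sl2E; ring.
move: x11 x10 x01 x00; rewrite !ltr_norml.
move=> /andP[d1 d2] /andP[c1 c2] /andP[b1 b2] /andP[a1 a2].
have eta_e : e ^+ 2 / 8 <= e / 16.
  by rewrite expr2; nra.
have yb : e / 2 < y 0 1 < 3 / 2 * e by rewrite y01; apply/andP; split; nra.
have /andP[yb1 yb2] := yb; have yb0 : 0 < y 0 1 by apply: lt_trans yb1; rewrite divr_gt0.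
exists ((y 1 1 - 1) / y 0 1), (y 0 1), ((y 0 0 - 1) / y 0 1), (- e); split.
- rewrite ltr_norml ltr_pdivrMr // ltr_pdivlMr // y11.
  by apply/andP; split; nra.
- by rewrite gtr0_norm // (lt_le_trans yb2) //; lra.
- rewrite ltr_norml ltr_pdivrMr // ltr_pdivlMr // y00.
  by apply/andP; split; nra.
- by rewrite normrN gtr0_norm //; lra.
- rewrite -SL2_lul ?gt_eqF // -upperV; apply: (mulIg (upper e)).
  by rewrite -mulgA mulVg mulg1.
Qed.

(** * Unipotent lifts in a covering group *)

Section CoveringGroup.
Variable R : realType.

Lemma nbhs_SL2_1 (eta : R) : 0 < eta ->
  nbhs (1%g : SL2 R) [set x | forall i j, `|x i j - (1%g : SL2 R) i j| < eta].
Proof.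
move=> eta0.
have : nbhs (1%g : SL2 R) (@SL2val R @^-1` ball (SL2val (1%g : SL2 R)) eta).
  by apply: initial_continuous; apply: nbhsx_ballx.
apply: filterS => x [_ bx] i j; rewrite distrC; exact: bx.
Qed.

Lemma nbhs_SL2_unipotent (v : R -> SL2 R) (W : set (SL2 R)) :
  (forall s i j, `|v s i j - v 0 i j| <= `|s|) -> v 0 = 1%g -> nbhs (1%g : SL2 R) W ->
  exists2 delta : R, 0 < delta & forall s, `|s| < delta -> W (v s).
Proof.
move=> vs v0 [_ [[B Bo <-] B1 BW]].
have /nbhs_ballP[e e0 eB] : nbhs (SL2val (1%g : SL2 R)) B by apply: open_nbhs_nbhs.
exists e => // s se; apply: BW; apply: eB; split=> // i j.
have := vs s i j; rewrite v0 => H; rewrite /ball /= distrC.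
exact: le_lt_trans H se.
Qed.


Section Perfect.
Variables (E : topologicalGroupType) (p : E -> SL2 R).
Hypotheses (p_cover : covering_map p) (pM : {morph p : x y / (x * y)%g}).
Variable D : set E.
Hypotheses (DM : forall x y, D x -> D y -> D (x * y)%g)
  (DV : forall x, D x -> D x^-1%g) (Dcomm : forall x y, D [~ x, y]%g).

Lemma cover1 : p 1%g = 1%g.
Proof. by apply: (mulgI (p 1%g)); rewrite -pM !mulg1. Qed.

Lemma coverV x : p x^-1%g = (p x)^-1%g.
Proof. by apply: (mulgI (p x)); rewrite -pM !mulgV cover1. Qed.

Lemma nbhs_mulg2 (W : set E) : nbhs (1%g : E) W ->
  exists2 W' : set E, nbhs (1%g : E) W' & forall x y, W' x -> W' y -> W (x * y)%g.
Proof.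
move=> W1; have := @mulg_continuous E (1%g, 1%g) W; rewrite /= mulg1 => /(_ W1).
move=> [[A B] [/= A1 B1] AB]; exists (A `&` B); first exact: filterI.
by move=> x y [Ax _] [_ By]; apply: (AB (x, y)).
Qed.

Lemma nbhs_mulgl (x y : E) (W : set E) : nbhs (x * y)%g W ->
  nbhs y [set z | W (x * z)%g].
Proof.
move=> Wxy; have [[A B] [/= Ax By] AB] := @mulg_continuous E (x, y) W Wxy.
apply: filterS By => z Bz; apply: (AB (x, z)); split=> //=.
exact: nbhs_singleton.
Qed.

Lemma nbhs_commg (d : E) (W : set E) : nbhs (1%g : E) W ->
  nbhs (1%g : E) [set w | W [~ w, d]%g].
Proof.
move=> W1.
have c : (fun w : E => [~ w, d]%g) @ (1%g : E) --> ([~ 1%g, d]%g : E).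
  have -> : (fun w : E => [~ w, d]%g) = (fun w : E => (w^-1 * (d^-1 * (w * d)))%g).
    by apply/funext => w; rewrite commgEl conjgE.
  have -> : [~ 1%g, d]%g = (1%g^-1 * (d^-1 * (1%g * d)))%g :> E.
    by rewrite commgEl conjgE.
  have mulc (f h : E -> E) (a b : E) : f @ (1%g : E) --> a -> h @ (1%g : E) --> b ->
      (fun w => (f w * h w)%g) @ (1%g : E) --> (a * b)%g.
    move=> fa hb; exact: (@continuous2_cvg _ _ _ _ (nbhs (1%g : E)) _ f h (fun x y : E => (x * y)%g)
      a b (@mulg_continuous E (a, b)) fa hb).
  apply: (mulc); first exact: invg_continuous.
  apply: (mulc); first exact: cvg_cst.
  by apply: (mulc); [exact: cvg_id | exact: cvg_cst].
by apply: c; rewrite comm1g.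
Qed.

(** A lift w of v(s/3) is taken near 1 and replaced by its commutator with a lift of d. This lies in
    [D] and above v(s); by continuity it is still near 1 in the cover itself, not merely above a
    matrix near 1. *)
Lemma cover_unipotent_lift (v : R -> SL2 R) (d : SL2 R) (W : set E) :
  (forall s i j, `|v s i j - v 0 i j| <= `|s|) -> v 0 = 1%g ->
  (forall s, [~ v s, d]%g = v (3 * s)) -> nbhs (1%g : E) W ->
  exists2 delta : R, 0 < delta &
    forall s, `|s| < delta -> exists w, [/\ W w, D w & p w = v s].
Proof.
move=> vs v0 vd W1; have [_ psurj cov] := p_cover.
have [U [VV [Uo U1 pU _ VVP]]] := cov 1%g.
have [V VVV V1] : (\bigcup_(V in VV) V) 1%g by rewrite -pU /= cover1.
have [Vo _ pV] := VVP V VVV.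
have [d' _ pd] : range p d by rewrite psurj.
have nO : nbhs (1%g : E) ([set w | W [~ w, d']%g] `&` V).
  by apply: filterI; [apply: nbhs_commg | apply: open_nbhs_nbhs].
move: nO; rewrite nbhsE => -[Z [Zo Z1] ZWV].
have pO : nbhs (1%g : SL2 R) (p @` Z).
  apply: open_nbhs_nbhs; split; last by exists 1%g => //; apply: cover1.
  by apply: pV => // w /ZWV[].
have [delta delta0 dP] := nbhs_SL2_unipotent vs v0 pO.
exists delta => // s sd; have [|w Zw pw] := dP (s / 3).
  rewrite normrM; apply: le_lt_trans sd; rewrite ler_piMr //.
  by rewrite ger0_norm ?invr_ge0 // invf_le1 // ler1n.
exists [~ w, d']%g; split; [by have [] := ZWV _ Zw | exact: Dcomm |].
rewrite commgEl conjgE !pM !coverV pw pd -conjgE -commgEl vd.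
by congr v; field.
Qed.

(* Unipotents near 1 lift to D near 1, and every matrix near 1 is a product of
   four of them. *)
Lemma cover_perfect_nbhs : nbhs (1%g : E) D.
Proof.
have [pc _ cov] := p_cover.
have [U [VV [Uo U1 pU _ VVP]]] := cov 1%g.
have [V VVV V1] : (\bigcup_(V in VV) V) 1%g by rewrite -pU /= cover1.
have [Vo [_ pinj _] pV] := VVP V VVV.
have nV : nbhs (1%g : E) V by apply: open_nbhs_nbhs.
(* A product of four elements of [W] stays in the sheet [V], where [p] is injective; this identifies
   [y] with the product of the lifts. *)
have [W1 nW1 W1V] := nbhs_mulg2 nV; have [W nW WW1] := nbhs_mulg2 nW1.
have two0 : (2 : R) != 0 by rewrite pnatr_eq0.
have [du du0 uP] : exists2 delta : R, 0 < delta &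
    forall s, `|s| < delta -> exists w, [/\ W w, D w & p w = upper s].
  apply: cover_unipotent_lift (upper_commg two0) nW; last exact: upper0.
  move=> s i j; case: (ord2E i) => ->; case: (ord2E j) => ->;
    by rewrite !sl2E ?subrr ?normr0 ?subr0.
have [dl dl0 lP] : exists2 delta : R, 0 < delta &
    forall s, `|s| < delta -> exists w, [/\ W w, D w & p w = lower s].
  apply: cover_unipotent_lift (lower_commg two0) nW; last exact: lower0.
  move=> s i j; case: (ord2E i) => ->; case: (ord2E j) => ->;
    by rewrite !sl2E ?subrr ?normr0 ?subr0.
have d0 : 0 < Num.min du dl by rewrite lt_min du0.
have [eta eta0 etaP] := SL2_near1_unipotent d0.
have nO : nbhs (1%g : E) (p @^-1` [set x | forall i j, `|x i j - (1%g : SL2 R) i j| < eta]).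
  by apply: pc; rewrite cover1; apply: nbhs_SL2_1.
apply: filterS2 nO nV => y /= /etaP[s1 [s2 [s3 [s4 [+ + + +]]]]] py Vy.
rewrite !lt_min => /andP[_ /lP[w1 [W1w D1 p1]]] /andP[/uP[w2 [W2 D2 p2]] _].
move=> /andP[_ /lP[w3 [W3 D3 p3]]] /andP[/uP[w4 [W4 D4 p4]] _].
have -> : y = ((w1 * w2) * (w3 * w4))%g.
  apply: pinj; rewrite ?inE //; first by apply: W1V; apply: WW1.
  by rewrite py !pM p1 p2 p3 p4 !mulgA.
by apply: (DM); apply: DM.
Qed.

(** A subgroup containing a neighbourhood of 1 is open and closed, so it contains every path
    starting at 1. *)
Lemma cover_perfect : (forall x y : E, exists f : R -> E, path_in f x y) ->
  forall x, D x.
Proof.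
move=> pathE; have nD := cover_perfect_nbhs.
have D1 : D 1%g by exact: nbhs_singleton.
have near_coset x : nbhs x [set y | D (x^-1 * y)%g].
  by apply: nbhs_mulgl; rewrite mulVg.
have Do : open D.
  rewrite openE => x Dx; apply: filterS (near_coset x) => y /= Dxy.
  by rewrite -(mulVKg x y); apply: DM.
have Dc : open (~` D).
  rewrite openE => x nDx; apply: filterS (near_coset x) => y /= Dxy Dy.
  apply: nDx; have := DM Dy (DV Dxy); by rewrite invgM invgK mulVKg.
move=> x; have [f [fc f0 f1]] := pathE 1%g x.
have If : connected (f @` `[0, 1]).
  by apply: connected_continuous_connected fc; apply: segment_connected.
have i0 : `[0, 1]%classic (0 : R) by rewrite /= in_itv /= lexx ler01.
have i1 : `[0, 1]%classic (1 : R) by rewrite /= in_itv /= lexx ler01.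
have : f @` `[0, 1] `&` D = f @` `[0, 1].
  apply: If.
  - by exists 1%g; split=> //; rewrite -f0; exists 0.
  - by exists D.
  - by exists D => //; rewrite -(setCK D); apply: open_closedC.
move=> E1; have : (f @` `[0, 1]) x by rewrite -f1; exists 1.
by rewrite -E1 => -[].
Qed.

End Perfect.
End CoveringGroup.

(** * Central extensions *)

Section CentralExtension.
Variables (V : zmodType) (H : groupType) (c : H -> H -> V).
Hypothesis c_cocycle : cocycle2 c.

Local Notation op := (cext_op c).

(** The cocycle is not assumed normalized, so the identity has first coordinate - c(1, 1) and not
    0. *)
Definition cext_one : V * H := (- c 1%g 1%g, 1%g).

Definition cext_inv (u : V * H) : V * H :=
  (- u.1 - c u.2 u.2^-1%g - c 1%g 1%g, u.2^-1%g).

Lemma cocycle_1r x : c x 1%g = c 1%g 1%g.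
Proof. by have := c_cocycle x 1%g 1%g; rewrite !mulg1 => /addrI. Qed.

Lemma cocycle_1l x : c 1%g x = c 1%g 1%g.
Proof. by have := c_cocycle 1%g 1%g x; rewrite !mul1g => /addIr. Qed.

Lemma cocycleV x : c x x^-1%g = c x^-1%g x.
Proof.
have := c_cocycle x x^-1%g x; rewrite mulgV mulVg cocycle_1r cocycle_1l.
by rewrite [RHS]addrC => /addIr.
Qed.

Lemma cext_opA : associative op.
Proof.
move=> [t x] [s y] [r z]; rewrite /cext_op /= mulgA; congr pair.
rewrite !addrA (addrAC (t + s) (c x y)) -!(addrA (t + s + r)) [X in _ + X = _]addrC.
by rewrite c_cocycle.
Qed.

Lemma cext_op1l : left_id cext_one op.
Proof. by move=> [t x]; rewrite /cext_op /= mul1g cocycle_1l addrAC addNr add0r. Qed.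

Lemma cext_op1r : right_id cext_one op.
Proof. by move=> [t x]; rewrite /cext_op /= mulg1 cocycle_1r addrNK. Qed.

Lemma cext_mulV u : op u (cext_inv u) = cext_one.
Proof.
case: u => t x; rewrite /cext_op /cext_inv /cext_one /= mulgV; congr pair.
by rewrite -!addrA addNKr addrCA addNr addr0.
Qed.

Lemma cext_mulVl u : op (cext_inv u) u = cext_one.
Proof.
case: u => t x; rewrite /cext_op /cext_inv /cext_one /= mulVg; congr pair.
by rewrite -cocycleV -!addrA [t + _]addrC (addrCA (- c 1%g 1%g)) addKr addrCA addNr addr0.
Qed.

Lemma cext_group : is_group op.
Proof.
split; first exact: cext_opA.
exists cext_one; split=> //; [exact: cext_op1l | exact: cext_op1r |].
by move=> u _; exists (cext_inv u); rewrite cext_mulV cext_mulVl.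
Qed.

Lemma cext_op_injl u v w : op u v = op u w -> v = w.
Proof.
case: u v w => [t x] [s y] [r z] [+ /mulgI yz]; rewrite yz.
by move=> /addIr/addrI ->.
Qed.

Lemma cext_op_shift s t x y u : op (s + t, x) (u, y) = (s + (op (t, x) (u, y)).1, (x * y)%g).
Proof. by rewrite /cext_op /= !addrA. Qed.

Lemma subgroup_cext_one M : is_subgroup op M -> M cext_one.
Proof.
move=> [e [el er Me _ _]]; suff -> : cext_one = e by [].
by rewrite -(cext_op1r e) el.
Qed.

Section Subgroup.
Variable M : set (V * H).
Hypothesis M_sub : is_subgroup op M.

Lemma subgroup_op u v : M u -> M v -> M (op u v).
Proof. by case: M_sub => e [_ _ _ + _]; apply. Qed.

Lemma subgroup_divl u v : M u -> M (op u v) -> M v.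
Proof.
move=> Mu Muv; case: (M_sub) => e [el er Me MM MV].
have [u' [Mu' _ u'u]] := MV u Mu.
have -> : v = op u' (op u v) by rewrite cext_opA u'u el.
exact: MM.
Qed.

Lemma subgroup_inv u : M u -> M (cext_inv u).
Proof.
move=> Mu; apply: (subgroup_divl Mu); rewrite cext_mulV.
exact: subgroup_cext_one.
Qed.

(* Since V is central, commutators only depend on the projections to H; w is the
   commutator of u and v up to order and inverses. *)
Lemma subgroup_commutator : (forall x, exists t, M (t, x)) ->
  forall u v w, op (op v u) w = op u v -> M w.
Proof.
move=> Msurj [s x] [s' y] w E.
have [t Mt] := Msurj x; have [t' Mt'] := Msurj y.
pose d := (s - t) + (s' - t').
have vu : op (s', y) (s, x) = (d + (op (t', y) (t, x)).1, (y * x)%g).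
  rewrite /d /cext_op /= !addrA; congr (_ + _, _).
  by rewrite subrK (addrAC _ s') subrK addrC.
have uv : op (s, x) (s', y) = (d + (op (t, x) (t', y)).1, (x * y)%g).
  rewrite /d /cext_op /= !addrA; congr (_ + _, _).
  by rewrite (addrAC _ t) subrK (addrAC _ s') subrK.
apply: (@subgroup_divl (op (t', y) (t, x))); first exact: subgroup_op.
suff -> : op (op (t', y) (t, x)) w = op (t, x) (t', y) by apply: subgroup_op.
move: E; rewrite vu uv; case: w => r z; rewrite cext_op_shift /= => -[/addrI E1 E2].
by rewrite /cext_op /= in E1 *; rewrite E1 E2.
Qed.

End Subgroup.
End CentralExtension.

(** * Transfer of the cocycle *)

Section Transfer.
Variables (R K : rcfType) (iota : {rmorphism R -> K}).

(** The universal closure over the first [n] variables is a sentence, which passes to [K] by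
    elementarity. Environments are read as 0 beyond their size. *)
Lemma transfer_valid n (f : GRing.formula R) :
  (forall e : seq R, size e = n -> GRing.holds e f) ->
  forall e : seq K, size e = n -> GRing.holds e (map_formula iota f).
Proof.
move=> fR e en; pose I := seq.iota 0 n.
have fclosed : GRing.holds [::] (foldr (@GRing.Forall R) f I).
  apply/GRing.foldForallP => e' e'P.
  apply: GRing.eq_holds (fR (mkseq (nth 0 e') n) (size_mkseq _ _)) => i.
  have [lti|lei] := ltnP i n; first by rewrite nth_mkseq.
  rewrite nth_default ?size_mkseq //; have := e'P i.
  by rewrite inE /= mem_iota add0n -leqNgt nth_nil; apply.
have := iffRL (QE.holds_map_formula iota [::] _) fclosed.
have -> : map_formula iota (foldr (@GRing.Forall R) f I) =
    foldr (@GRing.Forall K) (map_formula iota f) I.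
  by elim: (I) => //= i s ->.
move=> /GRing.foldForallP; apply=> i; rewrite inE /= mem_iota add0n -leqNgt.
by move=> ni; rewrite nth_nil nth_default ?en.
Qed.

(** Used as a guard, it relativizes quantification over four consecutive variables to SL_2. *)
Definition det_formula (F : rcfType) k : GRing.formula F :=
  let X i := GRing.Var F i in
  GRing.Equal (GRing.Add (GRing.Mul (X k) (X k.+3))
    (GRing.Opp (GRing.Mul (X k.+1) (X k.+2)))) (GRing.NatConst F 1).

Lemma coords_det (F : rcfType) (e : seq F) k :
  (k + 4 <= size e)%N -> GRing.holds e (det_formula F k) ->
  exists x : SL2 F, coords x = take 4 (drop k e).
Proof.
move=> ke /= H; exists (sl2 H); rewrite /coords !sl2E.
apply: (@eq_from_nth _ 0) => [|i lti].
  by rewrite size_takel // size_drop leq_subRL // (leq_trans (leq_addr 4 k)).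
rewrite nth_take // nth_drop; case: i lti => [|[|[|[|]]]] //= _;
  by rewrite ?addn0 ?addn1 ?addn2 ?addn3.
Qed.

Definition mul_terms (F : rcfType) a b : seq (GRing.term F) :=
  let X i := GRing.Var F i in
  let entry i j k l := GRing.Add (GRing.Mul (X i) (X j)) (GRing.Mul (X k) (X l)) in
  [:: entry a b a.+1 b.+2; entry a b.+1 a.+1 b.+3;
      entry a.+2 b a.+3 b.+2; entry a.+2 b.+1 a.+3 b.+3].

Lemma coordsM (F : fieldType) (x y : SL2 F) : coords (x * y)%g =
  [:: x 0 0 * y 0 0 + x 0 1 * y 1 0; x 0 0 * y 0 1 + x 0 1 * y 1 1;
      x 1 0 * y 0 0 + x 1 1 * y 1 0; x 1 0 * y 0 1 + x 1 1 * y 1 1].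
Proof. by rewrite /coords !SL2_mulE. Qed.

Lemma coords_map (F L : fieldType) (j : {rmorphism F -> L}) (x : SL2 F) :
  coords (SL2_map j x) = map j (coords x).
Proof. by rewrite /coords /= !mxE. Qed.

Variables (h : SL2 R -> SL2 R -> int) (phi : int -> GRing.formula R).

Local Notation I := (range (fun xy : SL2 R * SL2 R => h xy.1 xy.2)).

Hypothesis h_finite : finite_set I.
Hypothesis h_definable : forall n : int, I n -> forall x y : SL2 R,
  h x y = n <-> GRing.holds (coords x ++ coords y) (phi n).

Local Notation hK := (interp_cocycle iota I phi).

Lemma range_h x y : I (h x y).
Proof. by exists (x, y). Qed.

(** Because the range is finite, totality of h is a finite disjunction of the formulas [phi n] and
    transfers. *)
Lemma interp_exists (x y : SL2 K) : exists n, I n /\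
  GRing.holds (coords x ++ coords y) (map_formula iota (phi n)).
Proof.
have [s sE] := (finite_seqP I).1 h_finite.
pose f := GRing.Implies (GRing.And (det_formula R 0) (det_formula R 4))
  (foldr (fun n g => GRing.Or (phi n) g) (GRing.Bool false) s).
have fR e : size e = 8%N -> GRing.holds e f.
  move=> e8 [/(coords_det (k := 0))[|a aE]]; first by rewrite e8.
  move=> /(coords_det (k := 4))[|b bE]; first by rewrite e8.
  have -> : e = coords a ++ coords b.
    rewrite aE bE drop0 -[in LHS](cat_take_drop 4 e); congr (_ ++ _).
    by rewrite take_oversize // size_drop e8.
  have : h a b \in s by have := range_h a b; rewrite sE.
  elim: s {sE f} => //= n s IH; rewrite inE => /predU1P[hn|/IH]; last by right.
  by left; apply/h_definable; rewrite // -hn; apply: range_h.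
have := transfer_valid fR (e := coords x ++ coords y) erefl; rewrite /f /=.
move=> /(_ (conj (SL2_detE x) (SL2_detE y))).
suff : forall s' : seq int, {subset s' <= s} -> GRing.holds (coords x ++ coords y)
    (map_formula iota (foldr (fun n g => GRing.Or (phi n) g) (GRing.Bool false) s')) ->
    exists n, I n /\ GRing.holds (coords x ++ coords y) (map_formula iota (phi n)).
  by apply.
elim=> //= n s' IH s's [fn|].
  have : [set` s] n by apply: s's; rewrite mem_head.
  by rewrite -sE => In; exists n.
by apply: IH => m ms; apply: s's; rewrite inE ms orbT.
Qed.

Lemma interp_uniq (x y : SL2 K) n m : I n -> I m ->
  GRing.holds (coords x ++ coords y) (map_formula iota (phi n)) ->
  GRing.holds (coords x ++ coords y) (map_formula iota (phi m)) -> n = m.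
Proof.
move=> In Im fn fm; apply/eqP/negPn/negP => nm.
pose f := GRing.Implies (GRing.And (det_formula R 0) (det_formula R 4))
  (GRing.Not (GRing.And (phi n) (phi m))).
have fR e : size e = 8%N -> GRing.holds e f.
  move=> e8 [/(coords_det (k := 0))[|a aE]]; first by rewrite e8.
  move=> /(coords_det (k := 4))[|b bE]; first by rewrite e8.
  have -> : e = coords a ++ coords b.
    rewrite aE bE drop0 -[in LHS](cat_take_drop 4 e); congr (_ ++ _).
    by rewrite take_oversize // size_drop e8.
  by move=> [/h_definable-/(_ In) + /h_definable-/(_ Im)] => -> E; rewrite E eqxx in nm.
have := transfer_valid fR (e := coords x ++ coords y) erefl; rewrite /f /=.
by move=> /(_ (conj (SL2_detE x) (SL2_detE y))) []; split.
Qed.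

Lemma interpP (x y : SL2 K) : I (hK x y) /\
  GRing.holds (coords x ++ coords y) (map_formula iota (phi (hK x y))).
Proof. exact: (xgetPex 0 (interp_exists x y)). Qed.

Lemma interp_map (x y : SL2 R) : hK (SL2_map iota x) (SL2_map iota y) = h x y.
Proof.
have [In fn] := interpP (SL2_map iota x) (SL2_map iota y).
apply: interp_uniq In (range_h x y) fn _.
rewrite !coords_map -map_cat; apply/QE.holds_map_formula.
by apply/h_definable => //; exact: range_h.
Qed.

Hypothesis h_cocycle : cocycle2 h.

(** The four values over [K] are integers in the range of h. Once they are fixed, that no matrices
    over [R] take values violating the identity is a sentence. *)
Lemma interp_cocycle2 : cocycle2 hK.
Proof.
move=> x y z; have [I1 f1] := interpP x y; have [I2 f2] := interpP (x * y)%g z.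
have [I3 f3] := interpP x (y * z)%g; have [I4 f4] := interpP y z.
move: (hK x y) (hK (x * y)%g z) (hK x (y * z)%g) (hK y z) I1 I2 I3 I4 f1 f2 f3 f4.
move=> n1 n2 n3 n4 I1 I2 I3 I4 f1 f2 f3 f4; apply/eqP/negPn/negP => nE.
pose t1 (F : rcfType) := var_block F 0 8.
pose t2 (F : rcfType) := mul_terms F 0 4 ++ var_block F 8 4.
pose t3 (F : rcfType) := var_block F 0 4 ++ mul_terms F 4 8.
pose t4 (F : rcfType) := var_block F 4 8.
have tE (F : rcfType) (a b d : SL2 F) : let e := coords a ++ coords b ++ coords d in
  [/\ map (GRing.eval e) (t1 F) = coords a ++ coords b,
      map (GRing.eval e) (t2 F) = coords (a * b)%g ++ coords d,
      map (GRing.eval e) (t3 F) = coords a ++ coords (b * d)%g &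
      map (GRing.eval e) (t4 F) = coords b ++ coords d].
  by rewrite !coordsM.
pose f := GRing.Implies
  (GRing.And (GRing.And (det_formula R 0) (det_formula R 4)) (det_formula R 8))
  (GRing.Not (GRing.And (GRing.And (fsubsts (t1 R) (phi n1)) (fsubsts (t2 R) (phi n2)))
     (GRing.And (fsubsts (t3 R) (phi n3)) (fsubsts (t4 R) (phi n4))))).
have fR e : size e = 12%N -> GRing.holds e f.
  move=> e12 [[/(coords_det (k := 0))[|a aE]]]; first by rewrite e12.
  move=> /(coords_det (k := 4))[|b bE]; first by rewrite e12.
  move=> /(coords_det (k := 8))[|d dE]; first by rewrite e12.
  have -> : e = coords a ++ coords b ++ coords d.
    rewrite aE bE dE drop0 -[in LHS](cat_take_drop 4 e); congr (_ ++ _).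
    rewrite -[in LHS](cat_take_drop 4 (drop 4 e)) drop_drop; congr (_ ++ _).
    by rewrite take_oversize // size_drop e12.
  have [E1 E2 E3 E4] := tE R a b d.
  move=> [[/holds_fsubsts + /holds_fsubsts +] [/holds_fsubsts + /holds_fsubsts]].
  rewrite E1 E2 E3 E4 => /h_definable-/(_ I1) h1 /h_definable-/(_ I2) h2.
  move=> /h_definable-/(_ I3) h3 /h_definable-/(_ I4) h4.
  by move: nE; rewrite -h1 -h2 -h3 -h4 h_cocycle eqxx.
have := transfer_valid fR (e := coords x ++ coords y ++ coords z) erefl.
rewrite /f /= !map_fsubsts.
move=> /(_ (conj (conj (SL2_detE x) (SL2_detE y)) (SL2_detE z))); apply.
have [E1 E2 E3 E4] := tE K x y z.
have mt : [/\ map (map_term iota) (t1 R) = t1 K, map (map_term iota) (t2 R) = t2 K,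
  map (map_term iota) (t3 R) = t3 K & map (map_term iota) (t4 R) = t4 K] by [].
have [-> -> -> ->] := mt.
by do !split; apply/holds_fsubsts; rewrite ?E1 ?E2 ?E3 ?E4.
Qed.

End Transfer.

(** * Standard parts and density *)

Lemma rcf_morph_norm (F L : rcfType) (j : {rmorphism F -> L}) r : j `|r| = `|j r|.
Proof.
have [r0|r0] := leP 0 r.
  by rewrite !ger0_norm // -(rmorph0 j) QE.ler_rcf_morph.
by rewrite !ltr0_norm ?rmorphN // -(rmorph0 j) QE.ltr_rcf_morph.
Qed.

Section Infinitesimals.
Variable K : rcfType.
Implicit Types x y : K.

Lemma infinitesimal0 : infinitesimal (0 : K).
Proof. by move=> n; rewrite normr0 invr_gt0 ltr0Sn. Qed.

Lemma invS_double n : (2 * n.+1).-1.+1%:R^-1 + (2 * n.+1).-1.+1%:R^-1 = n.+1%:R^-1 :> K.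
Proof.
rewrite (_ : (2 * n.+1).-1.+1 = (2 * n.+1)%N) // natrM invfM.
by move: (n.+1%:R^-1) => x; field.
Qed.

Lemma infinitesimalD x y : infinitesimal x -> infinitesimal y -> infinitesimal (x + y).
Proof.
move=> xi yi n; rewrite -invS_double (le_lt_trans (ler_normD _ _)) //.
exact: ltrD.
Qed.

Lemma infinitesimalN x : infinitesimal x -> infinitesimal (- x).
Proof. by move=> xi n; rewrite normrN. Qed.

Lemma infinitesimalB x y : infinitesimal x -> infinitesimal y -> infinitesimal (x - y).
Proof. by move=> xi /infinitesimalN; apply: infinitesimalD. Qed.

Lemma infinitesimal_le x y : infinitesimal x -> `|y| <= `|x| -> infinitesimal y.
Proof. by move=> xi yx n; apply: le_lt_trans yx _. Qed.

Lemma infinitesimalM x y : infinitesimal x -> `|y| <= 1 -> infinitesimal (x * y).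
Proof.
move=> xi y1; apply: infinitesimal_le xi _.
by rewrite normrM ler_piMr.
Qed.
Lemma infinitesimal_morph (L : rcfType) (j : {rmorphism K -> L}) x :
  infinitesimal x -> infinitesimal (j x).
Proof.
move=> xi n; rewrite -rcf_morph_norm -(rmorph_nat j) -fmorphV.
by rewrite QE.ltr_rcf_morph.
Qed.

End Infinitesimals.

Section StandardPart.
Variables (R : realType) (K : rcfType) (iota : {rmorphism R -> K}).

Lemma infinitesimal_iota (r : R) : infinitesimal (iota r) -> r = 0.
Proof.
move=> ri; apply/eqP; rewrite -normr_eq0; apply: contraT => r0.
have /ltr_add_invr[k] : 0 < `|r| by rewrite lt0r r0 normr_ge0.
rewrite add0r -(QE.ltr_rcf_morph iota) fmorphV rmorph_nat.
by rewrite rcf_morph_norm => /(lt_trans (ri k)); rewrite ltxx.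
Qed.

Lemma SO2_entry_le1 (F : realFieldType) (t : SO2 F) : `|t 0 0| <= 1 /\ `|t 1 0| <= 1.
Proof.
have n := SO2_norm t; split; rewrite -(@expr_le1 _ 2) // real_normK ?num_real // -n.
  by rewrite lerDl sqr_ge0.
by rewrite lerDr sqr_ge0.
Qed.

Lemma standard_partE (t : SO2 K) (r : SO2 R) : standard_part iota t r <->
  infinitesimal (t 0 0 - iota (r 0 0)) /\ infinitesimal (t 1 0 - iota (r 1 0)).
Proof.
split=> [tr|[t0 t1] i j n]; first by split=> n; apply: tr.
have [t11 t10] := SO2_entries t; have [r11 r10] := SO2_entries r.
case: (ord2E i) => ->; case: (ord2E j) => ->; rewrite ?t11 ?r11 //.
have -> : t 0 1 = - t 1 0 by rewrite t10 opprK.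
have -> : r 0 1 = - r 1 0 by rewrite r10 opprK.
by rewrite rmorphN -opprD normrN.
Qed.

Lemma standard_part_iota (r : SO2 R) : standard_part iota (SO2_map iota r) r.
Proof. by apply/standard_partE; rewrite !SO2_mapE !subrr; split;
  apply: infinitesimal0. Qed.

Lemma standard_partD t s r q : standard_part iota t r -> standard_part iota s q ->
  standard_part iota (t + s) (r + q).
Proof.
move=> /standard_partE[t0 t1] /standard_partE[s0 s1]; apply/standard_partE.
have [b1 b2] := SO2_entry_le1 s; have [d1 d2] := SO2_entry_le1 (SO2_map iota r).
rewrite !SO2_mapE in d1 d2.
rewrite !SO2_addE !(rmorphB, rmorphD, rmorphM); split.
  have -> : t 0 0 * s 0 0 - t 1 0 * s 1 0 -
      (iota (r 0 0) * iota (q 0 0) - iota (r 1 0) * iota (q 1 0)) =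
      ((t 0 0 - iota (r 0 0)) * s 0 0 + (s 0 0 - iota (q 0 0)) * iota (r 0 0)) -
      ((t 1 0 - iota (r 1 0)) * s 1 0 + (s 1 0 - iota (q 1 0)) * iota (r 1 0)) by ring.
  by apply: infinitesimalB; apply: infinitesimalD; apply: infinitesimalM.
have -> : t 1 0 * s 0 0 + t 0 0 * s 1 0 -
    (iota (r 1 0) * iota (q 0 0) + iota (r 0 0) * iota (q 1 0)) =
    ((t 1 0 - iota (r 1 0)) * s 0 0 + (s 0 0 - iota (q 0 0)) * iota (r 1 0)) +
    ((t 0 0 - iota (r 0 0)) * s 1 0 + (s 1 0 - iota (q 1 0)) * iota (r 0 0)) by ring.
by apply: infinitesimalD; apply: infinitesimalD; apply: infinitesimalM.
Qed.

Lemma standard_partN t r : standard_part iota t r -> standard_part iota (- t) (- r).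
Proof.
move=> /standard_partE[t0 t1]; apply/standard_partE; rewrite !SO2_oppE; split=> //.
by rewrite rmorphN -opprD; apply: infinitesimalN.
Qed.

Lemma standard_partB t s r q : standard_part iota t r -> standard_part iota s q ->
  standard_part iota (t - s) (r - q).
Proof. by move=> tr /standard_partN; apply: standard_partD. Qed.

Lemma standard_part_uniq t r q : standard_part iota t r -> standard_part iota t q -> r = q.
Proof.
move=> /standard_partE[r0 r1] /standard_partE[q0 q1].
have diff (x y z : K) : y - z = (x - z) - (x - y) by ring.
apply: SO2_eqP; apply/eqP; rewrite -subr_eq0; apply/eqP/infinitesimal_iota;
  rewrite rmorphB.
  by rewrite (diff (t 0 0)); apply: infinitesimalB.
by rewrite (diff (t 1 0)); apply: infinitesimalB.
Qed.

(** Completeness of [R]: the standard part is the supremum of the reals whose image is at most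
    [a]. *)
Lemma standard_part_scalar (a : K) : `|a| <= 1 -> exists r : R, infinitesimal (a - iota r).
Proof.
rewrite ler_norml => /andP[a1 a2]; pose S := [set q : R | iota q <= a].
have S1 : S (-1) by rewrite /S /= rmorphN1.
have Sub : ubound S 1.
  by move=> q /= qa; rewrite -(QE.ler_rcf_morph iota) rmorph1 (le_trans qa).
have Ssup : has_sup S by split; [exists (-1) | exists 1].
exists (sup S) => n.
have lo : iota (sup S) - n.+1%:R^-1 < a.
  have [|q Sq qs] := @sup_adherent R S n.+1%:R^-1 _ Ssup;
    first by rewrite invr_gt0 ltr0Sn.
  rewrite -(QE.ltr_rcf_morph iota) rmorphB fmorphV rmorph_nat in qs.
  exact: lt_le_trans qs Sq.
have hi : a < iota (sup S) + n.+2%:R^-1.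
  rewrite ltNge; apply/negP => h; have : S (sup S + n.+2%:R^-1).
    by rewrite /S /= rmorphD fmorphV rmorph_nat.
  by move/(ub_le_sup Ssup.2); rewrite gerDl leNgt invr_gt0 ltr0Sn.
have n12 : n.+2%:R^-1 < n.+1%:R^-1 :> K by rewrite ltf_pV2 ?posrE ?ltr0Sn // ltr_nat.
rewrite ltr_norml; move: lo hi n12.
move: (iota _) (n.+1%:R^-1) (n.+2%:R^-1) => b c d lo hi n12; apply/andP; split; lra.
Qed.

Lemma standard_part_exists t : exists r, standard_part iota t r.
Proof.
have [t0 t1] := SO2_entry_le1 t.
have [a ai] := standard_part_scalar t0; have [b bi] := standard_part_scalar t1.
have norm1 (r : R) (x : K) : `|x| <= 1 -> infinitesimal (x - iota r) -> `|r| <= 1.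
  move=> x1 xr; rewrite leNgt; apply/negP => /ltr_add_invr[k kr].
  have := xr k; have : `|iota r| <= `|x| + `|x - iota r|.
    by rewrite -[X in `|X| <= _](subKr x) (le_trans (ler_normB _ _)).
  rewrite -rcf_morph_norm.
  move: kr; rewrite -(QE.ltr_rcf_morph iota) rmorphD rmorph1 fmorphV rmorph_nat.
  by move: (iota _) (k.+1%:R^-1) (`|x - _|) (`|x|) x1 => ? ? ? ? *; lra.
have a1 := norm1 _ _ t0 ai; have b1 := norm1 _ _ t1 bi.
(* The equation holds up to an infinitesimal, and a real number with infinitesimal image is 0. *)
have ab : a ^+ 2 + b ^+ 2 = 1.
  apply/eqP; rewrite -subr_eq0; apply/eqP/infinitesimal_iota.
  rewrite !(rmorphB, rmorphD, rmorphXn, rmorph1).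
  have ia1 : `|iota a| <= 1.
    by rewrite -rcf_morph_norm -(rmorph1 iota) QE.ler_rcf_morph.
  have ib1 : `|iota b| <= 1.
    by rewrite -rcf_morph_norm -(rmorph1 iota) QE.ler_rcf_morph.
  have -> : iota a ^+ 2 + iota b ^+ 2 - 1 =
      - (((t 0 0 - iota a) * iota a + (t 0 0 - iota a) * t 0 0) +
         ((t 1 0 - iota b) * iota b + (t 1 0 - iota b) * t 1 0)).
    by rewrite -[in LHS](SO2_norm t); ring.
  by apply/infinitesimalN/infinitesimalD; apply: infinitesimalD; apply: infinitesimalM.
by exists (rotation ab); apply/standard_partE; rewrite rotation00 rotation10.
Qed.

Lemma standard_part0_rot t : standard_part iota t 0 -> exists2 x, infinitesimal x & t = rot x.
Proof.
move=> /standard_partE; rewrite !SO2_0E rmorph1 rmorph0 subr0 => -[t0 t1].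
have t00 : 0 < t 0 0.
  by have := t0 0%N; rewrite invr1 ltr_norml => /andP[h _]; lra.
exists (t 1 0 / (1 + t 0 0)); last by rewrite -rotE // gt_eqF // (lt_trans _ t00) // oppr_lt0.
apply: infinitesimalM => //; rewrite ger0_norm ?invr_ge0; last by lra.
by rewrite invf_le1; lra.
Qed.

Lemma standard_part_rot x : infinitesimal x -> standard_part iota (rot x) 0.
Proof.
move=> xi; apply/standard_partE; rewrite !SO2_0E rmorph1 rmorph0 subr0 rotation00 rotation10.
have x1 : `|x| < 1 by have := xi 0%N; rewrite invr1.
have d0 := addr1_sqr_neq0 x; have d1 := addr1_sqr_gt0 x.
have dle : `|(1 + x ^+ 2)^-1| <= 1.
  by rewrite gtr0_norm ?invr_gt0 // invf_le1 // lerDl sqr_ge0.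
split.
  have -> : (1 - x ^+ 2) / (1 + x ^+ 2) - 1 =
    - (x * x * (1 + x ^+ 2)^-1 + x * x * (1 + x ^+ 2)^-1) by field.
  by apply/infinitesimalN/infinitesimalD; do !apply: infinitesimalM => //; apply: ltW.
have -> : 2 * x / (1 + x ^+ 2) = x * (1 + x ^+ 2)^-1 + x * (1 + x ^+ 2)^-1 by field.
by apply: infinitesimalD; apply: infinitesimalM.
Qed.

End StandardPart.

(** * Density of an infinite cyclic subgroup of the circle *)

Section CircleDensity.
Variable R : realType.

Definition angle (x : R) : SO2 R := rotation (cos2Dsin2 x).

Lemma angleE x : (angle x 0 0 = cos x) * (angle x 1 0 = sin x).
Proof. by rewrite rotation00 rotation10. Qed.

Lemma angleD : {morph angle : x y / x + y}.
Proof.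
move=> x y; apply: SO2_eqP; rewrite SO2_addE !rotation00 !rotation10.
  by rewrite cosD.
by rewrite sinD.
Qed.

Lemma angle0 : angle 0 = 0.
Proof. by apply: SO2_eqP; rewrite SO2_0E ?rotation00 ?rotation10 ?cos0 ?sin0. Qed.

Lemma angleN : {morph angle : x / - x}.
Proof.
move=> x; apply: SO2_eqP; rewrite SO2_oppE !(rotation00, rotation10).
  by rewrite cosN.
by rewrite sinN.
Qed.

Lemma angleMz x (z : int) : angle (x *~ z) = angle x *~ z.
Proof.
have an n : angle (x *+ n) = angle x *+ n.
  by elim: n => [|n IH]; rewrite ?mulr0n ?angle0 // !mulrS angleD IH.
by case: z => n; rewrite ?NegzE ?mulrNz ?angleN -!pmulrn an.
Qed.

Lemma angle_2pi : angle (pi *+ 2) = 0.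
Proof. by apply: SO2_eqP; rewrite SO2_0E ?rotation00 ?rotation10 ?cos2pi ?sin2pi. Qed.

Lemma angle_surj (r : SO2 R) : exists x, r = angle x.
Proof.
have [r0 r1] := SO2_entry_le1 r; rewrite ler_norml in r0.
have n := SO2_norm r; have c := acosK; pose x := acos (r 0 0).
have cx : cos x = r 0 0 by rewrite c // in_itv.
have : (sin x) ^+ 2 = (r 1 0) ^+ 2.
  by have := cos2Dsin2 x; rewrite cx -n => /addrI.
move/eqP; rewrite eqf_sqr => /orP[/eqP sx|/eqP sx].
  by exists x; apply: SO2_eqP; rewrite ?rotation00 ?rotation10.
by exists (- x); apply: SO2_eqP; rewrite ?rotation00 ?rotation10 ?cosN ?sinN ?cx ?sx ?opprK.
Qed.

Variable g : SO2 R.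
Hypothesis g_order : forall n : nat, (0 < n)%N -> g *+ n <> 0.

(* Dirichlet's box principle for the multiples of an angle of g. *)
Lemma small_multiple (N : nat) : exists (z : int) (d : R),
  [/\ angle d = g *~ z, d != 0 & `|d| < (pi *+ 2) / N.+1%:R].
Proof.
have [x gx] := angle_surj g; pose p : R := pi *+ 2.
have p0 : 0 < p by rewrite mulrn_wgt0 // pi_gt0.
have pn0 : p != 0 by rewrite gt_eqF.
(* The fractional part of k x / (2 pi); [b k] is the number of the box containing it when [0, 1) is
   cut into N + 1 boxes. Of N + 2 indices, two share a box. *)
pose u (k : nat) : R := x *+ k / p - (Num.floor (x *+ k / p))%:~R.
have u01 k : 0 <= u k < 1.
  have /andP[lo hi] := floor_itv (x *+ k / p); rewrite /u subr_ge0 lo /=.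
  by rewrite ltrBlDl -[X in _ < X](_ : (Num.floor (x *+ k / p) + 1)%:~R = _) // intrD.
pose b (k : nat) := Num.truncn (N.+1%:R * u k).
have b_itv k : (b k)%:R <= N.+1%:R * u k < (b k).+1%:R.
  by apply: truncn_itv; rewrite mulr_ge0 //; case/andP: (u01 k).
have bN k : (b k < N.+1)%N.
  rewrite -(ltr_nat R); have /andP[lo _] := b_itv k; apply: le_lt_trans lo _.
  by rewrite gtr_pMr ?ltr0Sn //; case/andP: (u01 k).
pose f (k : 'I_N.+2) : 'I_N.+1 := Ordinal (bN k).
have : ~~ injectiveb f.
  apply/negP => /injectiveP/leq_card; by rewrite !card_ord ltnn.
move=> /injectivePn[i [j ij fij]].
wlog ltij : i j ij fij / (i < j)%N.
  move=> H; have := ij; rewrite neq_ltn => /orP[lt|lt]; first exact: (H i j).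
  by apply: (H j i) => //; rewrite eq_sym.
have bij : b i = b j by have := congr1 val fij.
pose m := Num.floor (x *+ j / p) - Num.floor (x *+ i / p).
pose d := p * (u j - u i).
have dE : d = x *+ (j - i) - p *~ m.
  rewrite (mulrnBr _ (ltnW ltij)) -mulrzr /d /u /m.
  rewrite mulrzBr; move: (p) pn0 => q qn0.
  move: ((Num.floor (x *+ j / q))%:~R : R) ((Num.floor (x *+ i / q))%:~R : R).
  by move: (x *+ j) (x *+ i) => y z a c; field.
have gd : angle d = g *+ (j - i).
  rewrite dE angleD angleN angleMz angle_2pi mul0rz subr0 gx.
  by rewrite [x *+ _]pmulrn angleMz -pmulrn.
exists (j - i)%N, d; split.
- by rewrite gd pmulrn.
- apply/eqP => d0; apply: (g_order (n := (j - i)%N)); first by rewrite subn_gt0.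
  by rewrite -gd d0 angle0.
- rewrite /d normrM (gtr0_norm p0) ltr_pM2l // -[ltRHS]mul1r ltr_pdivlMr ?ltr0Sn //.
  rewrite -[X in _ * X]ger0_norm // -normrM mulrC mulrBr.
  have /andP[i1 i2] := b_itv i; have /andP[j1 j2] := b_itv j.
  rewrite -natr1 in i2 j2; rewrite bij in i1 i2.
  by rewrite ltr_norml; apply/andP; split; lra.
Qed.

Lemma cyclic_approx (r : SO2 R) (eps : R) : 0 < eps -> exists z : int,
  `|(g *~ z) 0 0 - r 0 0| < eps /\ `|(g *~ z) 1 0 - r 1 0| < eps.
Proof.
move=> e0; have [x ->] := angle_surj r.
have near_x : \forall y \near x, `|cos x - cos y| < eps /\ `|sin x - sin y| < eps.
  have hc := @continuous_cos R x; have hs := @continuous_sin R x.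
  have nc : \forall y \near x, `|cos x - cos y| < eps by move/cvgrPdist_lt: hc; apply.
  have ns : \forall y \near x, `|sin x - sin y| < eps by move/cvgrPdist_lt: hs; apply.
  by near=> y; split; near: y.
have [eta /= eta0 etaP] := near_x.
have p0 : 0 < (pi : R) *+ 2 by rewrite mulrn_wgt0 // pi_gt0.
have [N pN] : exists N, (pi *+ 2) / N.+1%:R < eta.
  have [|k] := @ltr_add_invr R 0 (eta / (pi *+ 2)); first by rewrite divr_gt0.
  by rewrite add0r => H; exists k; rewrite mulrC -ltr_pdivlMr.
have [z [d [gz d0 dN]]] := small_multiple N.
(* The multiple m d differs from [x] by at most |d|. *)
pose m := Num.floor (x / d).
have close : `|x - d *~ m| < eta.
  have -> : x - d *~ m = d * (x / d - m%:~R) by rewrite -mulrzr; field.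
  rewrite normrM (le_lt_trans _ pN) // (le_trans _ (ltW dN)) // ler_piMr //.
  have /andP[lo hi] := floor_itv (x / d).
  rewrite ger0_norm ?subr_ge0 // lerBlDl ltW //.
  by rewrite -[X in _ < X](_ : (m + 1)%:~R = _) // intrD.
exists (z * m); rewrite mulrzA -gz -angleMz.
have [cz sz] := etaP _ close; rewrite distrC in cz; rewrite distrC in sz.
by rewrite !angleE.
Unshelve. all: by end_near.
Qed.

Lemma cyclic_dense : dense (cyclic_subgroup g).
Proof.
move=> U [r Ur] [B Bo UB]; rewrite -UB in Ur *.
have /nbhs_ballP[e e0 eB] : nbhs (SO2val r) B by apply: open_nbhs_nbhs.
have [z [z0 z1]] := cyclic_approx r e0.
exists (g *~ z); split; last by exists z.
apply: eB; split=> // i j; rewrite /ball /=.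
have [r11 r10] := SO2_entries r; have [z11 z10] := SO2_entries (g *~ z).
case: (ord2E i) => ->; case: (ord2E j) => ->; rewrite ?r11 ?z11 distrC //.
have -> : r 0 1 = - r 1 0 by rewrite r10 opprK.
have -> : (g *~ z) 0 1 = - (g *~ z) 1 0 by rewrite z10 opprK.
by rewrite -opprD normrN.
Qed.

End CircleDensity.

(** * The components *)

Section MainSetup.
Variables (R : realType) (h : SL2 R -> SL2 R -> int).
Hypothesis h_cocycle : cocycle2 h.
Hypothesis h_finite : finite_set (range (fun xy : SL2 R * SL2 R => h xy.1 xy.2)).
Variable phi : int -> GRing.formula R.
Hypothesis h_definable : forall n : int,
  range (fun xy : SL2 R * SL2 R => h xy.1 xy.2) n ->
  forall x y : SL2 R, h x y = n <-> GRing.holds (coords x ++ coords y) (phi n).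
Hypothesis h_cover : iso_universal_cover_SL2 (cext_op h) snd.
Variable g : SO2 R.
Hypothesis g_order : forall n : nat, (0 < n)%N -> g *+ n <> 0.
Hypothesis g_alg : forall i j : 'I_2, algebraicOver (ratr : rat -> R) (g i j).
Variable K : rcfType.
Hypothesis K_sat : saturated K.
Hypothesis K_large : small K [set: R].
Variable iota : {rmorphism R -> K}.

Definition ext_cocycle (x y : SL2 K) : SO2 K := SO2_map iota g *~
  interp_cocycle iota (range (fun xy : SL2 R * SL2 R => h xy.1 xy.2)) phi x y.

Local Notation hK := (interp_cocycle iota
  (range (fun xy : SL2 R * SL2 R => h xy.1 xy.2)) phi).
Local Notation gK := (SO2_map iota g).
Local Notation opK := (cext_op ext_cocycle).

Lemma ext_cocycle2 : cocycle2 ext_cocycle.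
Proof.
move=> x y z; rewrite /ext_cocycle -!mulrzDr.
by rewrite (interp_cocycle2 iota h_finite h_definable h_cocycle).
Qed.

(** The homomorphism to G(K) from the universal cover of SL_2(R), presented as Z x SL_2(R). *)
Definition ext_of_cover (u : int * SL2 R) : SO2 K * SL2 K :=
  (gK *~ u.1, SL2_map iota u.2).

Lemma ext_of_coverM : {morph ext_of_cover : u v / cext_op h u v >-> opK u v}.
Proof.
move=> [z x] [z' y]; rewrite /cext_op /ext_of_cover /=; congr pair.
  by rewrite /ext_cocycle (interp_map iota h_finite h_definable) !mulrzDr.
exact: SL2_mapM.
Qed.

(** The subgroup Z g + mu, mu being the kernel of the residue map. *)
Definition residual : set (SO2 K) :=
  [set t | exists z : int, standard_part iota (t - gK *~ z) 0].

Lemma residual_mulz z : residual (gK *~ z).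
Proof.
by exists z; rewrite subrr -(SO2_map0 iota); apply: standard_part_iota.
Qed.

Lemma residual0 : residual 0.
Proof. by rewrite -(mulr0z gK); apply: residual_mulz. Qed.

Lemma residualB s t : residual s -> residual t -> residual (s - t).
Proof.
move=> [z sz] [z' tz']; exists (z - z'); have := standard_partB sz tz'.
by rewrite subrr mulrzBr opprD opprK addrACA opprB [_ + gK *~ z']addrC.
Qed.

Lemma residualN t : residual t -> residual (- t).
Proof. by rewrite -sub0r; apply: residualB residual0. Qed.

Lemma residualD s t : residual s -> residual t -> residual (s + t).
Proof. by move=> sr /residualN tr; rewrite -[t]opprK; apply: residualB. Qed.

(** * What an invariant subgroup of bounded index must contain *)

Section LowerBound.
Variables (M : set (SO2 K * SL2 K)) (A : set K).
Hypotheses (M_sub : is_subgroup opK M) (sA : small K A) (M_inv : Aut_invariant A M)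
  (M_bounded : bounded_index opK M).

Lemma coset_transversal (F : K -> SO2 K * SL2 K) :
  exists S : set K, small K S /\ forall x, exists2 t, S t & exists2 m, M m & F x = opK (F t) m.
Proof.
have [|S [sS SP]] := @small_transversal K _ _ (fun x => lcoset opK M (F x)).
  by apply: small_sub M_bounded => _ [x _ <-]; exists (F x).
exists S; split=> // x; have [t St tx] := SP x; exists t => //.
have : lcoset opK M (F x) (F x).
  case: M_sub => e [_ er Me _ _]; exists e => //; exact: er.
by rewrite -tx => -[m Mm]; exists m.
Qed.

Definition proj : set (SL2 K) := [set x | exists t, M (t, x)].

Lemma projM x y : proj x -> proj y -> proj (x * y)%g.
Proof.
move=> [t Mt] [s Ms]; exists (opK (t, x) (s, y)).1.
exact: (subgroup_op M_sub Mt Ms).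
Qed.

Lemma projV x : proj x -> proj x^-1%g.
Proof. by move=> [t Mt]; eexists; apply: (subgroup_inv ext_cocycle2 M_sub Mt). Qed.

(** The x with [v x] in the projection of M form an invariant subgroup of the additive group of K,
    with few cosets, hence all of K. *)
Lemma proj_unipotent (v : K -> SL2 K) :
  {morph v : x y / x + y >-> (x * y)%g} ->
  (forall (sigma : {rmorphism K -> K}) x, SL2_map sigma (v x) = v (sigma x)) ->
  forall x, proj (v x).
Proof.
move=> vD vmap; have v0 : v 0 = 1%g.
  by apply: (mulgI (v 0)); rewrite -vD addr0 mulg1.
have vN x : v (- x) = (v x)^-1%g.
  by apply: (mulgI (v x)); rewrite -vD subrr mulgV.
have [S [sS SP]] := coset_transversal (fun x => (0, v x)).
apply: (additive_subgroup_full K_sat sA sS).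
- by move=> x y px py; rewrite vD vN; apply: projM => //; apply: projV.
- move=> sigma sb sid x [t Mt]; exists (SO2_map sigma t); rewrite -vmap.
  exact: (M_inv sb sid Mt).
- move=> x; have [t St [[s y] Mm [_ E]]] := SP x; exists t => //.
  by exists s; rewrite addrC vD vN E mulKg.
Qed.

Lemma proj_full x : proj x.
Proof.
apply: SL2_unipotent_gen projM _ _ x; apply: proj_unipotent.
- by move=> x y; rewrite upperD.
- move=> sigma x; apply: SL2_eqP; rewrite /= !mxE //=;
  by rewrite ?rmorph1 ?rmorph0.
- by move=> x y; rewrite lowerD.
- move=> sigma x; apply: SL2_eqP; rewrite /= !mxE //=;
  by rewrite ?rmorph1 ?rmorph0.
Qed.

Lemma commutator_mem u v w : opK (opK v u) w = opK u v -> M w.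
Proof. exact: (subgroup_commutator ext_cocycle2 M_sub proj_full). Qed.

Lemma cover_mem u : M (ext_of_cover u).
Proof.
have [E [p [psi [p_cov pM [pathE _] [[psi' psiK psi'K] psiM psi_p]]]]] := h_cover.
pose J y := ext_of_cover (psi' y).
have JM : {morph J : x y / (x * y)%g >-> opK x y}.
  move=> x y; rewrite /J -ext_of_coverM; congr ext_of_cover.
  by apply: (can_inj psiK); rewrite psiM !psi'K.
have J1 : M (J 1%g).
  have -> : J 1%g = cext_one ext_cocycle.
    apply: (@cext_op_injl _ _ ext_cocycle (J 1%g)).
    by rewrite -JM mulg1 (cext_op1r ext_cocycle2).
  exact: subgroup_cext_one ext_cocycle2 _ M_sub.
rewrite -(psiK u); apply: (cover_perfect p_cov pM (D := [set y | M (J y)])) pathE _.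
- by move=> x y Mx My; rewrite /= JM; apply: (subgroup_op M_sub).
- move=> x Mx /=; apply: (subgroup_divl ext_cocycle2 M_sub Mx).
  by rewrite -JM mulgV.
- move=> x y /=; apply: (@commutator_mem (J x) (J y)).
  by rewrite -!JM -commgC.
Qed.

Lemma mulz_one_mem z : M (gK *~ z, 1%g).
Proof. by have := cover_mem (z, 1%g); rewrite /ext_of_cover /= SL2_map1. Qed.

(** The cocycle takes values in Z g, so the commutator of (0, x) and (0, y) has first coordinate in
    Z g; the integer is solved from the equation in [commutator_mem]. *)
Lemma commutator_SL2_mem (x y : SL2 K) : exists z, M (gK *~ z, [~ x, y]%g).
Proof.
exists (hK x y - hK y x - hK (y * x)%g [~ x, y]%g).
apply: (@commutator_mem (0, x) (0, y)).
rewrite /cext_op /= -commgC !add0r /ext_cocycle -!mulrzDr; congr (_ *~ _, _).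
ring.
Qed.

(** Unipotents over K are commutators, so products of them occur in M with some multiple of g; the
    elements (z g, 1) coming from the cover then adjust the multiple. *)
Lemma mulz_mem x z : M (gK *~ z, x).
Proof.
have two0 : (2 : K) != 0 by rewrite pnatr_eq0.
have [z0 Mz0] : exists z0, M (gK *~ z0, x).
  apply: (@SL2_unipotent_gen _ (fun x => exists z0, M (gK *~ z0, x))).
  - move=> y y' [a Ma] [b Mb]; exists (a + b + hK y y').
    by rewrite !mulrzDr; exact: (subgroup_op M_sub Ma Mb).
  - move=> s; rewrite -[s](divfK (_ : (3 : K) != 0)) ?pnatr_eq0 // mulrC.
    by rewrite -(upper_commg two0); apply: commutator_SL2_mem.
  - move=> s; rewrite -[s](divfK (_ : (3 : K) != 0)) ?pnatr_eq0 // mulrC.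
    by rewrite -(lower_commg two0); apply: commutator_SL2_mem.
have := subgroup_op M_sub (mulz_one_mem (z - z0 - hK 1%g x)) Mz0.
rewrite /cext_op /= mul1g /ext_cocycle -!mulrzDr.
by have -> : z - z0 - hK 1%g x + z0 + hK 1%g x = z by ring.
Qed.

(** Membership in M depends only on the first coordinate modulo Z g. *)
Lemma mem_shift t x z y : M (t, x) -> M (t + gK *~ z, y).
Proof.
move=> Mt; have := subgroup_op M_sub Mt (mulz_mem (x^-1 * y)%g (z - hK x (x^-1 * y)%g)).
rewrite /cext_op /= mulVKg /ext_cocycle -addrA -mulrzDr.
by rewrite subrK.
Qed.

Lemma mem_shift0 t x y : M (t, x) -> M (t, y).
Proof. by move=> /(mem_shift 0 y); rewrite mulr0z addr0. Qed.

Lemma memD s t x y : M (s, x) -> M (t, x) -> M (s + t, y).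
Proof.
move=> Ms /(mem_shift (- hK x x) x) Mt; have := subgroup_op M_sub Ms Mt.
rewrite /cext_op /= !addrA mulrNz subrK; exact: mem_shift0.
Qed.

Lemma memN t x y : M (t, x) -> M (- t, y).
Proof.
move=> Mt; have := subgroup_inv ext_cocycle2 M_sub Mt.
rewrite /cext_inv /ext_cocycle /=; move: (hK _ _) (hK _ _) => a b.
rewrite -addrA -opprD -mulrzDr => /(mem_shift (b + a) y).
by rewrite subrK.
Qed.

Lemma residual_mem t x : residual t -> M (t, x).
Proof.
move=> [z /standard_part0_rot[y yi tE]].
suff : M (rot y, 1%g) by rewrite -tE => /(mem_shift z x); rewrite subrK.
have [S [sS SP]] := coset_transversal (fun y => (rot y, 1%g)).
(* The fibre over 1 is a subgroup of the circle because the cocycle values, being multiples of g,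
   are absorbed by [mem_shift]. *)
pose C := [set t : SO2 K | M (t, 1%g)].
apply: (rot_subgroup_infinitesimal K_sat (C := C) sA sS) yi.
- by move=> a b Ca Cb; apply: (memD (x := 1%g)) => //; apply: (memN (x := 1%g)).
- move=> sigma sb sid a Ca; rewrite /C /= -(SL2_map1 sigma).
  exact: (M_inv sb sid Ca).
- move=> a; have [b Sb [[r m] Mm /(congr1 fst) E]] := SP a; exists b => //.
  rewrite /C /mkset; have -> : rot a - rot b = r + ext_cocycle 1%g m.
    by rewrite [rot a]E /cext_op /fst addrAC [rot b + r]addrC addrK.
  exact: mem_shift Mm.
Qed.

End LowerBound.

(** * The least invariant subgroup of bounded index, and its quotient *)

Definition comp000 : set (SO2 K * SL2 K) := [set u | residual u.1].

Lemma residual_ext_cocycle x y : residual (ext_cocycle x y).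
Proof. exact: residual_mulz. Qed.

Lemma comp_subgroup : is_subgroup opK comp000.
Proof.
have rc := residual_ext_cocycle.
exists (cext_one ext_cocycle); split.
- exact: cext_op1l ext_cocycle2.
- exact: cext_op1r ext_cocycle2.
- exact: residualN (rc _ _).
- by move=> u v ur vr; apply: residualD (rc _ _); apply: residualD.
- move=> u ur; exists (cext_inv ext_cocycle u).
  rewrite cext_mulV // (cext_mulVl ext_cocycle2); split=> //.
  by apply: residualB (rc _ _); apply: residualB (rc _ _); apply: residualN.
Qed.

(** A ring endomorphism of [K] preserves the order, so the iterates of a moved point are strictly
    monotone: they would be infinitely many roots of one rational polynomial. *)
Lemma automorphism_algebraic (sigma : {rmorphism K -> K}) (x : R) :
  algebraicOver (ratr : rat -> R) x -> sigma (iota x) = iota x.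
Proof.
move=> [p p0 px]; pose q : {poly K} := map_poly ratr p.
have q0 : q != 0 by rewrite map_poly_eq0.
pose y k := iter k sigma (iota x).
have root_y k : root q (y k).
  elim: k => [|k IH].
    have -> : q = map_poly iota (map_poly ratr p).
      by rewrite -map_poly_comp; apply: eq_map_poly => a /=; rewrite fmorph_rat.
    by rewrite fmorph_root.
  have -> : q = map_poly sigma q.
    by rewrite -map_poly_comp; apply: eq_map_poly => a /=; rewrite fmorph_rat.
  by rewrite /y iterS fmorph_root.
apply/eqP; apply: contraT => neq.
have yinj : injective y.
  move: neq; rewrite neq_lt => /orP[lt|lt].
    have yS k : y k.+1 < y k.
      by elim: k => [|k IH] //; rewrite /y !(iterS _ sigma) QE.ltr_rcf_morph.
    have ylt i j : (i < j)%N -> y j < y i.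
      elim: j => // j IH; rewrite ltnS leq_eqVlt => /predU1P[->//|/IH ji].
      exact: lt_trans (yS j) ji.
    move=> i j yij; apply/eqP; rewrite eqn_leq [(i <= j)%N]leqNgt [(j <= i)%N]leqNgt.
    by apply/andP; split; apply/negP => /ylt; rewrite yij ltxx.
  have yS k : y k < y k.+1.
    by elim: k => [|k IH] //; rewrite /y !(iterS _ sigma) QE.ltr_rcf_morph.
  have ylt i j : (i < j)%N -> y i < y j.
    elim: j => // j IH; rewrite ltnS leq_eqVlt => /predU1P[->//|/IH ij].
    exact: lt_trans ij (yS j).
  move=> i j yij; apply/eqP; rewrite eqn_leq [(i <= j)%N]leqNgt [(j <= i)%N]leqNgt.
  by apply/andP; split; apply/negP => /ylt; rewrite yij ltxx.
have := max_poly_roots q0 (rs := mkseq y (size q)).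
rewrite size_mkseq ltnn; apply; last exact: mkseq_uniq.
by apply/allP => _ /mapP[k _ ->].
Qed.

Lemma automorphism_g (sigma : {rmorphism K -> K}) : SO2_map sigma gK = gK.
Proof. by apply: SO2_eqP; rewrite !SO2_mapE; apply: automorphism_algebraic. Qed.

Lemma comp_invariant A : Aut_invariant A comp000.
Proof.
move=> sigma _ _ [t x] [z /standard_part0_rot[y yi tE]]; exists z => /=.
rewrite -(automorphism_g sigma) -SO2_map_mulz -SO2_mapB tE rot_map.
exact/standard_part_rot/infinitesimal_morph.
Qed.

(** The cocycle values are residual, so a coset is determined by the first coordinate modulo
    [residual]. The same holds on the right, whence normality. *)
Lemma lcoset_comp u : lcoset opK comp000 u = [set v | residual (v.1 - u.1)].
Proof.
have rc := residual_ext_cocycle; case: u => t x; apply/seteqP; split.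
  move=> _ [[s y] sr <-] /=; rewrite addrAC [t + s]addrC addrK.
  exact: residualD.
move=> [s y] /= sr; exists (s - t - ext_cocycle x (x^-1 * y)%g, (x^-1 * y)%g).
  exact: residualB (rc _ _).
by rewrite /cext_op /= mulVKg addrA subrK addrC subrK.
Qed.

Lemma rcoset_comp u : rcoset opK comp000 u = [set v | residual (v.1 - u.1)].
Proof.
have rc := residual_ext_cocycle; case: u => t x; apply/seteqP; split.
  move=> _ [[s y] sr <-] /=; rewrite addrAC addrK.
  exact: residualD.
move=> [s y] /= sr; exists (s - t - ext_cocycle (y * x^-1)%g x, (y * x^-1)%g).
  exact: residualB (rc _ _).
by rewrite /cext_op /= -mulgA mulVg mulg1 -addrA addrACA addNr addr0 subrK.
Qed.

Lemma comp_normal : is_normal opK comp000.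
Proof. by move=> u; rewrite lcoset_comp rcoset_comp. Qed.

Lemma residualP t r : standard_part iota t r -> residual t <-> cyclic_subgroup g r.
Proof.
have st_g z : standard_part iota (gK *~ z) (g *~ z).
  by rewrite -SO2_map_mulz; apply: standard_part_iota.
move=> tr; split=> [[z tz]|[z _ zr]].
  exists z => //; apply/eqP; rewrite eq_sym -subr_eq0; apply/eqP.
  exact: standard_part_uniq (standard_partB tr (st_g z)) tz.
by exists z; have := standard_partB tr (st_g z); rewrite zr subrr.
Qed.

Lemma residual_iota t r : standard_part iota t r -> residual (t - SO2_map iota r).
Proof.
move=> tr; exists 0; rewrite mulr0z subr0.
by have := standard_partB tr (standard_part_iota iota r); rewrite subrr.
Qed.

Lemma small_SO2 : small K [set: SO2 R].
Proof.
apply: small_card_le K_large; apply/card_ge_setTP.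
(* The closed upper half circle goes to [-1, 1] and the open lower half into (2, 4). *)
exists (fun r : SO2 R => if 0 <= r 1 0 then r 0 0 else r 0 0 + 3); split=> // r q.
have [r0 _] := SO2_entry_le1 r; have [q0 _] := SO2_entry_le1 q.
have rn := SO2_norm r; have qn := SO2_norm q.
move: r0 q0; rewrite !ler_norml => /andP[r1 r2] /andP[q1 q2].
have sq : r 0 0 = q 0 0 -> r 1 0 ^+ 2 = q 1 0 ^+ 2.
  by move=> E; rewrite -rn E in qn; move/addrI: qn.
case: leP => r10; case: leP => q10 E.
- apply: SO2_eqP => //; apply/eqP; rewrite -(eqrXn2 (n := 2)) //; exact/eqP/sq.
- exfalso; lra.
- exfalso; lra.
- have {}E : r 0 0 = q 0 0 by apply: addIr E.
  apply: SO2_eqP => //; apply/eqP; rewrite -eqr_opp.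
  rewrite -(eqrXn2 (n := 2)) ?oppr_ge0 ?ltW // !sqrrN; exact/eqP/sq.
Qed.

Lemma comp_bounded : bounded_index opK comp000.
Proof.
apply: small_sub (small_image (fun r : SO2 R =>
  [set v : SO2 K * SL2 K | residual (v.1 - SO2_map iota r)]) small_SO2).
move=> _ [[t x] _ <-]; have [r tr] := standard_part_exists iota t.
exists r => //; rewrite lcoset_comp /=; apply/seteqP.
have E (v : SO2 K * SL2 K) : v.1 - SO2_map iota r = (v.1 - t) + (t - SO2_map iota r).
  by rewrite addrA subrK.
split=> v /=; rewrite E => vr; last by apply: residualD vr (residual_iota tr).
by rewrite -(addrK (t - SO2_map iota r) (v.1 - t)); apply: residualB (residual_iota tr).
Qed.

Lemma comp_is_comp000 A : small K A -> is_comp000 opK A comp000.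
Proof.
move=> sA; split; first by split; [exact: comp_subgroup | exact: comp_invariant | exact: comp_bounded].
by move=> M [Msub Minv Mb] [t x]; apply: (residual_mem Msub sA Minv Mb).
Qed.

(** The half-turn has order 2, so it is not in the torsion-free group Z g; being standard, it is not
    residual either. *)
Lemma comp_neqT : comp000 <> setT.
Proof.
move=> E; have rn : (-1 : R) ^+ 2 + 0 ^+ 2 = 1 by ring.
have : residual (SO2_map iota (rotation rn)).
  have : comp000 (SO2_map iota (rotation rn), 1%g) by rewrite E.
  by [].
move=> /(residualP (standard_part_iota iota _))[z _ gz].
have r2 : rotation rn + rotation rn = 0.
  by apply: SO2_eqP; rewrite SO2_addE !rotation00 !rotation10 SO2_0E; ring.
have r0 : rotation rn <> 0.
  by move=> /(congr1 (fun t : SO2 R => t 0 0)); rewrite rotation00 SO2_0E => ?;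
    clear E; lra.
have z0 : z <> 0 by move=> z0; apply: r0; rewrite -gz z0 mulr0z.
have gn n : (0 < n)%N -> g *~ n%:Z <> 0 by rewrite -pmulrn; apply: g_order.
move: r2; rewrite -gz -mulrzDr => g2; case: z z0 g2 {gz} => n n0.
  by rewrite -PoszD; apply: gn; rewrite addn_gt0 orbb lt0n; apply/eqP => n00;
    apply: n0; rewrite n00.
by rewrite NegzE -opprD mulrNz => /eqP; rewrite oppr_eq0 -PoszD => /eqP; apply: gn.
Qed.

Definition comp_quotient (B : set (SO2 K * SL2 K)) : set (SO2 R) :=
  [set r | exists2 v, B v & standard_part iota v.1 r].

Lemma comp_quotient_lcoset t x r : standard_part iota t r ->
  comp_quotient (lcoset opK comp000 (t, x)) = lcoset +%R (cyclic_subgroup g) r.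
Proof.
move=> tr; rewrite lcoset_comp; apply/seteqP; split=> q.
  move=> [[s y] /= sr sq]; have st := standard_partB sq tr.
  move/(residualP st): sr => qr; exists (q - r) => //.
  by rewrite addrC subrK.
move=> [c cg <-]; exists (t + SO2_map iota c, 1%g) => /=; last first.
  exact: standard_partD tr (standard_part_iota iota c).
rewrite addrC addKr; apply/(residualP (standard_part_iota iota c)); exact: cg.
Qed.

Lemma comp_coset_eq t x s y : residual (t - s) ->
  lcoset opK comp000 (t, x) = lcoset opK comp000 (s, y).
Proof.
move=> ts; rewrite !lcoset_comp; apply/seteqP.
have E (v : SO2 K * SL2 K) : v.1 - s = (v.1 - t) + (t - s) by rewrite addrA subrK.
split=> v /= vr; first by rewrite E; apply: residualD.
by rewrite -(addrK (t - s) (v.1 - t)) -E; apply: residualB.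
Qed.

Lemma set_op_lcoset u v : set_op opK (lcoset opK comp000 u) (lcoset opK comp000 v) =
  lcoset opK comp000 (opK u v).
Proof.
have rc := residual_ext_cocycle.
rewrite !lcoset_comp; case: u v => [t x] [s y]; apply/seteqP; split.
  move=> _ [[a a'] /= ar [[b b'] /= br <-]];
    rewrite /cext_op /= opprD addrACA opprD (addrACA a).
  by apply: residualD (residualB (rc _ _) _) => //; apply: residualD.
move=> [w w'] /= wr; exists (w - s - ext_cocycle w' 1%g, w'); last first.
  exists (s, 1%g); first by rewrite /= subrr; apply: residual0.
  by rewrite /cext_op /= mulg1 addrAC !subrK.
rewrite /= addrAC; apply: residualB (rc _ _).
rewrite -(subrK (ext_cocycle x y) (w - s - t)); apply: residualD (rc _ _).
by move: wr; rewrite !opprD !addrA (addrAC w).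
Qed.

Lemma set_op_cyclic (r q : SO2 R) :
  set_op +%R (lcoset +%R (cyclic_subgroup g) r) (lcoset +%R (cyclic_subgroup g) q) =
  lcoset +%R (cyclic_subgroup g) (r + q).
Proof.
apply/seteqP; split.
  move=> _ [_ [_ [z _ <-] <-] [_ [_ [z' _ <-] <-] <-]].
  by exists (g *~ (z + z')); [exists (z + z') | rewrite mulrzDr addrACA].
move=> _ [_ [z _ <-] <-]; exists (r + g *~ z); first by exists (g *~ z) => //; exists z.
by exists q; [exists 0; [exists 0 | rewrite addr0] | rewrite addrAC].
Qed.

Lemma comp_quotient_iso :
  quotient_iso opK +%R comp000 (cyclic_subgroup g) comp_quotient.
Proof.
have rcyc (r q : SO2 R) : lcoset +%R (cyclic_subgroup g) r =
    lcoset +%R (cyclic_subgroup g) q -> cyclic_subgroup g (r - q).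
  move=> E; have : lcoset +%R (cyclic_subgroup g) r r.
    by exists 0; [exists 0 | rewrite addr0].
  by rewrite E => -[_ [z _ <-] <-]; exists z => //; rewrite addrC addKr.
split; last first.
  move=> _ _ [[t x] _ <-] [[s y] _ <-].
  have [r tr] := standard_part_exists iota t; have [q sq] := standard_part_exists iota s.
  rewrite set_op_lcoset (comp_quotient_lcoset _ tr) (comp_quotient_lcoset _ sq).
  rewrite set_op_cyclic -(comp_quotient_lcoset (x * y)%g (standard_partD tr sq)).
  congr comp_quotient; apply: comp_coset_eq.
  by rewrite addrC addKr; apply: residual_ext_cocycle.
split.
- move=> _ [[t x] _ <-]; have [r tr] := standard_part_exists iota t.
  by rewrite (comp_quotient_lcoset _ tr); exists r.
- move=> B B' /set_mem[[t x] _ <-] /set_mem[[s y] _ <-].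
  have [r tr] := standard_part_exists iota t; have [q sq] := standard_part_exists iota s.
  rewrite (comp_quotient_lcoset _ tr) (comp_quotient_lcoset _ sq) => /rcyc rq.
  by apply: comp_coset_eq; apply/(residualP (standard_partB tr sq)).
- move=> _ [r _ <-]; exists (lcoset opK comp000 (SO2_map iota r, 1%g)).
    by exists (SO2_map iota r, 1%g).
  by apply: comp_quotient_lcoset; apply: standard_part_iota.
Qed.


(** * Type-definable subgroups of bounded index *)

Lemma map_formula_fix (sigma : K -> K) (A : set K) (f : GRing.formula K) :
  (forall a, A a -> sigma a = a) -> formula_over A f -> map_formula sigma f = f.
Proof.
move=> sA; have tA (t : GRing.term K) : term_over A t -> map_term sigma t = t.
  elim: t => //=.
  - by move=> a /sA ->.
  - by move=> t IHt u IHu [/IHt -> /IHu ->].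
  - by move=> t IHt /IHt ->.
  - by move=> t IHt n /IHt ->.
  - by move=> t IHt u IHu [/IHt -> /IHu ->].
  - by move=> t IHt /IHt ->.
  - by move=> t IHt n /IHt ->.
elim: f => //=.
- by move=> t u [/tA -> /tA ->].
- by move=> t /tA ->.
- by move=> f IHf f' IHf' [/IHf -> /IHf' ->].
- by move=> f IHf f' IHf' [/IHf -> /IHf' ->].
- by move=> f IHf f' IHf' [/IHf -> /IHf' ->].
- by move=> f IHf /IHf ->.
- by move=> i f IHf /IHf ->.
- by move=> i f IHf /IHf ->.
Qed.

(** Through this invariance the lower bound applies to type-definable subgroups. *)
Lemma type_definable_invariant (A : set K) (p : set (GRing.formula K))
    (M : set (SO2 K * SL2 K)) : p `<=` formula_over A ->
  (forall u, M u <-> forall f, p f -> GRing.holds (coords u.1 ++ coords u.2) f) ->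
  Aut_invariant A M.
Proof.
move=> pA Mp sigma _ sA u /Mp up; apply/Mp => f pf.
have E : coords (SO2_map sigma u.1) ++ coords (SL2_map sigma u.2) =
    map sigma (coords u.1 ++ coords u.2).
  by rewrite map_cat -coords_map /coords !SO2_mapE.
rewrite -(map_formula_fix sA (pA f pf)) [X in GRing.holds X](E).
exact/QE.holds_map_formula/up.
Qed.

(** Over K the multiples of g come within every standard distance of [t]. Positivity of the first
    entry keeps the difference away from the half-turn, so that [rotE] applies. *)
Lemma cyclic_approx_K (t : SO2 K) n : exists z : int,
  0 < (gK *~ z - t) 0 0 /\ `|(gK *~ z - t) 1 0| < n.+1%:R^-1.
Proof.
have [r tr] := standard_part_exists iota t.
pose d := n.+1%:R^-1 : R.
have d01 : 0 < d <= 1 by rewrite invr_gt0 ltr0Sn invf_le1 ?ltr0Sn // ler1n.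
(* The addition formula turns two errors d/4 into d/2; the other half of d absorbs the infinitesimal
   error of the standard part. *)
have /andP[d0 d1] := d01; have e0 : 0 < d / 4 by rewrite divr_gt0.
have [z [z0 z1]] := cyclic_approx g_order r e0; exists z.
have st : standard_part iota (gK *~ z - t) (g *~ z - r).
  by apply: standard_partB tr; rewrite -SO2_map_mulz; apply: standard_part_iota.
have [s0 s1] := (standard_partE iota _ _).1 st.
have [r0 r1] := SO2_entry_le1 r.
have small_comb (a b x y : R) : `|a| < d / 4 -> `|b| < d / 4 -> `|x| <= 1 -> `|y| <= 1 ->
    `|a * x - b * y| < d / 2.
  move=> a4 b4 x1 y1; apply: le_lt_trans (ler_normB _ _) _; rewrite !normrM.
  have : `|a| * `|x| <= `|a| by rewrite ler_piMr.
  have : `|b| * `|y| <= `|b| by rewrite ler_piMr.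
  lra.
have q1 : `|(g *~ z - r) 1 0| < d / 2.
  have -> : (g *~ z - r) 1 0 = ((g *~ z) 1 0 - r 1 0) * r 0 0 - ((g *~ z) 0 0 - r 0 0) * r 1 0.
    by rewrite SO2_addE !SO2_oppE; ring.
  exact: small_comb.
have q0 : 1 / 2 < (g *~ z - r) 0 0.
  have : `|((g *~ z) 0 0 - r 0 0) * r 0 0 - ((g *~ z) 1 0 - r 1 0) * - r 1 0| < d / 2.
    by apply: small_comb => //; rewrite normrN.
  have -> : ((g *~ z) 0 0 - r 0 0) * r 0 0 - ((g *~ z) 1 0 - r 1 0) * - r 1 0 =
      (g *~ z - r) 0 0 - 1.
    by rewrite SO2_addE !SO2_oppE -(SO2_norm r); ring.
  by rewrite ltr_norml => /andP[lo _]; lra.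
have := s0 1%N; have := s1 (2 * n.+1).-1.
rewrite (_ : (2 * n.+1).-1.+1 = (2 * n.+1)%N) // natrM invfM.
move: q0 q1; rewrite -(QE.ltr_rcf_morph iota) -(QE.ltr_rcf_morph iota (`|_|)) rcf_morph_norm.
rewrite !fmorph_div rmorph1 !rmorph_nat /d fmorphV rmorph_nat.
move: (iota _) (iota _) ((gK *~ z - t) 0 0) ((gK *~ z - t) 1 0) (n.+1%:R^-1 : K).
move=> a b x y c; rewrite !ltr_norml => qa /andP[b1 b2] /andP[y1 y2] /andP[x1 x2].
by split; [lra | apply/andP; split; lra].
Qed.

(* By density of the multiples of g, every neighbourhood of t meets the fibre of M
   over x; saturation yields such a point infinitely close to t, and M contains the
   infinitesimal rotations. *)
Lemma type_definable_full (M : set (SO2 K * SL2 K)) : is_subgroup opK M ->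
  type_definable M -> bounded_index opK M -> forall u, M u.
Proof.
move=> Msub [A [p [sA pA Mp]]] Mb [t x].
have Minv := type_definable_invariant pA Mp.
have resM := residual_mem Msub sA Minv Mb.
(* The filter of small half-angle coordinates s such that t + rot s lies in the fibre of M over x.
   It is proper since some z g is close to t and M contains (z g, x). *)
pose F : set_system K := [set X | exists n, forall s,
  `|s| < n.+1%:R^-1 -> M (t + rot s, x) -> X s].
have FF : ProperFilter F.
  split.
    move=> [n]; have [z [z0 z1]] := cyclic_approx_K t n.
    pose s := (gK *~ z - t) 1 0 / (1 + (gK *~ z - t) 0 0).
    move=> /(_ s); apply.
      apply: le_lt_trans z1; rewrite /s normrM ler_piMr // ger0_norm ?invr_ge0;
        last by lra.
      by rewrite invf_le1; lra.
    rewrite /s -rotE; last by rewrite gt_eqF //; lra.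
    by rewrite addrC subrK; apply/resM/residual_mulz.
  split.
  - by exists 0%N.
  - move=> X Y [n Xn] [m Ym]; exists (maxn n m) => s sb Ms; split.
      by apply: Xn => //; apply: lt_le_trans sb _; rewrite invS_le ?leq_maxl.
    by apply: Ym => //; apply: lt_le_trans sb _; rewrite invS_le ?leq_maxr.
  - by move=> X Y XY [n Xn]; exists n => s sb Ms; apply: XY; apply: Xn.
pose X0 := GRing.Var K 0; pose T (a : K) := GRing.Const a; pose N n := GRing.NatConst K n.
(* The entries of t + rot s are rational functions of s over the entries of t; [e0] and [e1] form
   the first column. *)
pose D := GRing.Inv (GRing.Add (N 1%N) (GRing.Exp X0 2)).
pose c := GRing.Mul (GRing.Add (N 1%N) (GRing.Opp (GRing.Exp X0 2))) D.
pose d := GRing.Mul (GRing.Mul (N 2%N) X0) D.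
pose e0 := GRing.Add (GRing.Mul (T (t 0 0)) c) (GRing.Opp (GRing.Mul (T (t 1 0)) d)).
pose e1 := GRing.Add (GRing.Mul (T (t 1 0)) c) (GRing.Mul (T (t 0 0)) d).
pose ts := [:: e0; GRing.Opp e1; e1; e0] ++ map T (coords x).
have tsE s : map (GRing.eval [:: s]) ts = coords (t + rot s) ++ coords x.
  have [r11 r10] := SO2_entries (t + rot s).
  have r01 : (t + rot s) 0 1 = - (t + rot s) 1 0 by rewrite r10 opprK.
  rewrite /coords r11 r01 !SO2_addE !rotation00 !rotation10 /=.
  by [].
(* Together these bounds say that s is infinitesimal, a condition that only infinitely many formulas
   can express. *)
pose lo n := pos_formula (GRing.Add (GRing.Inv (N n.+1)) X0).
pose hi n := pos_formula (GRing.Add (GRing.Inv (N n.+1)) (GRing.Opp X0)).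
pose q : set (GRing.formula K) := [set fsubsts ts f | f in p] `|` range lo `|` range hi.
pose B := A `|` [set` coords t ++ coords x].
have sB : small K B by apply: smallU => //; apply: small_seq.
have cB (i j : 'I_2) : B (t i j) /\ B (x i j).
  split; right; rewrite /= !inE;
    by case: (ord2E i) => ->; case: (ord2E j) => ->; rewrite eqxx ?orbT.
have [||s sq] := saturated_filter K_sat FF (p := q) sB.
- move=> _ [[[f pf <-]|[n _ <-]]|[n _ <-]]; last 2 first.
  + by do !split.
  + by do !split.
  apply: fsubsts_over; last by apply: formula_over_sub (pA f pf) => a; left.
  have [[t00 x00] [t10 x10]] := (cB 0 0, cB 1 0).
  have [[t01 x01] [t11 x11]] := (cB 0 1, cB 1 1).
  move=> [|[|[|[|[|[|[|[|i]]]]]]]] //=; rewrite ?nth_nil /=; tauto.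
- move=> _ [[[f pf <-]|[n _ <-]]|[n _ <-]].
  + exists 0%N => s _ /Mp Ms; apply/holds_fsubsts; rewrite tsE; exact: Ms.
  + exists n => s; rewrite ltr_norml => /andP[s1 _] _; apply/holds_pos.
    by rewrite /= addrC -ltrBlDr sub0r.
  + by exists n => s; rewrite ltr_norml => /andP[_ s1] _; apply/holds_pos;
    rewrite /= subr_gt0.
have si : infinitesimal s.
  move=> n; rewrite ltr_norml; apply/andP; split.
    have /holds_pos : GRing.holds [:: s] (lo n) by apply: sq; left; right; exists n.
    by rewrite /= addrC -ltrBlDr sub0r.
  have /holds_pos : GRing.holds [:: s] (hi n) by apply: sq; right; exists n.
  by rewrite /= subr_gt0.
have Ms : M (t + rot s, x).
  apply/Mp => f pf; rewrite -tsE; apply/holds_fsubsts/sq.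
  by left; left; exists f.
have rs : residual (- rot s).
  by apply: residualN; exists 0; rewrite mulr0z subr0; apply: standard_part_rot.
rewrite -(addrK (rot s) t).
exact: (memD Msub sA Minv Mb _ Ms (resM _ x rs)).
Qed.

Lemma full_is_comp00 : is_comp00 opK setT.
Proof.
have [opA fullS] := cext_group ext_cocycle2.
split; last by move=> M [Msub Mt Mb] u _; apply: type_definable_full.
split=> //.
- by exists set0, set0; split=> //; apply: small0.
- apply: small_sub (small1 K [set: SO2 K * SL2 K]) => _ [u _ <-]; apply/seteqP.
  split=> // v _; exists (opK (cext_inv ext_cocycle u) v) => //.
  by rewrite opA cext_mulV // (cext_op1l ext_cocycle2).
Qed.

End MainSetup.

Theorem theorem3p3 (R : realType)
  (h : SL2 R -> SL2 R -> int)
  (h_cocycle : cocycle2 h)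
  (h_finite : finite_set (range (fun xy : SL2 R * SL2 R => h xy.1 xy.2)))
  (phi : int -> GRing.formula R)
  (h_definable : forall n : int,
     range (fun xy : SL2 R * SL2 R => h xy.1 xy.2) n ->
     forall x y : SL2 R,
       h x y = n <-> GRing.holds (coords x ++ coords y) (phi n))
  (h_cover : iso_universal_cover_SL2 (cext_op h) snd)
  (g : SO2 R)
  (g_order : forall n : nat, (0 < n)%N -> g *+ n <> 0)
  (g_alg : forall i j : 'I_2, algebraicOver (ratr : rat -> R) (g i j))
  (K : rcfType)
  (K_sat : saturated K)
  (K_large : small K [set: R])
  (iota : {rmorphism R -> K}) :
  let hK := interp_cocycle iota
    (range (fun xy : SL2 R * SL2 R => h xy.1 xy.2)) phi in
  let opK : SO2 K * SL2 K -> SO2 K * SL2 K -> SO2 K * SL2 K :=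
    cext_op (fun x y => SO2_map iota g *~ hK x y) in
  [/\ is_group opK,
      is_comp00 opK setT &
      exists N : set (SO2 K * SL2 K),
        [/\ forall A : set K, small K A -> is_comp000 opK A N,
            N <> setT,
            is_normal opK N &
            exists (c : SO2 R) (f : set (SO2 K * SL2 K) -> set (SO2 R)),
              [/\ dense (cyclic_subgroup c),
                  quotient_iso opK +%R N (cyclic_subgroup c) f &
                  forall (t : SO2 K) (x : SL2 K) (r : SO2 R),
                    standard_part iota t r ->
                    f (lcoset opK N (t, x)) = lcoset +%R (cyclic_subgroup c) r]]].
Proof.
move=> hK opK; split.
- exact: cext_group (ext_cocycle2 h_cocycle h_finite h_definable g iota).
- exact: (full_is_comp00 h_cocycle h_finite h_definable h_cover g_order K_sat).
exists (comp000 g iota); split.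
- exact: (comp_is_comp000 h_cocycle h_finite h_definable h_cover g_alg K_sat K_large).
- exact: (comp_neqT g_order).
- exact: comp_normal.
exists g, (comp_quotient iota); split.
- exact: (cyclic_dense g_order).
- exact: comp_quotient_iso.
- move=> t x r; exact: comp_quotient_lcoset.
Qed.
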